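(* The reachability problem for layered grid graphs (given an $n\times n$ layered grid graph $G$ and two vertices $s,t$ of $G$, decide whether there is a directed path from $s$ to $t$ in $G$) belongs to $\mathrm{near}\text{-}\mathrm{SC}$. That is, for every constant $\epsilon>0$ it can be decided by a deterministic algorithm running simultaneously in time polynomial in $n$ and space $O(n^{\epsilon})$.
   Context: An $n\times n$ layered grid graph is a directed graph $G$ whose vertices are the lattice points $(i,j)$ with $0\le i,j\le n$ and in which every edge is of the form $(i,j)\to(i+1,j)$ (east) or $(i,j)\to(i,j+1)$ (north); any subset of such edges may be present. Space is measured in the standard model: the input is on a read-only tape, output on a write-only tape, and only the work tape counts toward space. $\mathrm{TISP}(t(n),s(n))$ is the class of languages decided by a deterministic Turing machine running simultaneously in time $O(t(n))$ and space $O(s(n))$. For fixed $\epsilon>0$, $\mathrm{near}\text{-}\mathrm{SC}_\epsilon:=\mathrm{TISP}(n^{O(1)},n^{\epsilon})$, and $\mathrm{near}\text{-}\mathrm{SC}:=\bigcap_{\epsilon>0}\mathrm{near}\text{-}\mathrm{SC}_\epsilon$. *)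

(* Defs.v *)
From Stdlib Require Import Reals List Arith Relation_Operators.
Import ListNotations.

(* An n x n layered grid graph: vertices (i,j), 0 <= i,j <= n.
   [east i j] says the edge (i,j) -> (i+1,j) is present (meaningful only
   for i < n, j <= n); [north i j] says (i,j) -> (i,j+1) is present
   (meaningful only for i <= n, j < n). *)
Record LGG := mkLGG {
  lgg_n : nat;
  east : nat -> nat -> bool;
  north : nat -> nat -> bool
}.

Definition vertex := (nat * nat)%type.

Definition is_vertex (G : LGG) (v : vertex) : Prop :=
  fst v <= lgg_n G /\ snd v <= lgg_n G.

Inductive edge (G : LGG) : vertex -> vertex -> Prop :=
| edge_east : forall i j, i < lgg_n G -> j <= lgg_n G -> east G i j = true ->
    edge G (i, j) (S i, j)
| edge_north : forall i j, i <= lgg_n G -> j < lgg_n G -> north G i j = true ->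
    edge G (i, j) (i, S j).

Definition reach (G : LGG) (s t : vertex) : Prop :=
  clos_refl_trans vertex (edge G) s t.

Definition unary (k : nat) : list bool := repeat true k ++ [false].

(* adjacency bits, row-major over vertices (i,j); bits of absent edge
   slots (on the boundary) are written as false *)
Definition enc_vertex (G : LGG) (i j : nat) : list bool :=
  [ (Nat.ltb i (lgg_n G) && east G i j)%bool ;
    (Nat.ltb j (lgg_n G) && north G i j)%bool ].

Definition enc_graph (G : LGG) : list bool :=
  flat_map (fun i => flat_map (fun j => enc_vertex G i j) (seq 0 (S (lgg_n G))))
           (seq 0 (S (lgg_n G))).

Definition enc_instance (G : LGG) (s t : vertex) : list bool :=
  unary (lgg_n G) ++ unary (fst s) ++ unary (snd s)
    ++ unary (fst t) ++ unary (snd t) ++ enc_graph G.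

Definition LGGR (w : list bool) : Prop :=
  exists (G : LGG) (s t : vertex),
    is_vertex G s /\ is_vertex G t /\ enc_instance G s t = w /\ reach G s t.

Inductive move := MoveL | MoveR | MoveS.

(* States are 0..nstates-1, work symbols 0..nsyms-1, blank = 0.
   The input head reads [Some b] on an input cell, [None] on the right
   end marker (position |w|). *)
Record TM := mkTM {
  nstates : nat;
  nsyms : nat;
  q_start : nat;
  q_acc : nat;
  q_rej : nat;
  delta : nat -> option bool -> nat -> (nat * nat * move * move)
  (* (state, input symbol, work symbol) |->
     (new state, written work symbol, input-head move, work-head move) *)
}.

Definition TM_wf (M : TM) : Prop :=
  q_start M < nstates M /\ q_acc M < nstates M /\ q_rej M < nstates M /\
  q_acc M <> q_rej M /\ 0 < nsyms M /\
  forall q x a, q < nstates M -> a < nsyms M ->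
    match delta M q x a with
    | (q', a', _, _) => q' < nstates M /\ a' < nsyms M
    end.

Record config := mkConfig {
  c_state : nat;
  c_ipos : nat;            (* input head position, in 0..|w| *)
  c_tape : nat -> nat;
  c_wpos : nat
}.

Definition init_config (M : TM) : config :=
  mkConfig (q_start M) 0 (fun _ => 0) 0.

Definition halted (M : TM) (c : config) : Prop :=
  c_state c = q_acc M \/ c_state c = q_rej M.

Definition move_input (n : nat) (d : move) (p : nat) : nat :=
  match d with
  | MoveL => pred p
  | MoveR => Nat.min (S p) n    (* cannot move past the end marker *)
  | MoveS => p
  end.

Definition move_work (d : move) (p : nat) : nat :=
  match d with
  | MoveL => pred p
  | MoveR => S p
  | MoveS => p
  end.

Definition step (M : TM) (w : list bool) (c : config) : config :=
  if (Nat.eqb (c_state c) (q_acc M) || Nat.eqb (c_state c) (q_rej M))%bool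
  then c
  else
    match delta M (c_state c) (nth_error w (c_ipos c)) (c_tape c (c_wpos c)) with
    | (q', a', di, dw) =>
        mkConfig q'
          (move_input (length w) di (c_ipos c))
          (fun k => if Nat.eqb k (c_wpos c) then a' else c_tape c k)
          (move_work dw (c_wpos c))
    end.

Fixpoint run (M : TM) (w : list bool) (t : nat) : config :=
  match t with
  | 0 => init_config M
  | S t' => step M w (run M w t')
  end.

Definition near_SC_eps (L : list bool -> Prop) (eps : R) : Prop :=
  exists M : TM, TM_wf M /\
  exists (k c N0 : nat) (d : R),
  forall w : list bool,
  exists t : nat,
    halted M (run M w t) /\
    (c_state (run M w t) = q_acc M <-> L w) /\
    (N0 <= length w ->
       t <= c * length w ^ k /\
       forall t', t' <= t ->
         (INR (S (c_wpos (run M w t'))) <= d * Rpower (INR (length w)) eps)%R).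

Definition near_SC (L : list bool -> Prop) : Prop :=
  forall eps : R, (0 < eps)%R -> near_SC_eps L eps.

(* Main.v *)
Require Import Defs.
From Stdlib Require Import Reals List Arith Lia Bool Relation_Operators Operators_Properties Lra.
Import ListNotations.

(* Put the vertex (i, j) in layer tau = i + j at position x = i: an edge leads to the next layer and
   keeps x or increases it by one.  Hence two paths between the same layers that start and end in
   opposite orders share a vertex.  Let FIND k compute, from (tau, x) and a bound j, the least
   position y >= j of layer tau + b^k that is reachable from x.  To get FIND (k+1), cut b^(k+1)
   layers into b strips and walk through them by calls of FIND k, always taking the leftmost
   position allowed by a mark kept for each cut.  When the walk gets stuck at x on cut i, the crossing
   property shows that no position <= x of cut i leads to the goal, so the mark of cut i becomes x + 1
   and the walk restarts.  Marks only grow, so each level multiplies the time by a polynomial, and it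
   stores b numbers.  With b about |w|^(1/K), depth K covers all layers in space about b^2.

   The algorithm is written in a small language of binary number registers and unary pointer
   registers, all laid out as bit tracks of one work tape; every instruction is one sweep of the head
   to the right and back to the left end. *)

(** * Sweeping machines *)

(** The obstacle is to meet both bounds at once: breadth-first search stores a whole layer, and
    recursive guessing of midpoints needs more than polynomial time. Here a single number per cut
    takes over the role of a set of visited vertices, and at most about [b * n] restarts occur per
    call of a level. The exponent comes out right because the least [b] with [|w| <= b ^ K]
    satisfies [(b - 1) ^ K < |w|]; with [2 <= K * eps] this gives [(b - 1) ^ 2 <= |w| ^ eps]. A mark
    is given [b + C] bits, far more than it needs, which spares the computation of a logarithm.
    Rounding the number of layers up to [b ^ K] is harmless since idle steps follow the layer of the
    target. Words that encode no instance have to be rejected within the same bounds, so parsing and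
    validation are part of the program. *)

Record instr := mkInstr {
  stop : nat -> bool;
  upd : nat -> nat;
  tst : option bool -> nat -> bool;
  imv : move;
  jt : nat;
  jf : nat
}.

(** The stopping cell [k] is itself updated. Reduction modulo [A] keeps every symbol in the alphabet
    whatever [upd] is. *)
Definition sweep (A : nat) (ins : instr) (k : nat) (tau : nat -> nat) : nat -> nat :=
  fun i => if i <=? k then upd ins (tau i) mod A else tau i.

(* States 0, 1, 2 accept, reject and start; state [3 + 3 pc + ph] executes instruction [pc], sweeping
   right for [ph = 0] and returning with test result true or false for [ph = 1, 2].  A tape symbol is
   [2 a + mark] with [a] the instruction-level symbol and [mark = 1] on cell 0 only.  A run past the
   last instruction accepts iff bit 1 of cell 0 is set. *)
Definition machine_delta (A : nat) (P : list instr) (q : nat) (x : option bool) (s : nat)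
  : nat * nat * move * move :=
  if q =? 2 then (3, 1, MoveS, MoveS)
  else
    let pc := (q - 3) / 3 in
    let a := s / 2 in
    let mark := s mod 2 in
    match nth_error P pc with
    | None => (if Nat.testbit a 1 then 0 else 1, s, MoveS, MoveS)
    | Some ins =>
      match (q - 3) mod 3 with
      | 0 => if stop ins a
             then (3 + 3 * pc + (if tst ins x a then 1 else 2),
                   2 * (upd ins a mod A) + mark, imv ins, MoveS)
             else (q, 2 * (upd ins a mod A) + mark, MoveS, MoveR)
      | ph => if mark =? 1
              then (3 + 3 * Nat.min (if ph =? 1 then jt ins else jf ins) (length P), s, MoveS, MoveS)
              else (q, s, MoveS, MoveL)
      end
    end.

Definition machine (A : nat) (P : list instr) : TM :=
  mkTM (6 + 3 * length P) (2 * A) 2 0 1 (machine_delta A P).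

(** Clipping jump targets to [length P] and reducing symbols modulo [A] make this true for every
    instruction list. *)
Lemma machine_wf A P : 0 < A -> TM_wf (machine A P).
Proof.
  intros HA. unfold TM_wf; cbn [nstates nsyms q_start q_acc q_rej machine delta].
  repeat split; try lia.
  intros q x a Hq Ha. unfold machine_delta.
  destruct (Nat.eqb_spec q 2); [split; lia|].
  assert (Hpc : (q - 3) / 3 <= length P).
  { apply Nat.lt_succ_r, Nat.Div0.div_lt_upper_bound; lia. }
  destruct (nth_error P ((q - 3) / 3)) as [ins|] eqn:EI.
  - assert (Hlt : (q - 3) / 3 < length P) by (apply nth_error_Some; congruence).
    pose proof (Nat.mod_upper_bound a 2 ltac:(lia)).
    pose proof (Nat.mod_upper_bound (upd ins (a / 2)) A ltac:(lia)).
    destruct ((q - 3) mod 3).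
    + destruct (stop ins (a / 2)); [destruct (tst ins x (a / 2))|]; split; lia.
    + destruct (a mod 2 =? 1); [|split; lia]. split; lia.
  - destruct (Nat.testbit (a / 2) 1); split; lia.
Qed.

(** * Simulation of single instructions *)

Section Simulation.
Variables (A : nat) (P : list instr) (w : list bool) (V : nat).
Let M := machine A P.

Definition steps (n : nat) (c : config) : config := Nat.iter n (step M w) c.

Definition within (n : nat) (c : config) : Prop :=
  forall i, i <= n -> c_wpos (steps i c) <= V.

Lemma steps_add n m c : steps (n + m) c = steps m (steps n c).
Proof. unfold steps. rewrite Nat.add_comm. apply Nat.iter_add. Qed.

Lemma within_add n m c : within n c -> within m (steps n c) -> within (n + m) c.
Proof.
  intros H1 H2 i Hi. destruct (le_lt_dec i n) as [h|h]; [auto|].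
  replace i with (n + (i - n)) by lia. rewrite steps_add. apply H2. lia.
Qed.

Lemma within_0 c : c_wpos c <= V -> within 0 c.
Proof. intros H i Hi. replace i with 0 by lia. exact H. Qed.

Definition tape_at (c : config) (tau : nat -> nat) : Prop :=
  forall k, c_tape c k = 2 * tau k + (if k =? 0 then 1 else 0).

Definition at_pc (c : config) (pc ip : nat) (tau : nat -> nat) : Prop :=
  c_state c = 3 + 3 * pc /\ c_wpos c = 0 /\ c_ipos c = ip /\ tape_at c tau.

Lemma step_delta c q a di dw :
  2 <= c_state c ->
  machine_delta A P (c_state c) (nth_error w (c_ipos c)) (c_tape c (c_wpos c)) = (q, a, di, dw) ->
  step M w c = mkConfig q (move_input (length w) di (c_ipos c))
                 (fun k => if k =? c_wpos c then a else c_tape c k) (move_work dw (c_wpos c)).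
Proof.
  intros H1 H2. unfold step, M, machine; cbn.
  destruct (Nat.eqb_spec (c_state c) 0); [lia|].
  destruct (Nat.eqb_spec (c_state c) 1); [lia|]. cbn. now rewrite H2.
Qed.

Lemma pc_div pc ph : ph < 3 -> (3 + 3 * pc + ph - 3) / 3 = pc.
Proof.
  intros. replace (3 + 3 * pc + ph - 3) with (ph + pc * 3) by lia.
  rewrite Nat.div_add by lia. rewrite Nat.div_small; lia.
Qed.

Lemma pc_mod pc ph : ph < 3 -> (3 + 3 * pc + ph - 3) mod 3 = ph.
Proof.
  intros. replace (3 + 3 * pc + ph - 3) with (ph + pc * 3) by lia.
  rewrite Nat.Div0.mod_add. apply Nat.mod_small; lia.
Qed.

Lemma cell_div a k : (2 * a + (if k =? 0 then 1 else 0)) / 2 = a.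
Proof.
  rewrite Nat.mul_comm, Nat.add_comm, Nat.div_add by lia.
  destruct (k =? 0); reflexivity.
Qed.

Lemma cell_mod a k : (2 * a + (if k =? 0 then 1 else 0)) mod 2 = if k =? 0 then 1 else 0.
Proof.
  rewrite Nat.mul_comm, Nat.add_comm, Nat.Div0.mod_add.
  destruct (k =? 0); reflexivity.
Qed.

Lemma sweep_right ins pc c tau :
  nth_error P pc = Some ins -> at_pc c pc (c_ipos c) tau ->
  forall k, (forall i, i < k -> stop ins (tau i) = false) -> k <= V ->
  let c' := steps k c in
  within k c /\ c_state c' = 3 + 3 * pc /\ c_wpos c' = k /\ c_ipos c' = c_ipos c /\
  tape_at c' (fun i => if i <? k then upd ins (tau i) mod A else tau i).
Proof.
  intros HI (Hq & Hw & _ & Ht). induction k as [|k IH]; intros Hs Hk c'.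
  - subst c'. cbn. repeat split; auto. apply within_0. lia.
  - destruct IH as (H1 & H2 & H3 & H4 & H5); [intros; apply Hs; lia|lia|].
    subst c'. replace (S k) with (k + 1) by lia. rewrite steps_add.
    set (d := steps k c) in *.
    assert (E : steps 1 d = mkConfig (3 + 3 * pc) (c_ipos c)
      (fun i => if i =? k then 2 * (upd ins (tau k) mod A) + (if k =? 0 then 1 else 0) else c_tape d i) (S k)).
    { cbn. rewrite <- H4, <- H3. rewrite (step_delta d (3 + 3 * pc)
        (2 * (upd ins (tau k) mod A) + (if k =? 0 then 1 else 0)) MoveS MoveR); [|lia|].
      - rewrite H3. reflexivity.
      - unfold machine_delta. rewrite H2, H3. rewrite (H5 k), cell_div, cell_mod.
        rewrite Nat.ltb_irrefl.
        replace (3 + 3 * pc) with (3 + 3 * pc + 0) by lia. rewrite pc_div, pc_mod by lia. rewrite HI.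
        destruct (Nat.eqb_spec (3 + 3 * pc + 0) 2); [lia|].
        rewrite Hs by lia. reflexivity. }
    split; [|rewrite E; cbn [c_state c_wpos c_ipos]; repeat split; try lia].
    + apply within_add; auto. intros i Hi. destruct i; [cbn; fold d; lia|].
      replace (S i) with 1 by lia. fold d. rewrite E. cbn. lia.
    + intros i. cbn [c_tape]. destruct (Nat.eqb_spec i k).
      * subst i. destruct (Nat.ltb_spec k (k + 1)); [reflexivity|lia].
      * rewrite H5. destruct (Nat.ltb_spec i k), (Nat.ltb_spec i (k + 1)); try lia.
Qed.

(** The mark on cell 0 is what ends the return: a left move on cell 0 leaves the head where it is,
    so the end cannot be felt otherwise. *)
Lemma sweep_back ins pc ph k : forall c tau,
  nth_error P pc = Some ins -> (ph = 1 \/ ph = 2) -> k <= V ->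
  c_state c = 3 + 3 * pc + ph -> c_wpos c = k -> tape_at c tau ->
  within (S k) c /\
  at_pc (steps (S k) c) (Nat.min (if ph =? 1 then jt ins else jf ins) (length P)) (c_ipos c) tau.
Proof.
  induction k as [|k IH]; intros c tau HI Hph Hk Hq Hw Ht.
  - assert (E : steps 1 c = mkConfig (3 + 3 * Nat.min (if ph =? 1 then jt ins else jf ins) (length P))
       (c_ipos c) (fun i => if i =? 0 then c_tape c 0 else c_tape c i) 0).
    { cbn. rewrite (step_delta c (3 + 3 * Nat.min (if ph =? 1 then jt ins else jf ins) (length P))
        (c_tape c 0) MoveS MoveS); [|lia|].
      - rewrite Hw. reflexivity.
      - unfold machine_delta. rewrite Hq, Hw, pc_div, pc_mod by lia. rewrite HI.
        assert (Hm : c_tape c 0 mod 2 = 1) by (rewrite (Ht 0); apply (cell_mod _ 0)). rewrite Hm.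
        destruct (Nat.eqb_spec (3 + 3 * pc + ph) 2); [lia|].
        destruct Hph; subst ph; reflexivity. }
    split.
    + intros i Hi. destruct i; [cbn; lia|]. replace (S i) with 1 by lia. rewrite E. cbn. lia.
    + rewrite E. repeat split. intros i. cbn [c_tape]. rewrite (Ht i). destruct (Nat.eqb_spec i 0); [subst i; apply (Ht 0)|reflexivity].
  - assert (E : steps 1 c = mkConfig (3 + 3 * pc + ph)
       (c_ipos c) (fun i => if i =? S k then c_tape c (S k) else c_tape c i) k).
    { cbn -[Nat.mul]. rewrite (step_delta c (3 + 3 * pc + ph)
        (c_tape c (S k)) MoveS MoveL); [|lia|].
      - rewrite Hw. reflexivity.
      - unfold machine_delta. rewrite Hq, Hw, pc_div, pc_mod by lia. rewrite HI.
        assert (Hm : c_tape c (S k) mod 2 = 0) by (rewrite (Ht (S k)); apply (cell_mod _ (S k))). rewrite Hm.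
        destruct (Nat.eqb_spec (3 + 3 * pc + ph) 2); [lia|].
        destruct Hph; subst ph; reflexivity. }
    destruct (IH (steps 1 c) tau) as [H1 H2]; auto; try lia.
    + rewrite E; reflexivity.
    + rewrite E; reflexivity.
    + rewrite E. intros i. cbn [c_tape]. destruct (Nat.eqb_spec i (S k)); subst; apply Ht.
    + replace (S (S k)) with (1 + S k) by lia. rewrite steps_add. split.
      * apply within_add; auto. intros i Hi. destruct i; [cbn; lia|].
        replace (S i) with 1 by lia. rewrite E. cbn. lia.
      * rewrite E in H2 at 2. exact H2.
Qed.

(** The cost is [k] steps to the right, one on the stopping cell and [k + 1] back. The input head
    moves only in the step on the stopping cell. *)
Lemma instr_sim ins pc c ip tau k :
  nth_error P pc = Some ins -> at_pc c pc ip tau ->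
  (forall i, i < k -> stop ins (tau i) = false) -> stop ins (tau k) = true -> k <= V ->
  exists n, n <= 2 * V + 2 /\ within n c /\
  at_pc (steps n c)
    (Nat.min (if tst ins (nth_error w ip) (tau k) then jt ins else jf ins) (length P))
    (move_input (length w) (imv ins) ip) (sweep A ins k tau).
Proof.
  intros HI Hc Hs Hk HkV. pose proof Hc as (Hq & Hw & Hip & Ht). subst ip.
  destruct (sweep_right ins pc c tau HI Hc k Hs HkV) as (H1 & H2 & H3 & H4 & H5).
  set (d := steps k c) in *.
  set (ph := if tst ins (nth_error w (c_ipos c)) (tau k) then 1 else 2).
  assert (E : steps 1 d = mkConfig (3 + 3 * pc + ph) (move_input (length w) (imv ins) (c_ipos c))
     (fun i => if i =? k then 2 * (upd ins (tau k) mod A) + (if k =? 0 then 1 else 0) else c_tape d i) k).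
  { cbn -[Nat.mul]. rewrite (step_delta d (3 + 3 * pc + ph)
      (2 * (upd ins (tau k) mod A) + (if k =? 0 then 1 else 0)) (imv ins) MoveS); [|lia|].
    - rewrite H3, H4. reflexivity.
    - unfold machine_delta. rewrite H2, H3, H4, (H5 k), cell_div, cell_mod, Nat.ltb_irrefl.
      replace (3 + 3 * pc) with (3 + 3 * pc + 0) by lia. rewrite pc_div, pc_mod by lia. rewrite HI.
      destruct (Nat.eqb_spec (3 + 3 * pc + 0) 2); [lia|].
      rewrite Hk. subst ph. destruct (tst ins _ _); f_equal; f_equal; f_equal; lia. }
  destruct (sweep_back ins pc ph k (steps 1 d) (sweep A ins k tau)) as [H6 H7]; auto.
  - subst ph. destruct (tst _ _ _); auto.
  - rewrite E; reflexivity.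
  - rewrite E; reflexivity.
  - rewrite E. intros i. cbn [c_tape]. unfold sweep. destruct (Nat.eqb_spec i k).
    + subst i. rewrite Nat.leb_refl. reflexivity.
    + rewrite H5. destruct (Nat.ltb_spec i k), (Nat.leb_spec i k); try lia.
  - exists (k + (1 + S k)). split; [lia|]. rewrite !steps_add. fold d. split.
    + apply within_add; auto. fold d. apply within_add; auto.
      intros i Hi. destruct i; [cbn; lia|]. replace (S i) with 1 by lia. rewrite E. cbn. lia.
    + rewrite E in H7 at 2. cbn [c_ipos] in H7.
      replace (if tst ins (nth_error w (c_ipos c)) (tau k) then jt ins else jf ins)
        with (if ph =? 1 then jt ins else jf ins); [exact H7|].
      subst ph. destruct (tst _ _ _); reflexivity.
Qed.

Lemma start_sim : 
  within 1 (init_config M) /\ at_pc (steps 1 (init_config M)) 0 0 (fun _ => 0).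
Proof.
  assert (E : steps 1 (init_config M) = mkConfig 3 0 (fun k => if k =? 0 then 1 else 0) 0) by reflexivity.
  split.
  - intros i Hi. destruct i; [cbn; lia|]. replace (S i) with 1 by lia. rewrite E. cbn. lia.
  - rewrite E. repeat split.
Qed.

(** Bit 1 of a symbol will be the track of number register 0, so acceptance reads the lowest digit
    of the flag. *)
Lemma end_sim c ip tau :
  at_pc c (length P) ip tau ->
  within 1 c /\ c_state (steps 1 c) = if Nat.testbit (tau 0) 1 then 0 else 1.
Proof.
  intros (Hq & Hw & Hip & Ht).
  assert (E : step M w c = mkConfig (if Nat.testbit (tau 0) 1 then 0 else 1) (c_ipos c)
       (fun i => if i =? 0 then c_tape c 0 else c_tape c i) 0).
  { rewrite (step_delta c (if Nat.testbit (tau 0) 1 then 0 else 1) (c_tape c 0) MoveS MoveS); [|lia|].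
    - rewrite Hw. reflexivity.
    - unfold machine_delta. rewrite Hq, Hw.
      replace (3 + 3 * length P) with (3 + 3 * length P + 0) by lia. rewrite pc_div by lia.
      destruct (Nat.eqb_spec (3 + 3 * length P + 0) 2); [lia|].
      rewrite (proj2 (nth_error_None P (length P))) by lia.
      assert (Hm : c_tape c 0 / 2 = tau 0) by (rewrite (Ht 0); apply (cell_div _ 0)).
      rewrite Hm. reflexivity. }
  split.
  - intros i Hi. destruct i; [cbn; lia|]. replace (S i) with 1 by lia. cbn. rewrite E. cbn. lia.
  - cbn. rewrite E. reflexivity.
Qed.

Lemma run_steps t : run M w t = steps t (init_config M).
Proof. induction t; cbn; [reflexivity|]. now rewrite IHt. Qed.

End Simulation.

(** * A register language and its compilation *)

Inductive atom :=
| Zero (r : nat) | Inc (r : nat) | Copy (r r' : nat)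
| PZero (p : nat) | PInc (p : nat) | PCopy (p p' : nat)
| SetBit (r p : nat) (v : bool)
| Mv (d : move).

Inductive test :=
| EqN (r r' : nat) | EqP (p p' : nat) | Bit (r p : nat) | InTrue | InEnd.

Inductive cmd :=
| Skip
| Do (a : atom)
| Seq (c d : cmd)
| If (t : test) (c d : cmd)
| While (v : bool) (t : test) (c : cmd).

Record st := mkSt { ip : nat; num : nat -> nat; ptr : nat -> nat }.

Definition set (f : nat -> nat) (r v : nat) : nat -> nat :=
  fun r' => if r' =? r then v else f r'.
Definition setn (s : st) (r v : nat) : st := mkSt (ip s) (set (num s) r v) (ptr s).
Definition setp (s : st) (p v : nat) : st := mkSt (ip s) (num s) (set (ptr s) p v).

Definition write (t : nat) (v : bool) (a : nat) : nat :=
  if v then Nat.setbit a t else Nat.clearbit a t.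

Definition atom_eff (w : list bool) (a : atom) (s : st) : st :=
  match a with
  | Zero r => setn s r 0
  | Inc r => setn s r (S (num s r))
  | Copy r r' => setn s r (num s r')
  | PZero p => setp s p 0
  | PInc p => setp s p (S (ptr s p))
  | PCopy p p' => setp s p (ptr s p')
  | SetBit r p v => setn s r (write (ptr s p) v (num s r))
  | Mv d => mkSt (move_input (length w) d (ip s)) (num s) (ptr s)
  end.

(** These conditions keep all registers on the cells up to [V]; zeroing, copying and moving never
    make a register outgrow that range. *)
Definition atom_ok (V : nat) (a : atom) (s : st) : Prop :=
  match a with
  | Inc r => S (num s r) < 2 ^ V
  | PInc p => ptr s p < V
  | SetBit r p v => ptr s p < V
  | _ => True
  end.

Definition test_val (w : list bool) (t : test) (s : st) : bool :=
  match t with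
  | EqN r r' => num s r =? num s r'
  | EqP p p' => ptr s p =? ptr s p'
  | Bit r p => Nat.testbit (num s r) (ptr s p)
  | InTrue => match nth_error w (ip s) with Some b => b | None => false end
  | InEnd => match nth_error w (ip s) with Some b => false | None => true end
  end.

(** The last index counts sweeps: one for an atom or a test, and one for the jump that closes a
    [then] branch or a loop body. For an [else] branch it overestimates by one. *)
Inductive exec (V : nat) (w : list bool) : cmd -> st -> st -> nat -> Prop :=
| ex_skip s : exec V w Skip s s 0
| ex_do a s : atom_ok V a s -> exec V w (Do a) s (atom_eff w a s) 1
| ex_seq c d s s' s'' n n' :
    exec V w c s s' n -> exec V w d s' s'' n' -> exec V w (Seq c d) s s'' (n + n')
| ex_if t c d s s' n :
    exec V w (if test_val w t s then c else d) s s' n -> exec V w (If t c d) s s' (n + 2)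
| ex_while_end v t c s :
    test_val w t s = negb v -> exec V w (While v t c) s s 1
| ex_while v t c s s' s'' n n' :
    test_val w t s = v -> exec V w c s s' n -> exec V w (While v t c) s' s'' n' ->
    exec V w (While v t c) s s'' (n + 2 + n').

(* Track 0 holds the unary width that bounds all number registers, track [1 + 2 r] the binary
   digits of number register [r], track [2 + 2 p] the unary value of pointer register [p]. *)
Definition wbit (a : nat) : bool := Nat.testbit a 0.
Definition nt (r : nat) : nat := 1 + 2 * r.
Definition pt (p : nat) : nat := 2 + 2 * p.
Definition nbit (r a : nat) : bool := Nat.testbit a (nt r).
Definition pbit (p a : nat) : bool := Nat.testbit a (pt p).

(** The sweep ends where the effect is complete: [Inc] at the first digit 0, which absorbs the
    carry, [Zero] and [Copy] at the end of the width track, pointer operations and [SetBit] at the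
    end of the unary blocks involved. *)
Definition atom_stop (a : atom) (x : nat) : bool :=
  match a with
  | Zero _ | Copy _ _ => negb (wbit x)
  | Inc r => negb (nbit r x)
  | PZero p | PInc p | SetBit _ p _ => negb (pbit p x)
  | PCopy p p' => negb (pbit p x) && negb (pbit p' x)
  | Mv _ => true
  end.

(** [Inc] and [SetBit] may create a new leading digit, so they extend the width track over every
    cell they visit. *)
Definition atom_upd (a : atom) (x : nat) : nat :=
  match a with
  | Zero r => write (nt r) false x
  | Copy r r' => write (nt r) (nbit r' x) x
  | Inc r => write 0 true (write (nt r) (negb (nbit r x)) x)
  | PZero p => write (pt p) false x
  | PInc p => write (pt p) true x
  | PCopy p p' => write (pt p) (pbit p' x) x
  | SetBit r p v => write 0 true (if pbit p x then x else write (nt r) v x)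
  | Mv _ => x
  end.

Definition atom_move (a : atom) : move := match a with Mv d => d | _ => MoveS end.

Definition test_stop (t : test) (x : nat) : bool :=
  match t with
  | EqN r r' => negb (wbit x) || xorb (nbit r x) (nbit r' x)
  | EqP p p' => negb (pbit p x) || negb (pbit p' x)
  | Bit r p => negb (pbit p x)
  | _ => true
  end.

(** Evaluated on the stopping cell. If [EqN] stops at the end of the width, both digits there are 0
    and agree; [EqP] answers yes iff both blocks end at the same cell. *)
Definition test_read (t : test) (i : option bool) (x : nat) : bool :=
  match t with
  | EqN r r' => eqb (nbit r x) (nbit r' x)
  | EqP p p' => eqb (pbit p x) (pbit p' x)
  | Bit r p => nbit r x
  | InTrue => match i with Some b => b | None => false end
  | InEnd => match i with Some b => false | None => true end
  end.

Definition atom_instr (a : atom) (next : nat) : instr :=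
  mkInstr (atom_stop a) (atom_upd a) (fun _ _ => true) (atom_move a) next next.

Definition test_instr (t : test) (n1 n2 : nat) : instr :=
  mkInstr (test_stop t) (fun x => x) (test_read t) MoveS n1 n2.

Definition atom_max (a : atom) : nat :=
  match a with
  | Zero r | Inc r | PZero r | PInc r => r
  | Copy r r' | PCopy r r' | SetBit r r' _ => r + r'
  | Mv _ => 0
  end.

Definition test_max (t : test) : nat :=
  match t with
  | EqN r r' | EqP r r' | Bit r r' => r + r'
  | _ => 0
  end.

Fixpoint cmd_max (c : cmd) : nat :=
  match c with
  | Skip => 0
  | Do a => atom_max a
  | Seq c d => Nat.max (cmd_max c) (cmd_max d)
  | If t c d => Nat.max (test_max t) (Nat.max (cmd_max c) (cmd_max d))
  | While _ t c => Nat.max (test_max t) (cmd_max c)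
  end.

Lemma least_stop (f : nat -> bool) k0 :
  f k0 = true -> exists k, k <= k0 /\ f k = true /\ forall i, i < k -> f i = false.
Proof.
  induction k0 as [k0 IH] using lt_wf_ind. intros H.
  destruct (existsb f (seq 0 k0)) eqn:E.
  - apply existsb_exists in E. destruct E as (k & Hin & Hk). apply in_seq in Hin.
    destruct (IH k) as (k' & H1 & H2 & H3); [lia|auto|]. exists k'. repeat split; auto; lia.
  - exists k0. repeat split; auto. intros i Hi. destruct (f i) eqn:Ei; auto.
    assert (existsb f (seq 0 k0) = true); [|congruence].
    apply existsb_exists. exists i. split; auto. apply in_seq. lia.
Qed.

Lemma write_bit t v a t' :
  Nat.testbit (write t v a) t' = if t' =? t then v else Nat.testbit a t'.
Proof.
  unfold write. destruct v.
  - rewrite Nat.setbit_eqb, Nat.eqb_sym. destruct (t' =? t); reflexivity.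
  - rewrite Nat.clearbit_eqb, Nat.eqb_sym. destruct (t' =? t); cbn; now rewrite ?andb_false_r, ?andb_true_r.
Qed.

Lemma bits_of_lt_pow2 a n i : a < 2 ^ n -> n <= i -> Nat.testbit a i = false.
Proof.
  intros H Hi. rewrite <- (Nat.mod_small a (2 ^ n)) by auto. now apply Nat.mod_pow2_bits_high.
Qed.

(** Carry propagation. The bound [2 ^ k <= S a] turns the overflow condition of [Inc] into a bound
    on the head position. *)
Lemma succ_bits k : forall a,
  (forall i, i < k -> Nat.testbit a i = true) -> Nat.testbit a k = false ->
  2 ^ k <= S a /\
  forall i, Nat.testbit (S a) i = if i <? k then false else (i =? k) || Nat.testbit a i.
Proof.
  induction k as [|k IH]; intros a H1 H2.
  - split; [cbn; lia|]. intros i. change (i <? 0) with false. cbv iota.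
    destruct (Nat.Even_or_Odd a) as [[q ->]|[q ->]].
    + replace (S (2 * q)) with (2 * q + 1) by lia. destruct i.
      * now rewrite Nat.testbit_odd_0.
      * rewrite Nat.testbit_odd_succ, Nat.testbit_even_succ by lia. reflexivity.
    + rewrite Nat.testbit_odd_0 in H2. discriminate.
  - destruct (Nat.Even_or_Odd a) as [[q ->]|[q ->]].
    + specialize (H1 0 ltac:(lia)). rewrite Nat.testbit_even_0 in H1. discriminate.
    + destruct (IH q) as [H3 H4].
      { intros i Hi. specialize (H1 (S i) ltac:(lia)). rewrite Nat.testbit_odd_succ in H1 by lia. auto. }
      { rewrite Nat.testbit_odd_succ in H2 by lia. auto. }
      replace (S (2 * q + 1)) with (2 * S q) by lia. split; [cbn [Nat.pow]; lia|].
      intros i. destruct i.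
      * rewrite Nat.testbit_even_0. reflexivity.
      * rewrite Nat.testbit_even_succ, Nat.testbit_odd_succ by lia. rewrite H4. reflexivity.
Qed.

(** * Registers as tracks of the work tape *)

Section Compile.
Variables (R : nat) (w : list bool) (V : nat).
(** The tracks are [0 .. 2 * R + 2]: the width, and one number and one pointer track for each index
    up to [R]. *)
Definition alphabet := 2 ^ (2 * R + 3).

(** The width [wd] is not part of the state: any value that covers the digits of all number
    registers will do, and it never shrinks. *)
Definition rep (tau : nat -> nat) (s : st) : Prop :=
  exists wd, wd <= V /\
  (forall k, wbit (tau k) = (k <? wd)) /\
  (forall r k, r <= R -> nbit r (tau k) = Nat.testbit (num s r) k) /\
  (forall r k, r <= R -> wd <= k -> Nat.testbit (num s r) k = false) /\
  (forall p k, p <= R -> pbit p (tau k) = (k <? ptr s p)) /\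
  (forall p, p <= R -> ptr s p <= V).

Lemma low_bits a t : t < 2 * R + 3 -> Nat.testbit (a mod alphabet) t = Nat.testbit a t.
Proof. apply Nat.mod_pow2_bits_low. Qed.

Ltac eqs := repeat match goal with
  | |- context [?a =? ?b] => destruct (Nat.eqb_spec a b); try lia
  end.

Ltac btest := repeat match goal with
  | |- context [?a <? ?b] => destruct (Nat.ltb_spec a b); try lia
  | |- context [?a <=? ?b] => destruct (Nat.leb_spec a b); try lia
  | |- context [?a =? ?b] => destruct (Nat.eqb_spec a b); try lia
  end.

(** Every update is local to a cell. The only information that travels is the carry of [Inc] and the
    position addressed by a pointer, and both are encoded in the place where the sweep stops. *)
Lemma atom_sim a s tau n :
  atom_max a <= R -> rep tau s -> atom_ok V a s ->
  exists k, k <= V /\ atom_stop a (tau k) = true /\ (forall i, i < k -> atom_stop a (tau i) = false) /\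
  rep (sweep alphabet (atom_instr a n) k tau) (atom_eff w a s).
Proof.
  intros Ha (wd & HV & Hw & Hn & Hz & Hp & HpV) Hok.
  assert (Hstop : exists k0, k0 <= V /\ atom_stop a (tau k0) = true).
  { destruct a; cbn [atom_stop atom_max atom_ok] in *.
    - exists wd. rewrite Hw. rewrite Nat.ltb_irrefl. auto.
    - exists wd. rewrite Hn, Hz by lia. auto.
    - exists wd. rewrite Hw. rewrite Nat.ltb_irrefl. auto.
    - exists (ptr s p). rewrite Hp by lia. rewrite Nat.ltb_irrefl. auto.
    - exists (ptr s p). rewrite Hp by lia. rewrite Nat.ltb_irrefl. auto.
    - exists (Nat.max (ptr s p) (ptr s p')). split.
      + specialize (HpV p) as h1; specialize (HpV p') as h2. lia.
      + rewrite !Hp by lia. btest; reflexivity.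
    - exists (ptr s p). rewrite Hp by lia. rewrite Nat.ltb_irrefl. split; [apply HpV; lia|reflexivity].
    - exists 0. split; [lia|reflexivity]. }
  destruct Hstop as (k0 & Hk0 & Hs0).
  destruct (least_stop (fun k => atom_stop a (tau k)) k0 Hs0) as (k & Hk & Hs & Hlt).
  exists k. split; [lia|]. split; [auto|]. split; [auto|].
  destruct a; cbn [atom_stop atom_max atom_ok atom_eff atom_instr] in *.
  - rewrite Hw in Hs. exists wd. unfold sweep, wbit, nbit, pbit; cbn [upd atom_instr].
    repeat split; auto; cbn [num ptr setn]; unfold set.
    + intros i. destruct (i <=? k); [|apply Hw].
      rewrite low_bits by lia. cbn [upd atom_instr atom_upd]. rewrite write_bit. unfold nt. eqs. apply Hw.
    (* Cells beyond the stopping cell lie outside the width, where every digit is already 0. *)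
    + intros r0 i Hr. assert (i <=? k = false -> Nat.testbit 0 i = nbit r (tau i)).
      { intros Hi. apply Nat.leb_gt in Hi. rewrite Hn by lia.
        destruct (Nat.ltb_spec k wd); [discriminate|]. rewrite Hz by lia. apply Nat.bits_0. }
      destruct (i <=? k) eqn:E.
      * unfold nt; rewrite low_bits by lia. cbn [upd atom_instr atom_upd]. rewrite write_bit. unfold nt.
        eqs; [rewrite Nat.bits_0; reflexivity|]. apply Hn; auto.
      * destruct (Nat.eqb_spec r0 r); [subst; symmetry; auto|]. apply Hn; auto.
    + intros r0 i Hr Hi. destruct (r0 =? r); [apply Nat.bits_0|auto].
    + intros p i Hpp. destruct (i <=? k); [|apply Hp; auto].
      unfold pt; rewrite low_bits by lia. cbn [upd atom_instr atom_upd]. rewrite write_bit. unfold nt, pt. eqs. apply Hp; auto.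
  - assert (Hk1 : forall i, i < k -> Nat.testbit (num s r) i = true).
    { intros i Hi. specialize (Hlt i Hi). cbn beta in Hlt. rewrite Hn in Hlt by lia.
      now apply negb_false_iff in Hlt. }
    assert (Hk2 : Nat.testbit (num s r) k = false).
    { rewrite Hn in Hs by lia. now apply negb_true_iff in Hs. }
    destruct (succ_bits k _ Hk1 Hk2) as [Hb1 Hb2].
    (* [2 ^ k <= num s r + 1 < 2 ^ V], so the extended width [S k] is still at most [V]. *)
    assert (HkV : k < V).
    { destruct (le_lt_dec V k); auto.
      pose proof (Nat.pow_le_mono_r 2 V k ltac:(lia) l). lia. }
    exists (Nat.max wd (S k)). unfold sweep, wbit, nbit, pbit; cbn [upd atom_instr].
    repeat split; auto; cbn [num ptr setn]; unfold set; [lia| | | |].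
    + intros i. destruct (Nat.leb_spec i k).
      * rewrite low_bits by lia. cbn [upd atom_instr atom_upd]. rewrite write_bit, Nat.eqb_refl. btest; reflexivity.
      * unfold wbit in Hw. rewrite Hw. btest; reflexivity.
    + intros r0 i Hr. destruct (Nat.leb_spec i k).
      * unfold nt; rewrite low_bits by lia. cbn [upd atom_instr atom_upd]. rewrite !write_bit. unfold nt. eqs.
        -- replace r0 with r by lia. rewrite Hb2, Hn by lia. btest; cbn.
           ++ rewrite Hk1; auto.
           ++ subst i. rewrite Hk2. reflexivity.
        -- apply Hn; auto.
      * destruct (Nat.eqb_spec r0 r); [subst r0|apply Hn; auto].
        rewrite Hb2. btest. apply Hn. auto.
    + intros r0 i Hr Hi. destruct (Nat.eqb_spec r0 r); [subst r0|apply Hz; auto; lia].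
      rewrite Hb2. btest. cbn. apply Hz; lia.
    + intros p i Hpp. destruct (i <=? k); [|apply Hp; auto].
      unfold pt; rewrite low_bits by lia. cbn [upd atom_instr atom_upd]. rewrite !write_bit. unfold nt, pt. eqs. apply Hp; auto.
  - rewrite Hw in Hs. exists wd. unfold sweep, wbit, nbit, pbit; cbn [upd atom_instr].
    repeat split; auto; cbn [num ptr setn]; unfold set.
    + intros i. destruct (i <=? k); [|apply Hw].
      rewrite low_bits by lia. cbn [upd atom_instr atom_upd]. rewrite write_bit. unfold nt. eqs. apply Hw.
    + intros r0 i Hr. destruct (Nat.leb_spec i k) as [E|E].
      * unfold nt; rewrite low_bits by lia. cbn [upd atom_instr atom_upd]. rewrite write_bit. unfold nt.
        eqs; apply Hn; lia.
      * destruct (Nat.ltb_spec k wd); [discriminate|].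
        change (nbit r0 (tau i) = Nat.testbit (if r0 =? r then num s r' else num s r0) i).
        rewrite Hn by auto. destruct (Nat.eqb_spec r0 r); [|reflexivity]. rewrite !Hz; auto; lia.
    + intros r0 i Hr Hi. destruct (r0 =? r); apply Hz; auto; lia.
    + intros p i Hpp. destruct (i <=? k); [|apply Hp; auto].
      unfold pt; rewrite low_bits by lia. cbn [upd atom_instr atom_upd]. rewrite write_bit. unfold nt, pt. eqs. apply Hp; auto.
  - rewrite Hp in Hs by lia. exists wd. unfold sweep, wbit, nbit, pbit; cbn [upd atom_instr].
    repeat split; auto; cbn [num ptr setp]; unfold set.
    + intros i. destruct (i <=? k); [|apply Hw].
      rewrite low_bits by lia. cbn [upd atom_instr atom_upd]. rewrite write_bit. unfold pt. eqs. apply Hw.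
    + intros r0 i Hr. destruct (i <=? k); [|apply Hn; auto].
      unfold nt; rewrite low_bits by lia. cbn [upd atom_instr atom_upd]. rewrite write_bit. unfold nt, pt. eqs. apply Hn; auto.
    + intros p0 i Hpp. destruct (Nat.leb_spec i k).
      * unfold pt; rewrite low_bits by lia. cbn [upd atom_instr atom_upd]. rewrite write_bit. unfold pt. eqs; [reflexivity|]. apply Hp; auto.
      * destruct (Nat.ltb_spec k (ptr s p)); [discriminate|].
        change (pbit p0 (tau i) = (i <? (if p0 =? p then 0 else ptr s p0))). rewrite Hp by auto.
        destruct (Nat.eqb_spec p0 p); [subst p0|reflexivity]. btest; reflexivity.
    + intros p0 Hpp. eqs. auto.
  - rewrite Hp in Hs by lia. exists wd. unfold sweep, wbit, nbit, pbit; cbn [upd atom_instr].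
    repeat split; auto; cbn [num ptr setp]; unfold set.
    + intros i. destruct (i <=? k); [|apply Hw].
      rewrite low_bits by lia. cbn [upd atom_instr atom_upd]. rewrite write_bit. unfold pt. eqs. apply Hw.
    + intros r0 i Hr. destruct (i <=? k); [|apply Hn; auto].
      unfold nt; rewrite low_bits by lia. cbn [upd atom_instr atom_upd]. rewrite write_bit. unfold nt, pt. eqs. apply Hn; auto.
    + assert (k = ptr s p).
      { destruct (Nat.ltb_spec k (ptr s p)); [discriminate|].
        destruct (Nat.eq_dec k (ptr s p)); auto. specialize (Hlt (ptr s p) ltac:(lia)). cbn beta in Hlt.
        rewrite Hp, Nat.ltb_irrefl in Hlt by lia. discriminate. }
      intros p0 i Hpp. destruct (Nat.leb_spec i k).
      * unfold pt; rewrite low_bits by lia. cbn [upd atom_instr atom_upd]. rewrite write_bit. unfold pt. eqs.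
        -- btest; reflexivity.
        -- apply Hp; auto.
      * change (pbit p0 (tau i) = (i <? (if p0 =? p then S (ptr s p) else ptr s p0))). rewrite Hp by auto.
        destruct (Nat.eqb_spec p0 p); [subst p0|reflexivity]. btest; reflexivity.
    + intros p0 Hpp. eqs. auto.
  - rewrite !Hp in Hs by lia. exists wd. unfold sweep, wbit, nbit, pbit; cbn [upd atom_instr].
    repeat split; auto; cbn [num ptr setp]; unfold set.
    + intros i. destruct (i <=? k); [|apply Hw].
      rewrite low_bits by lia. cbn [upd atom_instr atom_upd]. rewrite write_bit. unfold pt. eqs. apply Hw.
    + intros r0 i Hr. destruct (i <=? k); [|apply Hn; auto].
      unfold nt; rewrite low_bits by lia. cbn [upd atom_instr atom_upd]. rewrite write_bit. unfold nt, pt. eqs. apply Hn; auto.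
    + intros p0 i Hpp. destruct (Nat.leb_spec i k).
      * unfold pt; rewrite low_bits by lia. cbn [upd atom_instr atom_upd]. rewrite write_bit. unfold pt. eqs; apply Hp; auto; lia.
      * destruct (Nat.ltb_spec k (ptr s p)); [discriminate|].
        destruct (Nat.ltb_spec k (ptr s p')); [discriminate|].
        change (pbit p0 (tau i) = (i <? (if p0 =? p then ptr s p' else ptr s p0))). rewrite Hp by auto.
        destruct (Nat.eqb_spec p0 p); [subst p0|reflexivity]. btest; reflexivity.
    + intros p0 Hpp. destruct (p0 =? p); apply HpV; lia.
  - rewrite Hp in Hs by lia.
    assert (k = ptr s p).
    { destruct (Nat.ltb_spec k (ptr s p)); [discriminate|].
      destruct (Nat.eq_dec k (ptr s p)); auto. specialize (Hlt (ptr s p) ltac:(lia)). cbn beta in Hlt.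
      rewrite Hp, Nat.ltb_irrefl in Hlt by lia. discriminate. }
    exists (Nat.max wd (S k)). unfold sweep, wbit, nbit, pbit; cbn [upd atom_instr].
    repeat split; auto; cbn [num ptr setn]; unfold set; [lia| | | |].
    + intros i. destruct (Nat.leb_spec i k).
      * rewrite low_bits by lia. cbn [upd atom_instr atom_upd]. rewrite write_bit, Nat.eqb_refl. btest; reflexivity.
      * unfold wbit in Hw. rewrite Hw. btest; reflexivity.
    + intros r0 i Hr. destruct (Nat.leb_spec i k).
      * unfold nt; rewrite low_bits by lia. cbn [upd atom_instr atom_upd]. rewrite write_bit.
        destruct (Nat.eqb_spec (1 + 2 * r0) 0); [lia|]. rewrite Hp by lia.
        destruct (Nat.ltb_spec i (ptr s p)).
        -- destruct (Nat.eqb_spec r0 r); [|apply Hn; auto]. rewrite write_bit. eqs. subst r0. apply Hn; auto.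
        -- rewrite write_bit. unfold nt. eqs.
           ++ rewrite write_bit. eqs; reflexivity.
           ++ apply Hn; auto.
      * destruct (Nat.eqb_spec r0 r); [subst r0|apply Hn; auto].
        rewrite write_bit. eqs. apply Hn. auto.
    + intros r0 i Hr Hi. destruct (Nat.eqb_spec r0 r); [subst r0|apply Hz; auto; lia].
      rewrite write_bit. eqs. apply Hz; lia.
    + intros p0 i Hpp. destruct (i <=? k); [|apply Hp; auto].
      unfold pt; rewrite low_bits by lia. cbn [upd atom_instr atom_upd]. rewrite write_bit.
      destruct (Nat.eqb_spec (2 + 2 * p0) 0); [lia|].
      destruct (pbit p (tau i)); [apply Hp; auto|]. rewrite write_bit. unfold nt. eqs. apply Hp; auto.
  - exists wd. unfold sweep, wbit, nbit, pbit; cbn [upd atom_instr atom_upd].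
    repeat split; auto.
    + intros i. destruct (i <=? k); [|apply Hw]. rewrite low_bits by lia. apply Hw.
    + intros r0 i Hr. destruct (i <=? k); [|apply Hn; auto]. unfold nt; rewrite low_bits by lia. apply Hn; auto.
    + intros p i Hpp. destruct (i <=? k); [|apply Hp; auto]. unfold pt; rewrite low_bits by lia. apply Hp; auto.
Qed.

Lemma test_sim t s tau n1 n2 :
  test_max t <= R -> rep tau s ->
  exists k, k <= V /\ test_stop t (tau k) = true /\ (forall i, i < k -> test_stop t (tau i) = false) /\
  test_read t (nth_error w (ip s)) (tau k) = test_val w t s /\
  rep (sweep alphabet (test_instr t n1 n2) k tau) s.
Proof.
  intros Ht Hrep. pose proof Hrep as (wd & HV & Hw & Hn & Hz & Hp & HpV).
  assert (Hid : forall k, rep (sweep alphabet (test_instr t n1 n2) k tau) s).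
  { intros k. exists wd. unfold sweep, wbit, nbit, pbit; cbn [upd test_instr].
    repeat split; auto.
    + intros i. destruct (i <=? k); [|apply Hw]. rewrite low_bits by lia. apply Hw.
    + intros r0 i Hr. destruct (i <=? k); [|apply Hn; auto]. unfold nt; rewrite low_bits by lia. apply Hn; auto.
    + intros p i Hpp. destruct (i <=? k); [|apply Hp; auto]. unfold pt; rewrite low_bits by lia. apply Hp; auto. }
  assert (Hstop : exists k0, k0 <= V /\ test_stop t (tau k0) = true).
  { destruct t; cbn [test_stop test_max] in *.
    - exists wd. rewrite Hw. rewrite Nat.ltb_irrefl. auto.
    - exists (ptr s p). rewrite !Hp by lia. rewrite Nat.ltb_irrefl. split; [apply HpV; lia|reflexivity].
    - exists (ptr s p). rewrite Hp by lia. rewrite Nat.ltb_irrefl. split; [apply HpV; lia|reflexivity].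
    - exists 0. split; [lia|reflexivity].
    - exists 0. split; [lia|reflexivity]. }
  destruct Hstop as (k0 & Hk0 & Hs0).
  destruct (least_stop (fun k => test_stop t (tau k)) k0 Hs0) as (k & Hk & Hs & Hlt).
  exists k. split; [lia|]. split; [auto|]. split; [auto|]. split; [|auto].
  destruct t; cbn [test_stop test_max test_read test_val] in *; auto.
  - rewrite !Hn in * by lia. rewrite Hw in Hs.
    destruct (Nat.eqb_spec (num s r) (num s r')) as [E|E].
    + rewrite E. apply eqb_reflx.
    + destruct (Nat.ltb_spec k wd).
      * cbn in Hs. destruct (Nat.testbit (num s r) k), (Nat.testbit (num s r') k); cbn in *; congruence.
      (* Digits that agree below the width and vanish above it would make the two numbers equal. *)
      * exfalso. apply E. apply Nat.bits_inj. intros i. destruct (le_lt_dec wd i).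
        -- rewrite !Hz by lia. reflexivity.
        -- specialize (Hlt i ltac:(lia)). cbn beta in Hlt. rewrite !Hn in Hlt by lia.
           apply orb_false_iff in Hlt. destruct Hlt as [_ Hlt]. now apply xorb_eq.
  - rewrite !Hp in * by lia.
    assert (Hlt' : forall i, i < k -> i < ptr s p /\ i < ptr s p').
    { intros i Hi. specialize (Hlt i Hi). cbn beta in Hlt. rewrite !Hp in Hlt by lia.
      destruct (Nat.ltb_spec i (ptr s p)), (Nat.ltb_spec i (ptr s p')); try discriminate; auto. }
    assert (k <= ptr s p /\ k <= ptr s p').
    { destruct k; [lia|]. specialize (Hlt' k ltac:(lia)). lia. }
    destruct (Nat.ltb_spec k (ptr s p)), (Nat.ltb_spec k (ptr s p')), (Nat.eqb_spec (ptr s p) (ptr s p'));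
      try discriminate; try lia; reflexivity.
  - rewrite Hn, Hp in * by lia. f_equal.
    destruct (Nat.ltb_spec k (ptr s p)); [discriminate|].
    destruct (Nat.eq_dec k (ptr s p)); auto. specialize (Hlt (ptr s p) ltac:(lia)). cbn beta in Hlt.
    rewrite Hp, Nat.ltb_irrefl in Hlt by lia. discriminate.
Qed.

(** * Code generation and its correctness *)

Fixpoint code_size (c : cmd) : nat :=
  match c with
  | Skip => 0
  | Do _ => 1
  | Seq c d => code_size c + code_size d
  | If _ c d => 2 + code_size c + code_size d
  | While _ _ c => 2 + code_size c
  end.

Definition jump (l : nat) : instr := atom_instr (Mv MoveS) l.

(** [b] is the address of the first instruction, so that all jump targets are absolute. *)
Fixpoint code (c : cmd) (b : nat) : list instr :=
  match c with
  | Skip => []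
  | Do a => [atom_instr a (b + 1)]
  | Seq c d => code c b ++ code d (b + code_size c)
  | If t c d =>
      test_instr t (b + 1) (b + 2 + code_size c)
      :: code c (b + 1) ++ jump (b + 2 + code_size c + code_size d) :: code d (b + 2 + code_size c)
  | While v t c =>
      (if v then test_instr t (b + 1) (b + 2 + code_size c)
       else test_instr t (b + 2 + code_size c) (b + 1))
      :: code c (b + 1) ++ [jump b]
  end.

Lemma code_length c : forall b, length (code c b) = code_size c.
Proof.
  induction c; intros b; cbn; auto; rewrite ?length_app, ?IHc1, ?IHc2, ?IHc; cbn; rewrite ?IHc2; lia.
Qed.

Definition code_at (P : list instr) (b : nat) (l : list instr) : Prop :=
  exists l1 l2, P = l1 ++ l ++ l2 /\ length l1 = b.

Lemma code_at_app P b l l' : code_at P b (l ++ l') -> code_at P b l /\ code_at P (b + length l) l'.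
Proof.
  intros (l1 & l2 & -> & <-). split.
  - exists l1, (l' ++ l2). now rewrite <- !app_assoc.
  - exists (l1 ++ l), l2. rewrite length_app. now rewrite <- !app_assoc.
Qed.

Lemma code_at_cons P b i l :
  code_at P b (i :: l) -> nth_error P b = Some i /\ b < length P /\ code_at P (b + 1) l.
Proof.
  intros (l1 & l2 & -> & <-). repeat split.
  - rewrite nth_error_app2, Nat.sub_diag by lia. reflexivity.
  - rewrite !length_app. cbn. lia.
  - exists (l1 ++ [i]), l2. rewrite length_app. cbn. now rewrite <- !app_assoc.
Qed.

Lemma code_at_le P b l : code_at P b l -> b + length l <= length P.
Proof. intros (l1 & l2 & -> & <-). rewrite !length_app. lia. Qed.

Section Run.
Variable P : list instr.
Let A := alphabet.

Definition simulates (c : config) (pc : nat) (s : st) : Prop :=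
  exists tau, at_pc c pc (ip s) tau /\ rep tau s.

Definition moves (n : nat) (c : config) (pc : nat) (s : st) : Prop :=
  exists k, k <= n * (2 * V + 2) /\ within A P w V k c /\ simulates (steps A P w k c) pc s.

Lemma moves_trans n n' c pc s pc' s' :
  moves n c pc s ->
  (forall c', simulates c' pc s -> moves n' c' pc' s') ->
  moves (n + n') c pc' s'.
Proof.
  intros (k & H1 & H2 & H3) H. destruct (H _ H3) as (k' & H4 & H5 & H6).
  exists (k + k'). rewrite steps_add. repeat split; auto; [lia|]. apply within_add; [exact H2|exact H5].
Qed.

Lemma alphabet_pos : 0 < A.
Proof. unfold A, alphabet. pose proof (Nat.pow_nonzero 2 (2 * R + 3)). lia. Qed.

Lemma atom_moves a pc n c s :
  atom_max a <= R -> atom_ok V a s -> nth_error P pc = Some (atom_instr a n) -> n <= length P ->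
  simulates c pc s -> moves 1 c n (atom_eff w a s).
Proof.
  intros Ha Hok HI Hn (tau & H1 & H2).
  destruct (atom_sim a s tau n Ha H2 Hok) as (k & Hk & Hs & Hlt & Hr).
  destruct (instr_sim A P w V _ pc c _ tau k HI H1 Hlt Hs Hk) as (m & Hm & Hw & Hat).
  exists m. split; [lia|]. split; auto.
  exists (sweep A (atom_instr a n) k tau). split; [|exact Hr].
  cbn [atom_instr tst jt jf imv] in Hat. rewrite Nat.min_l in Hat by lia.
  replace (ip (atom_eff w a s)) with (move_input (length w) (atom_move a) (ip s)); [exact Hat|].
  destruct a; reflexivity.
Qed.

Lemma test_moves t pc n1 n2 c s :
  test_max t <= R -> nth_error P pc = Some (test_instr t n1 n2) -> n1 <= length P -> n2 <= length P ->
  simulates c pc s -> moves 1 c (if test_val w t s then n1 else n2) s.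
Proof.
  intros Ha HI Hn1 Hn2 (tau & H1 & H2).
  destruct (test_sim t s tau n1 n2 Ha H2) as (k & Hk & Hs & Hlt & Hv & Hr).
  destruct (instr_sim A P w V _ pc c _ tau k HI H1 Hlt Hs Hk) as (m & Hm & Hw & Hat).
  exists m. split; [lia|]. split; auto.
  exists (sweep A (test_instr t n1 n2) k tau). split; [|exact Hr].
  cbn [test_instr tst jt jf imv] in Hat. rewrite Hv, Nat.min_l in Hat; [exact Hat|].
  destruct (test_val w t s); lia.
Qed.

(** Induction on the execution rather than on the command, because the remaining rounds of a loop
    execute the same code again, from the same address and a new configuration. *)
Lemma exec_moves c s s' n :
  exec V w c s s' n -> cmd_max c <= R ->
  forall b cf, code_at P b (code c b) -> simulates cf b s -> moves n cf (b + code_size c) s'.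
Proof.
  induction 1 as [s|a s Hok|c d s s' s'' n n' H1 IH1 H2 IH2|t c d s s' n H IH|v t c s Hv|v t c s s' s'' n n' Hv H1 IH1 H2 IH2];
    cbn [cmd_max code code_size]; intros Hmax b cf Hc Hsim.
  - exists 0. split; [lia|]. rewrite Nat.add_0_r. split; auto.
    apply within_0. destruct Hsim as (tau & (_ & -> & _) & _). lia.
  - apply code_at_cons in Hc. destruct Hc as (Hn & Hb & _).
    eapply atom_moves; eauto; lia.
  - apply code_at_app in Hc. destruct Hc as [Hc Hd]. rewrite code_length in Hd.
    eapply moves_trans; [apply IH1; eauto; lia|]. intros c' Hc'.
    rewrite Nat.add_assoc. apply IH2; auto; lia.
  - pose proof (code_at_le _ _ _ Hc) as Hle. cbn [length] in Hle. rewrite length_app in Hle.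
    cbn [length] in Hle. rewrite !code_length in Hle.
    apply code_at_cons in Hc. destruct Hc as (Hn & Hb & Hc).
    apply code_at_app in Hc. destruct Hc as [Hc Hd]. rewrite code_length in Hd.
    apply code_at_cons in Hd. destruct Hd as (Hj & Hbj & Hd).
    replace (n + 2) with (1 + (n + 1)) by lia.
    eapply moves_trans; [eapply test_moves; eauto; lia|]. intros c' Hc'.
    destruct (test_val w t s).
    + eapply moves_trans; [apply IH; eauto; lia|]. intros c'' Hc''.
      replace (b + (2 + code_size c + code_size d)) with (b + 2 + code_size c + code_size d) by lia.
      apply (atom_moves (Mv MoveS) _ _ _ _ ltac:(cbn; lia) Logic.I Hj ltac:(lia)) in Hc''.
      destruct s'; exact Hc''.
    + replace (b + 1 + code_size c + 1) with (b + 2 + code_size c) in Hd by lia.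
      replace (b + (2 + code_size c + code_size d)) with (b + 2 + code_size c + code_size d) by lia.
      destruct (IH ltac:(lia) _ _ Hd Hc') as (k & Hk1 & Hk2).
      exists k. split; auto. lia.
  - pose proof (code_at_le _ _ _ Hc) as Hle. cbn [length] in Hle. rewrite length_app in Hle.
    cbn [length] in Hle. rewrite !code_length in Hle.
    apply code_at_cons in Hc. destruct Hc as (Hn & Hb & Hc).
    replace (b + (2 + code_size c)) with (b + 2 + code_size c) by lia.
    destruct v; eapply test_moves in Hn; eauto; try lia; rewrite Hv in Hn; exact Hn.
  - pose proof Hc as Hwhole.
    pose proof (code_at_le _ _ _ Hc) as Hle. cbn [length] in Hle. rewrite length_app in Hle.
    cbn [length] in Hle. rewrite !code_length in Hle.
    apply code_at_cons in Hc. destruct Hc as (Hn & Hb & Hc).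
    apply code_at_app in Hc. destruct Hc as [Hc Hd]. rewrite code_length in Hd.
    apply code_at_cons in Hd. destruct Hd as (Hj & Hbj & _).
    replace (n + 2 + n') with (1 + (n + (1 + n'))) by lia.
    apply moves_trans with (pc := b + 1) (s := s).
    { destruct v; eapply test_moves in Hn; eauto; try lia; rewrite Hv in Hn; exact Hn. }
    intros c1 Hc1. eapply moves_trans; [apply IH1; eauto; lia|].
    intros c2 Hc2. apply moves_trans with (pc := b) (s := s').
    { apply (atom_moves (Mv MoveS) _ _ _ _ ltac:(cbn; lia) Logic.I Hj ltac:(lia)) in Hc2.
      destruct s'; exact Hc2. }
    intros c3 Hc3. apply IH2; auto.
Qed.

End Run.
End Compile.

Definition init_st : st := mkSt 0 (fun _ => 0) (fun _ => 0).

Definition compiled (c : cmd) : TM := machine (alphabet (cmd_max c)) (code c 0).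

Lemma compiled_wf c : TM_wf (compiled c).
Proof. apply machine_wf. apply alphabet_pos. Qed.

Theorem compile_correct c V w s n :
  exec V w c init_st s n ->
  exists t, t <= n * (2 * V + 2) + 2 /\
    (forall t', t' <= t -> c_wpos (run (compiled c) w t') <= V) /\
    c_state (run (compiled c) w t) = if Nat.testbit (num s 0) 0 then 0 else 1.
Proof.
  intros He. set (A := alphabet (cmd_max c)). set (P := code c 0).
  destruct (start_sim A P w V) as [Hw0 Hs0].
  assert (Hsim : simulates (cmd_max c) V (steps A P w 1 (init_config (machine A P))) 0 init_st).
  { exists (fun _ => 0). split; [exact Hs0|]. exists 0. unfold wbit, nbit, pbit, init_st; cbn [num ptr].
    repeat split; intros; rewrite ?Nat.bits_0; try lia; try reflexivity. }
  assert (Hcode : code_at P 0 (code c 0)) by (exists [], []; now rewrite app_nil_r).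
  destruct (exec_moves (cmd_max c) w V P c _ _ _ He (le_n _) 0 _ Hcode Hsim) as (k & Hk & Hwk & Hsk).
  destruct Hsk as (tau & Hat & Hrep).
  assert (HP : 0 + code_size c = length P) by (unfold P; now rewrite code_length).
  rewrite HP in Hat. destruct (end_sim A P w V _ _ _ Hat) as [Hw2 Hs2].
  exists (1 + k + 1). split; [lia|].
  change (compiled c) with (machine A P).
  split.
  - intros t' Ht'. rewrite run_steps. revert t' Ht'.
    apply within_add; [apply within_add; auto|]. rewrite steps_add. auto.
  - rewrite run_steps, !steps_add. etransitivity; [exact Hs2|].
    destruct Hrep as (wd & _ & _ & Hn & _). rewrite <- (Hn 0 0) by lia. reflexivity.
Qed.

(** * Program logic with polynomial cost *)

(* A command costs at most [m ^ wt c] if each of its loops makes at most [m ^ 4] iterations. *)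
Fixpoint wt (c : cmd) : nat :=
  match c with
  | Skip | Do _ => 0
  | Seq c d => S (Nat.max (wt c) (wt d))
  | If _ c d => 2 + Nat.max (wt c) (wt d)
  | While _ _ c => 7 + wt c
  end.

(** The syntactic write sets. Through [frame] they supply everything about a final state that a
    specification does not mention. *)
Definition atom_wn (a : atom) (r : nat) : Prop :=
  match a with Zero r' | Inc r' | Copy r' _ | SetBit r' _ _ => r = r' | _ => False end.
Definition atom_wp (a : atom) (p : nat) : Prop :=
  match a with PZero p' | PInc p' | PCopy p' _ => p = p' | _ => False end.
Definition atom_wi (a : atom) : Prop := match a with Mv _ => True | _ => False end.

Fixpoint wn (c : cmd) (r : nat) : Prop :=
  match c with
  | Skip => False
  | Do a => atom_wn a r
  | Seq c d | If _ c d => wn c r \/ wn d r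
  | While _ _ c => wn c r
  end.
Fixpoint wp (c : cmd) (p : nat) : Prop :=
  match c with
  | Skip => False
  | Do a => atom_wp a p
  | Seq c d | If _ c d => wp c p \/ wp d p
  | While _ _ c => wp c p
  end.
Fixpoint wi (c : cmd) : Prop :=
  match c with
  | Skip => False
  | Do a => atom_wi a
  | Seq c d | If _ c d => wi c \/ wi d
  | While _ _ c => wi c
  end.

Definition frame (c : cmd) (s s' : st) : Prop :=
  (forall r, ~ wn c r -> num s' r = num s r) /\
  (forall p, ~ wp c p -> ptr s' p = ptr s p) /\
  (~ wi c -> ip s' = ip s).

Lemma frame_refl c s : frame c s s.
Proof. repeat split. Qed.

Lemma frame_trans c s s' s'' : frame c s s' -> frame c s' s'' -> frame c s s''.
Proof.
  intros (H1 & H2 & H3) (H4 & H5 & H6). repeat split; intros.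
  - now rewrite H4, H1.
  - now rewrite H5, H2.
  - now rewrite H6, H3.
Qed.

Lemma frame_sub c d s s' :
  frame c s s' -> (forall r, wn c r -> wn d r) -> (forall p, wp c p -> wp d p) -> (wi c -> wi d) ->
  frame d s s'.
Proof. intros (H1 & H2 & H3) A B C. repeat split; intros; auto. Qed.

Lemma frame_atom w a s : frame (Do a) s (atom_eff w a s).
Proof.
  repeat split; destruct a; cbn; intros; try tauto; unfold set;
    match goal with |- context [?a =? ?b] => destruct (Nat.eqb_spec a b); tauto end.
Qed.

Lemma exec_frame V w c s s' n : exec V w c s s' n -> frame c s s'.
Proof.
  induction 1 as [s|a s Hok|c d s s' s'' n n' H1 IH1 H2 IH2|t c d s s' n H IH|v t c s Hv|v t c s s' s'' n n' Hv H1 IH1 H2 IH2].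
  - apply frame_refl.
  - apply frame_atom.
  - eapply frame_trans; eapply frame_sub; eauto; cbn; auto.
  - destruct (test_val w t s); eapply frame_sub; eauto; cbn; auto.
  - apply frame_refl.
  - eapply frame_trans; eauto.
Qed.

Definition NFor (c r : nat) (body : cmd) : cmd :=
  Seq (Do (Zero c)) (While false (EqN c r) (Seq body (Do (Inc c)))).
Definition PFor (c r : nat) (body : cmd) : cmd :=
  Seq (Do (PZero c)) (While false (EqP c r) (Seq body (Do (PInc c)))).

Section Logic.
Variables (V : nat) (w : list bool) (m : nat).
Hypothesis m_ge : 2 <= m.

(** Total correctness together with a cost whose exponent depends on the command alone: the degree
    of the final polynomial is then fixed by the program text, and costs need no attention in the
    proofs about programs. *)
Definition runs (c : cmd) (s : st) (Q : st -> Prop) : Prop :=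
  exists s' n, exec V w c s s' n /\ n <= m ^ wt c /\ Q s'.

Lemma pow_pos e : 1 <= m ^ e.
Proof. pose proof (Nat.pow_nonzero m e). lia. Qed.

Lemma pow_le e e' : e <= e' -> m ^ e <= m ^ e'.
Proof. apply Nat.pow_le_mono_r. lia. Qed.

Lemma runs_skip s (Q : st -> Prop) : Q s -> runs Skip s Q.
Proof. intros H. exists s, 0. repeat split; auto; [constructor|lia]. Qed.

Lemma runs_do a s (Q : st -> Prop) : atom_ok V a s -> Q (atom_eff w a s) -> runs (Do a) s Q.
Proof. intros H1 H2. exists (atom_eff w a s), 1. repeat split; auto. now constructor. Qed.

Lemma runs_seq c d s Q : runs c s (fun s' => runs d s' Q) -> runs (Seq c d) s Q.
Proof.
  intros (s' & n & H1 & H2 & s'' & n' & H3 & H4 & H5). exists s'', (n + n').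
  repeat split; auto; [econstructor; eauto|]. cbn [wt Nat.pow].
  pose proof (pow_le (wt c) (Nat.max (wt c) (wt d)) ltac:(lia)).
  pose proof (pow_le (wt d) (Nat.max (wt c) (wt d)) ltac:(lia)). nia.
Qed.

Lemma runs_if t c d s Q :
  (test_val w t s = true -> runs c s Q) -> (test_val w t s = false -> runs d s Q) ->
  runs (If t c d) s Q.
Proof.
  intros Hc Hd.
  assert (H : exists s' n, exec V w (if test_val w t s then c else d) s s' n /\
    n <= m ^ Nat.max (wt c) (wt d) /\ Q s').
  { destruct (test_val w t s).
    - destruct (Hc eq_refl) as (s' & n & H1 & H2 & H3). exists s', n. repeat split; auto.
      pose proof (pow_le (wt c) (Nat.max (wt c) (wt d)) ltac:(lia)). lia.
    - destruct (Hd eq_refl) as (s' & n & H1 & H2 & H3). exists s', n. repeat split; auto.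
      pose proof (pow_le (wt d) (Nat.max (wt c) (wt d)) ltac:(lia)). lia. }
  destruct H as (s' & n & H1 & H2 & H3). exists s', (n + 2). repeat split; auto; [now constructor|].
  cbn [wt]. rewrite Nat.pow_add_r. pose proof (pow_pos (Nat.max (wt c) (wt d))).
  assert (4 <= m ^ 2) by (apply (Nat.pow_le_mono_l 2 m 2); lia). nia.
Qed.

Lemma runs_frame c s (Q : st -> Prop) :
  runs c s (fun s' => frame c s s' -> Q s') -> runs c s Q.
Proof.
  intros (s' & n & H1 & H2 & H3). exists s', n. repeat split; auto. apply H3.
  eapply exec_frame; eauto.
Qed.

Lemma runs_mono c s (Q Q' : st -> Prop) :
  runs c s Q -> (forall s', frame c s s' -> Q s' -> Q' s') -> runs c s Q'.
Proof.
  intros (s' & n & H1 & H2 & H3) H. exists s', n. repeat split; auto. apply H; auto.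
  eapply exec_frame; eauto.
Qed.

(** The measure bounds the number of rounds. The uniform budget [m ^ 4] is dictated by the search
    loop, whose measure is about [b * n * b]; every other loop makes at most [m] rounds. *)
Lemma runs_while v t c (Inv : st -> Prop) (mu : st -> nat) s Q :
  Inv s -> mu s <= m ^ 4 ->
  (forall s1, frame (While v t c) s s1 -> Inv s1 -> test_val w t s1 = v ->
     runs c s1 (fun s2 => Inv s2 /\ mu s2 < mu s1)) ->
  (forall s1, frame (While v t c) s s1 -> Inv s1 -> test_val w t s1 = negb v -> Q s1) ->
  runs (While v t c) s Q.
Proof.
  intros H0 Hmu Hstep Hend.
  assert (H : forall k s1, mu s1 <= k -> frame (While v t c) s s1 -> Inv s1 ->
    exists s2 n, exec V w (While v t c) s1 s2 n /\ n <= k * (m ^ wt c + 2) + 1 /\ Q s2).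
  { induction k as [|k IH]; intros s1 Hk Hf Hi.
    - destruct (bool_dec (test_val w t s1) v) as [E|E].
      + destruct (Hstep s1 Hf Hi E) as (s2 & n & _ & _ & _ & h). lia.
      + exists s1, 1. assert (test_val w t s1 = negb v) by (revert E; destruct (test_val w t s1), v; cbn; congruence).
        repeat split; auto. now constructor.
    - destruct (bool_dec (test_val w t s1) v) as [E|E].
      + destruct (Hstep s1 Hf Hi E) as (s2 & n & H1 & H2 & H3 & H4).
        destruct (IH s2) as (s3 & n' & H5 & H6 & H7); auto; [lia| |].
        * eapply frame_trans; eauto. eapply frame_sub; [eapply exec_frame; eauto|auto..].
        * exists s3, (n + 2 + n'). repeat split; auto; [econstructor; eauto|nia].
      + exists s1, 1. assert (test_val w t s1 = negb v) by (revert E; destruct (test_val w t s1), v; cbn; congruence).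
        repeat split; auto; [now constructor|lia]. }
  destruct (H (m ^ 4) s) as (s2 & n & H1 & H2 & H3); auto; [apply frame_refl|].
  exists s2, n. repeat split; auto.
  (* Of the exponent 7, four pay for the rounds and three for the overhead of tests and jumps. *)
  cbn [wt]. replace (7 + wt c) with (4 + (3 + wt c)) by lia. rewrite (Nat.pow_add_r m 4).
  pose proof (pow_pos 4). pose proof (pow_pos (wt c)).
  assert (m ^ wt c + 3 <= m ^ (3 + wt c)).
  { rewrite Nat.pow_add_r. assert (8 <= m ^ 3) by (apply (Nat.pow_le_mono_l 2 m 3); lia). nia. }
  nia.
Qed.

Lemma le_pow4 a : a <= m -> a <= m ^ 4.
Proof. intros. pose proof (pow_le 1 4 ltac:(lia)). rewrite Nat.pow_1_r in *. lia. Qed.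

(** The bound register is compared again in every round, so the body must preserve both it and the
    counter. The invariant is required for the state after the counter has been increased. *)
Lemma runs_nfor c r body (Inv : nat -> st -> Prop) s Q :
  c <> r -> ~ wn body c -> ~ wn body r -> num s r <= m -> num s r < 2 ^ V ->
  Inv 0 (setn s c 0) ->
  (forall i s1, i < num s r -> num s1 c = i -> frame (NFor c r body) s s1 -> Inv i s1 ->
     runs body s1 (fun s' => Inv (S i) (setn s' c (S i)))) ->
  (forall s', frame (NFor c r body) s s' -> num s' c = num s r -> Inv (num s r) s' -> Q s') ->
  runs (NFor c r body) s Q.
Proof.
  intros Hcr Hc Hr Hm HV H0 Hstep Hend.
  apply runs_seq. apply runs_do; [exact Logic.I|]. cbn [atom_eff].
  set (s0 := setn s c 0).
  assert (Hf0 : frame (NFor c r body) s s0).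
  { eapply frame_sub; [apply (frame_atom w (Zero c) s)|cbn; tauto..]. }
  assert (Hf : forall s1, frame (While false (EqN c r) (Seq body (Do (Inc c)))) s0 s1 -> frame (NFor c r body) s s1).
  { intros s1 h. eapply frame_trans; [exact Hf0|]. eapply frame_sub; eauto; cbn; tauto. }
  apply runs_while with (Inv := fun s1 => num s1 c <= num s r /\ num s1 r = num s r /\ Inv (num s1 c) s1)
     (mu := fun s1 => num s r - num s1 c).
  - cbn. unfold set. rewrite Nat.eqb_refl. destruct (Nat.eqb_spec r c); [lia|]. repeat split; auto. lia.
  - pose proof (le_pow4 _ Hm). lia.
  - intros s1 Hf1 (H1 & H2 & H3) Ht. cbn in Ht. apply Nat.eqb_neq in Ht.
    apply runs_seq. eapply runs_mono; [apply Hstep with (i := num s1 c); auto; lia|].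
    intros s2 (Hfn & _) Hinv. apply runs_do; [cbn; rewrite Hfn by auto; lia|].
    cbn [atom_eff]. rewrite Hfn by auto. set (s3 := setn s2 c (S (num s1 c))) in *.
    assert (E1 : num s3 c = S (num s1 c)) by (cbn; unfold set; now rewrite Nat.eqb_refl).
    assert (E2 : num s3 r = num s1 r).
    { cbn; unfold set. destruct (Nat.eqb_spec r c); [lia|]. auto. }
    rewrite E1, E2. repeat split; auto; lia.
  - intros s1 Hf1 (H1 & H2 & H3) Ht. cbn in Ht. apply Nat.eqb_eq in Ht.
    apply Hend; auto; [lia|]. replace (num s r) with (num s1 c) by lia. auto.
Qed.

Lemma runs_pfor c r body (Inv : nat -> st -> Prop) s Q :
  c <> r -> ~ wp body c -> ~ wp body r -> ptr s r <= m -> ptr s r <= V ->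
  Inv 0 (setp s c 0) ->
  (forall i s1, i < ptr s r -> ptr s1 c = i -> frame (PFor c r body) s s1 -> Inv i s1 ->
     runs body s1 (fun s' => Inv (S i) (setp s' c (S i)))) ->
  (forall s', frame (PFor c r body) s s' -> ptr s' c = ptr s r -> Inv (ptr s r) s' -> Q s') ->
  runs (PFor c r body) s Q.
Proof.
  intros Hcr Hc Hr Hm HV H0 Hstep Hend.
  apply runs_seq. apply runs_do; [exact Logic.I|]. cbn [atom_eff].
  set (s0 := setp s c 0).
  assert (Hf0 : frame (PFor c r body) s s0).
  { eapply frame_sub; [apply (frame_atom w (PZero c) s)|cbn; tauto..]. }
  assert (Hf : forall s1, frame (While false (EqP c r) (Seq body (Do (PInc c)))) s0 s1 -> frame (PFor c r body) s s1).
  { intros s1 h. eapply frame_trans; [exact Hf0|]. eapply frame_sub; eauto; cbn; tauto. }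
  apply runs_while with (Inv := fun s1 => ptr s1 c <= ptr s r /\ ptr s1 r = ptr s r /\ Inv (ptr s1 c) s1)
     (mu := fun s1 => ptr s r - ptr s1 c).
  - cbn. unfold set. rewrite Nat.eqb_refl. destruct (Nat.eqb_spec r c); [lia|]. repeat split; auto. lia.
  - pose proof (le_pow4 _ Hm). lia.
  - intros s1 Hf1 (H1 & H2 & H3) Ht. cbn in Ht. apply Nat.eqb_neq in Ht.
    apply runs_seq. eapply runs_mono; [apply Hstep with (i := ptr s1 c); auto; lia|].
    intros s2 (_ & Hfn & _) Hinv. apply runs_do; [cbn; rewrite Hfn by auto; lia|].
    cbn [atom_eff]. rewrite Hfn by auto. set (s3 := setp s2 c (S (ptr s1 c))) in *.
    assert (E1 : ptr s3 c = S (ptr s1 c)) by (cbn; unfold set; now rewrite Nat.eqb_refl).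
    assert (E2 : ptr s3 r = ptr s1 r).
    { cbn; unfold set. destruct (Nat.eqb_spec r c); [lia|]. auto. }
    rewrite E1, E2. repeat split; auto; lia.
  - intros s1 Hf1 (H1 & H2 & H3) Ht. cbn in Ht. apply Nat.eqb_eq in Ht.
    apply Hend; auto; [lia|]. replace (ptr s r) with (ptr s1 c) by lia. auto.
Qed.

End Logic.

(** * Arithmetic and array routines *)

Notation rFlag := 0 (only parsing).
Notation rZero := 1 (only parsing).
Notation rLen := 2 (only parsing).
Notation rN := 3 (only parsing).
Notation rTt := 4 (only parsing).
Notation rXt := 5 (only parsing).
Notation rT := 6 (only parsing).
Notation rX := 7 (only parsing).
Notation rJ := 8 (only parsing).
Notation rC := 9 (only parsing).
Notation rD := 10 (only parsing).
Notation rBad := 11 (only parsing).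
Notation rY := 12 (only parsing).
Notation rYt := 13 (only parsing).
Notation rE := 14 (only parsing).
Notation rK := 15 (only parsing).
Notation pB := 0 (only parsing).
Notation pW := 1 (only parsing).
Notation pS := 2 (only parsing).
Notation pU := 3 (only parsing).
Notation pV := 4 (only parsing).
Notation pI := 5 (only parsing).
Notation pZ := 6 (only parsing).

Notation "c ;; d" := (Seq c d) (at level 61, right associativity).

(** Only equality can be tested, so the counter runs through [0 .. a - 1] and the answer is no as
    soon as it meets [b]. *)
Definition LE (a b : nat) : cmd :=
  Do (Zero rFlag) ;; Do (Inc rFlag) ;;
  NFor rK a (If (EqN rK b) (Do (Zero rFlag)) Skip).

Definition ADD (d a : nat) : cmd := NFor rK a (Do (Inc d)).

(** Pointers have no arithmetic: the first bit position of entry [i] is counted out, [pW] (the entry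
    width) times for each smaller index. *)
Definition SEEK (i : nat) : cmd :=
  Do (PZero pS) ;; PFor pV i (PFor pU pW (Do (PInc pS))).

Definition LOAD (A i : nat) : cmd :=
  SEEK i ;; Do (Zero rJ) ;;
  PFor pU pW (If (Bit A pS) (Do (SetBit rJ pU true)) Skip ;; Do (PInc pS)).

(** The value written is [rX + 1], the new mark of a cut on which the walk is stuck at [rX]. *)
Definition STORE (A i : nat) : cmd :=
  Do (Copy rD rX) ;; Do (Inc rD) ;; SEEK i ;;
  PFor pU pW (If (Bit rD pU) (Do (SetBit A pS true)) (Do (SetBit A pS false)) ;; Do (PInc pS)).

(* Entry [i] of the array packed into the number [a]: its binary digits [i d, ..., i d + d - 1]. *)
Definition seg (d a i : nat) : nat := Nat.shiftr a (i * d) mod 2 ^ d.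

Lemma seg_bit d a i t : t < d -> Nat.testbit (seg d a i) t = Nat.testbit a (t + i * d).
Proof.
  intros. unfold seg. rewrite Nat.mod_pow2_bits_low by auto. apply Nat.shiftr_spec. lia.
Qed.

Lemma seg_eq d a i v :
  v < 2 ^ d -> (forall t, t < d -> Nat.testbit a (t + i * d) = Nat.testbit v t) -> seg d a i = v.
Proof.
  intros Hv H. apply Nat.bits_inj. intros t. destruct (le_lt_dec d t).
  - unfold seg. rewrite Nat.mod_pow2_bits_high by auto. symmetry. eapply bits_of_lt_pow2; eauto.
  - rewrite seg_bit; auto.
Qed.

Lemma seg_lt d a i : seg d a i < 2 ^ d.
Proof. unfold seg. apply Nat.mod_upper_bound. apply Nat.pow_nonzero. lia. Qed.

Lemma seg_0 d i : seg d 0 i = 0.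
Proof. unfold seg. rewrite Nat.shiftr_0_l. apply Nat.Div0.mod_0_l. Qed.

Ltac dec_eqb := repeat match goal with
  | |- context [?a =? ?b] =>
      first [replace (a =? b) with true by (symmetry; apply Nat.eqb_eq; lia)
            |replace (a =? b) with false by (symmetry; apply Nat.eqb_neq; lia)]
  end.
Ltac look := cbn [num ptr ip setn setp atom_eff]; unfold set; dec_eqb; cbv iota.

Section Macros.
Variables (V : nat) (w : list bool) (m : nat).
Hypothesis m_ge : 2 <= m.
Hypothesis V_ge : 1 <= V.
Notation runs := (runs V w m).

Lemma two_le_pow : 2 <= 2 ^ V.
Proof. apply (Nat.pow_le_mono_r 2 1 V); lia. Qed.

Lemma runs_LE a b s (Q : st -> Prop) :
  a <> rFlag -> a <> rK -> b <> rFlag -> b <> rK -> num s a <= m -> num s a < 2 ^ V ->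
  (forall s', frame (LE a b) s s' -> num s' rFlag = (if num s a <=? num s b then 1 else 0) -> Q s') ->
  runs (LE a b) s Q.
Proof.
  intros Ha Ha' Hb Hb' Hm HV HQ. apply runs_frame; auto.
  pose proof two_le_pow.
  destruct (Nat.eq_dec (num s a) 0) as [E0|E0].
  - apply runs_seq; auto. apply runs_do; [exact Logic.I|].
    apply runs_seq; auto. apply runs_do; [cbn; lia|].
    apply runs_nfor with (Inv := fun i s1 => num s1 rFlag = 1); auto; try (cbn; lia).
    + look. lia.
    + look. lia.
    + look. intros; lia.
    + intros s' _ _ H1 Hf. apply HQ; auto. rewrite E0. exact H1.
  - apply runs_seq; auto. apply runs_do; [exact Logic.I|].
    apply runs_seq; auto. apply runs_do; [cbn; lia|].
    apply runs_nfor with (Inv := fun i s1 => num s1 rFlag = if num s b <? i then 0 else 1); auto; try (cbn; lia).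
    + look. lia.
    + look. lia.
    + look. intros i s1 Hi Hc (Fn & _) Hinv. apply runs_if; auto; cbn [test_val]; intros Ht.
      * apply Nat.eqb_eq in Ht. revert Ht. rewrite (Fn b) by (cbn; lia). look. intros.
        apply runs_do; [exact Logic.I|]. look.
        destruct (Nat.ltb_spec (num s b) (S i)); lia.
      * apply Nat.eqb_neq in Ht. revert Ht. rewrite (Fn b) by (cbn; lia). look. intros.
        apply runs_skip; auto. look. rewrite Hinv.
        destruct (Nat.ltb_spec (num s b) i), (Nat.ltb_spec (num s b) (S i)); lia.
    + look. intros s' _ _ H1 Hf. apply HQ; auto. rewrite H1.
      destruct (Nat.ltb_spec (num s b) (num s a)), (Nat.leb_spec (num s a) (num s b)); lia.
Qed.

Lemma runs_ADD d a s (Q : st -> Prop) :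
  d <> a -> a <> rK -> d <> rK -> num s a <= m -> num s d + num s a < 2 ^ V ->
  (forall s', frame (ADD d a) s s' -> num s' d = num s d + num s a -> Q s') ->
  runs (ADD d a) s Q.
Proof.
  intros Hd Ha Hdk Hm HV HQ.
  apply runs_nfor with (Inv := fun i s1 => num s1 d = num s d + i); auto; try (cbn; lia).
  - look. lia.
  - intros i s1 Hi Hc Hf Hinv. apply runs_do; [cbn; lia|]. look. lia.
Qed.

Lemma runs_SEEK i s (Q : st -> Prop) :
  i <> pS -> i <> pU -> i <> pV -> ptr s i <= m -> ptr s i <= V -> ptr s pW <= m -> ptr s pW <= V ->
  ptr s i * ptr s pW <= V ->
  (forall s', frame (SEEK i) s s' -> ptr s' pS = ptr s i * ptr s pW -> Q s') ->
  runs (SEEK i) s Q.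
Proof.
  intros H1 H2 H3 H4 H5 H6 H7 H8 HQ. apply runs_frame; auto.
  apply runs_seq; auto. apply runs_do; [exact Logic.I|].
  apply runs_pfor with (Inv := fun k s1 => ptr s1 pS = k * ptr s pW); auto; try (cbn; lia); look; auto.
  intros k s1 Hk Hc (_ & Fp & _) Hinv.
  assert (EW : ptr s1 pW = ptr s pW) by (rewrite Fp by (cbn; lia); look; auto).
  apply runs_pfor with (Inv := fun l s2 => ptr s2 pS = k * ptr s pW + l); rewrite ?EW; auto; try (cbn; lia).
  - intros l s2 Hl Hc2 (_ & Fp2 & _) Hinv2. apply runs_do; [cbn|look; lia]. nia.
Qed.

Lemma runs_LOAD A i s (Q : st -> Prop) :
  A <> rJ -> i <> pS -> i <> pU -> i <> pV -> ptr s i <= m -> ptr s i <= V ->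
  ptr s pW <= m -> ptr s pW <= V -> (ptr s i + 1) * ptr s pW <= V ->
  (forall s', frame (LOAD A i) s s' -> num s' rJ = seg (ptr s pW) (num s A) (ptr s i) -> Q s') ->
  runs (LOAD A i) s Q.
Proof.
  intros HA H1 H2 H3 H4 H5 H6 H7 H8 HQ. apply runs_frame; auto.
  apply runs_seq; auto. apply runs_SEEK; auto; [nia|]. intros s1 (Fn & Fp & _) Hs1.
  assert (EW : ptr s1 pW = ptr s pW) by (apply Fp; cbn; lia).
  assert (EA : num s1 A = num s A) by (apply Fn; cbn; lia).
  apply runs_seq; auto. apply runs_do; [exact Logic.I|].
  set (base := ptr s i * ptr s pW) in *.
  apply runs_pfor with (Inv := fun k s2 => ptr s2 pS = base + k /\
     forall t, Nat.testbit (num s2 rJ) t = (t <? k) && Nat.testbit (num s A) (t + base)); auto; try (cbn; lia).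
  - look. split; [lia|]. intros t. now rewrite Nat.bits_0.
  - look. intros k s2 Hk Hc (Fn2 & Fp2 & _) [Hi1 Hi2].
    assert (EA2 : num s2 A = num s A) by (rewrite Fn2 by (cbn; lia); look; auto).
    assert (HV : base + ptr s pW <= V) by (unfold base; nia).
    apply runs_seq; auto. apply runs_if; auto; cbn [test_val]; rewrite EA2, Hi1; intros Ht.
    + apply runs_do; [cbn; lia|]. apply runs_do; [cbn; lia|]. look. split; [lia|].
      intros t. rewrite write_bit, Hc, Hi2. destruct (Nat.eqb_spec t k).
      * subst t. destruct (Nat.ltb_spec k (S k)); [|lia]. rewrite Nat.add_comm, Ht. reflexivity.
      * destruct (Nat.ltb_spec t k), (Nat.ltb_spec t (S k)); try lia; reflexivity.
    + apply runs_skip; auto. apply runs_do; [cbn; lia|]. look. split; [lia|].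
      intros t. rewrite Hi2. destruct (Nat.ltb_spec t k), (Nat.ltb_spec t (S k)); try lia; try reflexivity.
      replace t with k by lia. rewrite Nat.add_comm, Ht. reflexivity.
  - look. intros s2 _ _ [_ Hi2] Hf. apply HQ; auto. rewrite EW in Hi2.
    apply Nat.bits_inj. intros t. rewrite Hi2. destruct (Nat.ltb_spec t (ptr s pW)).
    + rewrite seg_bit by auto. reflexivity.
    + unfold seg. now rewrite Nat.mod_pow2_bits_high by auto.
Qed.

Lemma runs_STORE A i s (Q : st -> Prop) :
  A <> rD -> A <> rX -> i <> pS -> i <> pU -> i <> pV -> ptr s i <= m -> ptr s i <= V ->
  ptr s pW <= m -> ptr s pW <= V -> (ptr s i + 1) * ptr s pW <= V ->
  S (num s rX) < 2 ^ ptr s pW ->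
  (forall s', frame (STORE A i) s s' ->
     (forall k, seg (ptr s pW) (num s' A) k =
        if k =? ptr s i then S (num s rX) else seg (ptr s pW) (num s A) k) -> Q s') ->
  runs (STORE A i) s Q.
Proof.
  intros HA HA2 H1 H2 H3 H4 H5 H6 H7 H8 HX HQ. apply runs_frame; auto.
  assert (HXV : S (num s rX) < 2 ^ V).
  { pose proof (Nat.pow_le_mono_r 2 (ptr s pW) V ltac:(lia) ltac:(lia)). lia. }
  apply runs_seq; auto. apply runs_do; [exact Logic.I|].
  apply runs_seq; auto. apply runs_do; [cbn; lia|].
  apply runs_seq; auto. apply runs_SEEK; auto; [cbn; nia|]. look. intros s1 (Fn & Fp & _) Hs1.
  assert (EW : ptr s1 pW = ptr s pW) by (rewrite Fp by (cbn; lia); look; auto).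
  assert (EA : num s1 A = num s A) by (rewrite Fn by (cbn; lia); look; auto).
  assert (ED : num s1 rD = S (num s rX)) by (rewrite Fn by (cbn; lia); look; auto).
  set (base := ptr s i * ptr s pW) in *.
  apply runs_pfor with (Inv := fun k s2 => ptr s2 pS = base + k /\
     forall t, Nat.testbit (num s2 A) t =
       if (base <=? t) && (t <? base + k) then Nat.testbit (S (num s rX)) (t - base) else Nat.testbit (num s A) t);
    auto; try (cbn; lia).
  - look. split; [lia|]. intros t. rewrite EA. 
    destruct (Nat.leb_spec base t), (Nat.ltb_spec t (base + 0)); try lia; reflexivity.
  - intros k s2 Hk Hc (Fn2 & Fp2 & _) [Hi1 Hi2].
    assert (ED2 : num s2 rD = S (num s rX)) by (rewrite Fn2 by (cbn; lia); look; auto).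
    assert (HV : base + ptr s pW <= V) by (unfold base; nia).
    assert (Hb : forall t, (if t =? base + k then Nat.testbit (S (num s rX)) k else Nat.testbit (num s2 A) t) =
       if (base <=? t) && (t <? base + S k) then Nat.testbit (S (num s rX)) (t - base) else Nat.testbit (num s A) t).
    { intros t. rewrite Hi2. destruct (Nat.eqb_spec t (base + k)).
      - replace (t - base) with k by lia.
        destruct (Nat.leb_spec base t), (Nat.ltb_spec t (base + S k)); try lia; reflexivity.
      - destruct (Nat.leb_spec base t), (Nat.ltb_spec t (base + S k)), (Nat.ltb_spec t (base + k)); try lia; reflexivity. }
    apply runs_seq; auto. apply runs_if; auto; cbn [test_val]; rewrite ED2, Hc; intros Ht; rewrite Ht in Hb.
    + apply runs_do; [cbn; lia|]. apply runs_do; [cbn; lia|]. look. split; [lia|].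
      intros t. rewrite write_bit, Hi1. apply Hb.
    + apply runs_do; [cbn; lia|]. apply runs_do; [cbn; lia|]. look. split; [lia|].
      intros t. rewrite write_bit, Hi1. apply Hb.
  - intros s2 _ _ [_ Hi2] Hf. apply HQ; auto. rewrite EW in Hi2. intros k.
    destruct (Nat.eqb_spec k (ptr s i)) as [->|E].
    + apply seg_eq; auto. intros t Ht. rewrite Hi2. fold base. replace (t + base - base) with t by lia.
      destruct (Nat.leb_spec base (t + base)), (Nat.ltb_spec (t + base) (base + ptr s pW)); try lia; reflexivity.
    + apply seg_eq; [apply seg_lt|]. intros t Ht. rewrite Hi2, seg_bit by auto.
      destruct (Nat.leb_spec base (t + k * ptr s pW)), (Nat.ltb_spec (t + k * ptr s pW) (base + ptr s pW)); try reflexivity.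
      (* Different entries occupy disjoint ranges of bits. *)
      exfalso. unfold base in *. assert (k < ptr s i \/ ptr s i < k) as [h|h] by lia; nia.
Qed.

End Macros.

(** * Paths in layered graphs *)

Section Paths.
Variable E : nat -> nat -> nat -> Prop.
Hypothesis E_step : forall tau x y, E tau x y -> y = x \/ y = S x.

Fixpoint path (L tau x y : nat) : Prop :=
  match L with
  | 0 => x = y
  | S L => exists z, E tau x z /\ path L (S tau) z y
  end.

Lemma path_app L1 L2 : forall tau x y,
  path (L1 + L2) tau x y <-> exists z, path L1 tau x z /\ path L2 (tau + L1) z y.
Proof.
  induction L1 as [|L1 IH]; intros tau x y; cbn [Nat.add path].
  - rewrite Nat.add_0_r. split; [eauto|]. now intros (z & -> & H).
  - split.
    + intros (z & H1 & H2). apply IH in H2. destruct H2 as (z' & H2 & H3).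
      exists z'. split; [eauto|]. replace (tau + S L1) with (S tau + L1) by lia. auto.
    + intros (z' & (z & H1 & H2) & H3). exists z. split; auto. apply IH. exists z'. split; auto.
      replace (S tau + L1) with (tau + S L1) by lia. auto.
Qed.

(* Two paths whose order is reversed meet in a common vertex, since positions grow by at most
   one per layer. *)
Lemma path_cross L : forall tau x y x' y',
  path L tau x y -> path L tau x' y' -> x <= x' -> y' <= y -> path L tau x y'.
Proof.
  induction L as [|L IH]; intros tau x y x' y' H1 H2 Hx Hy.
  - cbn in *. lia.
  - destruct (Nat.eq_dec x x') as [->|Hne]; [auto|].
    destruct H1 as (z & H1 & H1'), H2 as (z' & H2 & H2').
    apply E_step in H2 as H4. apply E_step in H1 as H3.
    exists z. split; auto. eapply IH; eauto. lia.
Qed.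

Variables (b L tau x0 j : nat).

(** Both halves matter: a position below a mark may well lead to the goal, provided that no path
    from [x0] arrives there. *)
Definition alive (i y : nat) : Prop :=
  path (i * L) tau x0 y /\ exists z, j <= z /\ path ((b - i) * L) (tau + i * L) y z.

Lemma alive_next i y : i < b -> alive i y -> exists y', path L (tau + i * L) y y' /\ alive (S i) y'.
Proof.
  intros Hi (H1 & z & Hz & H2). replace ((b - i) * L) with (L + (b - S i) * L) in H2.
  - apply path_app in H2. destruct H2 as (y' & H2 & H3). exists y'. split; auto. split.
    + replace (S i * L) with (i * L + L) by lia. apply path_app. eauto.
    + exists z. split; auto. replace (tau + S i * L) with (tau + i * L + L) by lia. auto.
  - replace (b - i) with (S (b - S i)) by lia. lia.
Qed.

Lemma alive_prev i y' : i < b -> alive (S i) y' -> exists y, path L (tau + i * L) y y' /\ alive i y.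
Proof.
  intros Hi (H1 & z & Hz & H2). replace (S i * L) with (i * L + L) in H1 by lia.
  apply path_app in H1. destruct H1 as (y & H1 & H3). exists y. split; auto. split; auto.
  exists z. split; auto. replace ((b - i) * L) with (L + (b - S i) * L).
  - apply path_app. exists y'. split; auto. replace (tau + i * L + L) with (tau + S i * L) by lia. auto.
  - replace (b - i) with (S (b - S i)) by lia. lia.
Qed.

Lemma alive_last y : alive b y <-> path (b * L) tau x0 y /\ j <= y.
Proof.
  unfold alive. rewrite Nat.sub_diag. cbn [Nat.mul path]. split.
  - intros (H & z & Hz & ->). auto.
  - intros (H & Hz). split; auto. exists y. auto.
Qed.

Lemma alive_first y : alive 0 y -> y = x0.
Proof. intros [H _]. cbn in H. auto. Qed.

Variable r : nat -> nat.
Hypothesis r_last : r b = j.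
Hypothesis r_dead : forall i y, 1 <= i < b -> y < r i -> ~ alive i y.

Lemma alive_mark i y : 1 <= i <= b -> alive i y -> r i <= y.
Proof.
  intros Hi Ha. destruct (Nat.eq_dec i b) as [->|Hne].
  - apply alive_last in Ha. rewrite r_last. tauto.
  - destruct (le_lt_dec (r i) y) as [|h]; auto. exfalso. eapply r_dead; eauto; lia.
Qed.

Variables (i x : nat).
Hypothesis i_lt : i < b.
Hypothesis x_left : forall y, alive i y -> x <= y.

(** An alive [y] on the next cut is reached from an alive [u >= x]. If [y < x'], the path from [u]
    to [y] crosses the one from [x] to [x'], so [x] reaches [y] as well; as [y] respects the mark,
    this contradicts the choice of [x']. *)
Lemma leftmost_next x' :
  path L (tau + i * L) x x' ->
  (forall z, r (S i) <= z -> path L (tau + i * L) x z -> x' <= z) ->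
  forall y, alive (S i) y -> x' <= y.
Proof.
  intros Hp Hmin y Hy. destruct (alive_prev i y i_lt Hy) as (u & Hu & Ha).
  specialize (x_left u Ha). destruct (le_lt_dec x' y) as [|h]; auto. exfalso.
  specialize (Hmin y). apply alive_mark in Hy; [|lia].
  specialize (Hmin Hy). assert (x' <= y); [|lia]. apply Hmin.
  eapply path_cross; eauto. lia.
Qed.

(** Alive positions are at least [x], so only [x] itself is in question; if it were alive, the strip
    would lead from it to an alive position of the next cut, which no mark excludes. *)
Lemma stuck_dead :
  (forall z, r (S i) <= z -> ~ path L (tau + i * L) x z) -> forall y, y < S x -> ~ alive i y.
Proof.
  intros H y Hy Ha. specialize (x_left y Ha). replace y with x in * by lia.
  destruct (alive_next i x i_lt Ha) as (y' & H1 & H2).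
  apply (H y'); auto. apply alive_mark; auto. lia.
Qed.

End Paths.

Fixpoint sumf (f : nat -> nat) (n : nat) : nat :=
  match n with 0 => 0 | S n => f n + sumf f n end.

Lemma sumf_le f g n : (forall i, i < n -> f i <= g i) -> sumf f n <= sumf g n.
Proof. induction n; cbn; intros H; [lia|]. specialize (H n) as h. specialize (IHn ltac:(auto)). lia. Qed.

Lemma sumf_lt f g n i :
  i < n -> (forall k, k < n -> f k <= g k) -> f i < g i -> sumf f n < sumf g n.
Proof.
  induction n; cbn; intros Hi H Hlt; [lia|]. destruct (Nat.eq_dec i n) as [->|].
  - pose proof (sumf_le f g n ltac:(auto)). lia.
  - specialize (IHn ltac:(lia) ltac:(auto) Hlt). specialize (H n). lia.
Qed.

Lemma sumf_const c n : sumf (fun _ => c) n = n * c.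
Proof. induction n; cbn; lia. Qed.

(** * The search procedure *)

Definition SKIPU : cmd := While true InTrue (Do (Mv MoveR)) ;; Do (Mv MoveR).

(** The input head has no address, so each access starts over: [|w|] moves to the left certainly
    reach cell 0, then the five header blocks are skipped and the offset [2 * (x * n + tau)] is
    counted out. *)
Definition GOTO : cmd :=
  NFor rC rLen (Do (Mv MoveL)) ;;
  SKIPU ;; SKIPU ;; SKIPU ;; SKIPU ;; SKIPU ;;
  NFor rC rX (NFor rD rN (Do (Mv MoveR) ;; Do (Mv MoveR))) ;;
  NFor rC rT (Do (Mv MoveR) ;; Do (Mv MoveR)).

(** Entered with the head on the north bit of the vertex; its east bit is the cell to the left. *)
Definition EAST : cmd :=
  Do (Mv MoveL) ;; Do (Copy rE rX) ;; Do (Inc rE) ;; LE rJ rE ;;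
  If (EqN rFlag rZero) Skip (If InTrue (Do (Inc rX) ;; Do (Inc rT)) (Do (Zero rFlag))).

(** The north edge comes first because it keeps the position, and the least admissible position is
    wanted. From layer [rTt] on the only step is the idle one. *)
Definition STEP : cmd :=
  LE rTt rT ;;
  If (EqN rFlag rZero)
    (GOTO ;; Do (Mv MoveR) ;; LE rJ rX ;;
     If (EqN rFlag rZero) EAST (If InTrue (Do (Inc rT)) EAST))
    (LE rJ rX ;; If (EqN rFlag rZero) Skip (Do (Inc rT))).

Notation lT k := (20 + 5 * k) (only parsing).
Notation lX k := (21 + 5 * k) (only parsing).
Notation lJ k := (22 + 5 * k) (only parsing).
Notation lA k := (23 + 5 * k) (only parsing).
Notation lGo k := (24 + 5 * k) (only parsing).
Notation pL k := (10 + k) (only parsing).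

(* Entry [i] of the array in [lA k] is the mark of cut [i]; the mark of the last cut is the bound [lJ k]
   itself.  On failure the flag is 0, and [rT] and [rX] keep their values. *)
Fixpoint FIND (k : nat) : cmd :=
  match k with
  | 0 => STEP
  | S k =>
    Do (Copy (lT k) rT) ;; Do (Copy (lX k) rX) ;; Do (Copy (lJ k) rJ) ;;
    Do (Zero (lA k)) ;; Do (PZero (pL k)) ;; Do (Zero (lGo k)) ;;
    While true (EqN (lGo k) rZero)
      (Do (PCopy pI (pL k)) ;; Do (PInc pI) ;;
       If (EqP pI pB) (Do (Copy rJ (lJ k))) (LOAD (lA k) pI) ;;
       FIND k ;;
       If (EqN rFlag rZero)
         (If (EqP (pL k) pZ)
            (Do (Inc (lGo k)))
            (STORE (lA k) (pL k) ;; Do (PZero (pL k)) ;; Do (Copy rT (lT k)) ;; Do (Copy rX (lX k))))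
         (Do (PInc (pL k)) ;; If (EqP (pL k) pB) (Do (Inc (lGo k))) Skip))
  end.

(** The loop built on top of [FIND k] keeps its data in the registers from [20 + 5 * k] on, so the
    inner call leaves them alone. *)
Lemma FIND_wn k r : wn (FIND k) r -> r = 0 \/ 6 <= r <= 15 \/ 20 <= r < 20 + 5 * k.
Proof. induction k as [|k IH]; cbn -[Nat.mul]; intros H; repeat destruct H as [H|H]; try apply IH in H; lia. Qed.

Lemma FIND_wp k p : wp (FIND k) p -> 2 <= p <= 5 \/ 10 <= p < 10 + k.
Proof. induction k as [|k IH]; cbn -[Nat.mul]; intros H; repeat destruct H as [H|H]; try apply IH in H; lia. Qed.

Ltac ipc := cbn [ip atom_eff setn setp move_input].

Section Search.
Variables (V : nat) (w : list bool) (m : nat).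
Hypothesis m_ge : 2 <= m.
Hypothesis V_ge : 1 <= V.
Notation runs := (runs V w m).
Notation len := (length w).
Variables b d n Tt : nat.
Variables v1 v2 v3 v4 v5 : nat.

Definition ublock (p v : nat) : Prop :=
  (forall i, i < v -> nth_error w (p + i) = Some true) /\ nth_error w (p + v) = Some false.

Notation h := (v1 + 1 + (v2 + 1) + (v3 + 1) + (v4 + 1) + (v5 + 1)).
(* Vertex (x, tau - x) has row-major index [x (n + 1) + (tau - x) = x n + tau]. *)
Definition addr (tau x : nat) : nat := h + 2 * (x * n + tau).

Hypothesis b1 : ublock 0 v1.
Hypothesis b2 : ublock (v1 + 1) v2.
Hypothesis b3 : ublock (v1 + 1 + (v2 + 1)) v3.
Hypothesis b4 : ublock (v1 + 1 + (v2 + 1) + (v3 + 1)) v4.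
Hypothesis b5 : ublock (v1 + 1 + (v2 + 1) + (v3 + 1) + (v4 + 1)) v5.

(* From layer [Tt] on the graph is padded with idle steps, so that the number of layers may be rounded
   up to a power of [b]. *)
Definition E (tau x z : nat) : Prop :=
  if tau <? Tt then
    (z = x /\ nth_error w (S (addr tau x)) = Some true) \/
    (z = S x /\ nth_error w (addr tau x) = Some true)
  else z = x.

(** Both coordinates [x] and [tau - x] lie in [0 .. n]; in the padded layers [tau - x] has no
    meaning and only [x] is bounded. *)
Definition ok (tau x : nat) : Prop := x <= n /\ (tau < Tt -> x <= tau <= x + n).

Hypothesis addr_lt : forall tau x, tau < Tt -> ok tau x -> S (addr tau x) < len.
Hypothesis no_east : forall tau, tau < Tt -> ok tau n -> nth_error w (addr tau n) <> Some true.
Hypothesis no_north : forall x, x + n < Tt -> ok (x + n) x -> nth_error w (S (addr (x + n) x)) <> Some true.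

Lemma E_step tau x y : E tau x y -> y = x \/ y = S x.
Proof. unfold E. destruct (tau <? Tt); intuition. Qed.

(** The boundary slots of the encoding hold no true bit, so a path never leaves the square and every
    address read lies inside the input. *)
Lemma E_ok tau x y : E tau x y -> ok tau x -> ok (S tau) y.
Proof.
  unfold E. intros H Hok. pose proof Hok as [H1 H2]. destruct (Nat.ltb_spec tau Tt) as [Ht|Ht].
  - destruct H as [[-> H]|[-> H]].
    + split; auto. intros Hs. specialize (H2 Ht). split; [lia|].
      destruct (Nat.eq_dec tau (x + n)) as [->|]; [|lia]. exfalso. eapply no_north; eauto.
    + specialize (H2 Ht). destruct (Nat.eq_dec x n) as [->|]; [exfalso; eapply no_east; eauto|].
      split; [lia|]. lia.
  - subst y. split; auto. lia.
Qed.

Notation Epath := (path E).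

Lemma path_ok L : forall tau x y, Epath L tau x y -> ok tau x -> ok (tau + L) y.
Proof.
  induction L as [|L IH]; cbn [path]; intros tau x y H Hok.
  - subst. now rewrite Nat.add_0_r.
  - destruct H as (z & H1 & H2). replace (tau + S L) with (S tau + L) by lia.
    eapply IH; eauto. eapply E_ok; eauto.
Qed.

Definition env (s : st) : Prop :=
  num s rLen = len /\ num s rN = n /\ num s rTt = Tt /\ num s rZero = 0 /\
  ptr s pB = b /\ ptr s pW = d /\ ptr s pZ = 0 /\ ip s <= len.

Lemma env_frame c s s' :
  frame c s s' -> env s -> ip s' <= len ->
  (forall r, 1 <= r <= 4 -> ~ wn c r) -> ~ wp c pB -> ~ wp c pW -> ~ wp c pZ -> env s'.
Proof.
  intros (Fn & Fp & _) (H1 & H2 & H3 & H4 & H5 & H6 & H7 & H8) Hip Hn HB HW HZ.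
  repeat split; auto; rewrite ?Fn, ?Fp by (auto; apply Hn; lia); auto.
Qed.

Definition result (L tau x j : nat) (s : st) : Prop :=
  (num s rFlag = 1 /\ num s rT = tau + L /\ j <= num s rX /\ Epath L tau x (num s rX) /\
   forall z, j <= z -> Epath L tau x z -> num s rX <= z) \/
  (num s rFlag = 0 /\ num s rT = tau /\ num s rX = x /\ forall z, j <= z -> ~ Epath L tau x z).

Hypothesis len_m : len <= m.
Hypothesis Tt_m : Tt <= m.
Hypothesis n_m : S n <= m.
Hypothesis len_V : len < 2 ^ V.
Hypothesis Tt_V : Tt < 2 ^ V.
Hypothesis n_V : S (S n) < 2 ^ V.

Lemma runs_SKIPU p v s (Q : st -> Prop) :
  ublock p v -> ip s = p ->
  (forall s', frame SKIPU s s' -> ip s' = p + (v + 1) -> Q s') -> runs SKIPU s Q.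
Proof.
  intros [Hb1 Hb2] Hp HQ. apply runs_frame; auto. apply runs_seq; auto.
  assert (Hl : p + v < len) by (apply nth_error_Some; congruence).
  apply runs_while with (Inv := fun s1 => p <= ip s1 <= p + v) (mu := fun s1 => p + v - ip s1); auto; [lia| | |].
  - pose proof (le_pow4 m m_ge (p + v) ltac:(lia)). lia.
  - intros s1 _ Hi Ht. cbn in Ht. apply runs_do; [exact Logic.I|]. ipc.
    destruct (Nat.eq_dec (ip s1) (p + v)) as [E1|E1].
    + rewrite E1, Hb2 in Ht. discriminate.
    + lia.
  - intros s1 _ Hi Ht. cbn in Ht. assert (E1 : ip s1 = p + v).
    { destruct (Nat.eq_dec (ip s1) (p + v)) as [|E1]; auto.
      replace (ip s1) with (p + (ip s1 - p)) in Ht by lia. rewrite Hb1 in Ht by lia. discriminate. }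
    apply runs_do; [exact Logic.I|]. intros Hf. apply HQ; auto. ipc. lia.
Qed.

Lemma runs_MOVE2 c r s (Q : st -> Prop) :
  c <> r -> num s r <= m -> num s r < 2 ^ V -> ip s + 2 * num s r <= len ->
  (forall s', frame (NFor c r (Do (Mv MoveR) ;; Do (Mv MoveR))) s s' -> ip s' = ip s + 2 * num s r -> Q s') ->
  runs (NFor c r (Do (Mv MoveR) ;; Do (Mv MoveR))) s Q.
Proof.
  intros Hc Hm HV Hl HQ.
  apply runs_nfor with (Inv := fun i s1 => ip s1 = ip s + 2 * i); auto; try (cbn; lia).
  intros i s1 Hi _ _ Hinv. apply runs_seq; auto. apply runs_do; [exact Logic.I|].
  apply runs_do; [exact Logic.I|]. ipc. lia.
Qed.

Lemma runs_GOTO tau x s (Q : st -> Prop) :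
  env s -> num s rT = tau -> num s rX = x -> tau < Tt -> ok tau x ->
  (forall s', frame GOTO s s' -> ip s' = addr tau x -> Q s') -> runs GOTO s Q.
Proof.
  intros Henv HT HX Ht Hok HQ. apply runs_frame; auto.
  pose proof Henv as (HL & HN & _ & _ & _ & _ & _ & Hip).
  pose proof (addr_lt _ _ Ht Hok) as Ha. unfold addr in Ha. pose proof Hok as [Hx _].
  apply runs_seq; auto.
  apply runs_nfor with (Inv := fun i s1 => ip s1 = ip s - i); rewrite ?HL; auto; try (cbn; lia).
  { intros i s1 _ _ _ Hi. apply runs_do; [exact Logic.I|]. ipc. lia. }
  intros s1 F1 _ Hi1.
  apply runs_seq; auto. apply runs_SKIPU with (p := 0) (v := v1); auto; [lia|]. intros s2 F2 Hi2.
  apply runs_seq; auto. eapply runs_SKIPU; [exact b2|lia|]. intros s3 F3 Hi3.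
  apply runs_seq; auto. eapply runs_SKIPU; [exact b3|lia|]. intros s4 F4 Hi4.
  apply runs_seq; auto. eapply runs_SKIPU; [exact b4|lia|]. intros s5 F5 Hi5.
  apply runs_seq; auto. eapply runs_SKIPU; [exact b5|lia|]. intros s6 F6 Hi6.
  destruct F1 as (F1 & _), F2 as (F2 & _), F3 as (F3 & _), F4 as (F4 & _), F5 as (F5 & _), F6 as (F6 & _).
  assert (Ex : num s6 rX = x) by (rewrite F6, F5, F4, F3, F2, F1 by (cbn; lia); auto).
  assert (En : num s6 rN = n) by (rewrite F6, F5, F4, F3, F2, F1 by (cbn; lia); auto).
  assert (Et : num s6 rT = tau) by (rewrite F6, F5, F4, F3, F2, F1 by (cbn; lia); auto).
  apply runs_seq; auto.
  apply runs_nfor with (Inv := fun i s1 => ip s1 = h + 2 * (i * n)); rewrite ?Ex; auto; try (cbn; lia).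
  { intros i s7 Hi _ (F7 & _) Hi7. assert (En7 : num s7 rN = n) by (rewrite F7 by (cbn; lia); auto).
    apply runs_MOVE2; rewrite ?En7; try lia; [nia|]. intros s8 _ Hi8. cbn [ip setn]. lia. }
  intros s7 (F7 & _) _ Hi7. assert (Et7 : num s7 rT = tau) by (rewrite F7 by (cbn; lia); auto).
  apply runs_MOVE2; rewrite ?Et7; try lia. intros s8 _ Hi8 Hf. apply HQ; auto. unfold addr. lia.
Qed.

Lemma flag_test s a c :
  num s rZero = 0 -> num s rFlag = (if a <=? c then 1 else 0) ->
  (test_val w (EqN rFlag rZero) s = true -> c < a) /\ (test_val w (EqN rFlag rZero) s = false -> a <= c /\ num s rFlag = 1).
Proof.
  intros Hz Hf. cbn [test_val]. rewrite Hz, Hf. destruct (Nat.leb_spec a c); cbn; split; intros; try discriminate; auto.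
Qed.

Lemma path_1 tau x y : Epath 1 tau x y <-> E tau x y.
Proof. cbn. split; [intros (z & H & ->); auto|eauto]. Qed.

(** Used when the north edge is absent or would end below [j]; the east edge is then the only
    candidate. *)
Lemma runs_EAST tau x j s (Q : st -> Prop) :
  env s -> num s rT = tau -> num s rX = x -> num s rJ = j -> tau < Tt -> ok tau x -> j <= S n ->
  ip s = S (addr tau x) -> (j <= x -> nth_error w (S (addr tau x)) <> Some true) ->
  (forall s', frame EAST s s' -> ip s' <= len -> result 1 tau x j s' -> Q s') -> runs EAST s Q.
Proof.
  intros Henv HT HX HJ Ht Hok Hj Hip Hno HQ. apply runs_frame; auto.
  pose proof Henv as (_ & _ & _ & HZ & _). pose proof Hok as [Hx Htx].
  pose proof (addr_lt _ _ Ht Hok) as Ha.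
  apply runs_seq; auto. apply runs_do; [exact Logic.I|].
  apply runs_seq; auto. apply runs_do; [exact Logic.I|].
  apply runs_seq; auto. apply runs_do; [cbn; lia|].
  apply runs_seq; auto. apply runs_LE; auto; look; try lia. intros s1 (Fn & _ & Fi) Hf.
  rewrite HJ, HX in Hf.
  assert (Z1 : num s1 rZero = 0) by (rewrite Fn by (cbn; lia); look; auto).
  assert (X1 : num s1 rX = x) by (rewrite Fn by (cbn; lia); look; auto).
  assert (T1 : num s1 rT = tau) by (rewrite Fn by (cbn; lia); look; auto).
  assert (I1 : ip s1 = addr tau x) by (rewrite Fi by (cbn; lia); ipc; lia).
  assert (HE : forall z, j <= z -> Epath 1 tau x z <-> z = S x /\ nth_error w (addr tau x) = Some true).
  { intros z Hz. rewrite path_1. unfold E. destruct (Nat.ltb_spec tau Tt); [|lia]. split; [|tauto].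
    intros [[-> h]|h]; auto. exfalso. apply Hno; auto. }
  destruct (flag_test s1 j (S x) Z1 Hf) as [Hf1 Hf2].
  apply runs_if; auto; intros Htest.
  - apply Hf1 in Htest. apply runs_skip; auto. intros Hfr. apply HQ; auto; [lia|]. right.
    repeat split; auto.
    + rewrite Hf. destruct (Nat.leb_spec j (S x)); [lia|auto].
    + intros z Hz Hp. apply HE in Hp; auto. lia.
  - apply Hf2 in Htest. destruct Htest as [Hle Hf3]. apply runs_if; auto; cbn [test_val]; intros Hin.
    + apply runs_seq; auto. apply runs_do; [cbn; lia|]. apply runs_do; [cbn; lia|].
      intros Hfr. apply HQ; auto; [cbn; lia|]. left. look. rewrite X1, T1, I1 in *.
      assert (nth_error w (addr tau x) = Some true).
      { destruct (nth_error w (addr tau x)) as [[]|]; congruence. }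
      repeat split; auto; try lia; [apply HE; auto|]. intros z Hz Hp. apply HE in Hp; auto. lia.
    + apply runs_do; [exact Logic.I|]. intros Hfr. apply HQ; auto; [cbn; lia|]. right. look.
      repeat split; auto. intros z Hz Hp. apply HE in Hp; auto. destruct Hp as [_ Hp].
      rewrite I1, Hp in Hin. discriminate.
Qed.

Lemma runs_STEP tau x j s :
  env s -> num s rT = tau -> num s rX = x -> num s rJ = j -> ok tau x -> j <= S n -> S tau < 2 ^ V ->
  runs STEP s (fun s' => env s' /\ result 1 tau x j s').
Proof.
  intros Henv HT HX HJ Hok Hj HtV. apply runs_frame; auto.
  assert (Hkeep : forall s', frame STEP s s' -> ip s' <= len -> env s').
  { intros s' Hf Hi. apply (env_frame STEP s); auto; cbn; lia. }
  pose proof Henv as (_ & _ & HTt & HZ & _ & _ & _ & Hip). pose proof Hok as [Hx Htx].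
  apply runs_seq; auto. apply runs_LE; auto; rewrite ?HTt; auto; try lia. intros s1 F1 Hf.
  assert (E1 : env s1).
  { destruct F1 as (a1 & a2 & a3). apply (env_frame (LE rTt rT) s); auto; try (cbn; lia).
    - repeat split; auto.
    - rewrite a3 by (cbn; lia). auto. }
  destruct F1 as (Fn & Fp & Fi). rewrite HT in Hf. pose proof E1 as (_ & _ & _ & Z1 & _ & _ & _ & Hip1).
  destruct (flag_test s1 Tt tau Z1 Hf) as [Hf1 Hf2].
  assert (X1 : num s1 rX = x) by (rewrite Fn by (cbn; lia); auto).
  assert (T1 : num s1 rT = tau) by (rewrite Fn by (cbn; lia); auto).
  assert (J1 : num s1 rJ = j) by (rewrite Fn by (cbn; lia); auto).
  apply runs_if; auto; intros Htest.
  - apply Hf1 in Htest. pose proof (addr_lt _ _ Htest Hok) as Ha.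
    apply runs_seq; auto. apply runs_GOTO with (tau := tau) (x := x); auto. intros s2 (Fn2 & Fp2 & _) Hi2.
    apply runs_seq; auto. apply runs_do; [exact Logic.I|].
    apply runs_seq; auto. apply runs_LE; auto; look; rewrite ?Fn2 by (cbn; lia); try lia.
    intros s3 (Fn3 & Fp3 & Fi3) Hf3. rewrite J1, X1 in Hf3.
    assert (E3 : env s3).
    { destruct E1 as (A1 & A2 & A3 & A4 & A5 & A6 & A7 & A8).
      assert (I3 : ip s3 = S (addr tau x)) by (rewrite Fi3 by (cbn; lia); ipc; lia).
      repeat split; rewrite ?Fn3, ?Fp3 by (cbn; lia); look; rewrite ?Fn2, ?Fp2 by (cbn; lia); auto. lia. }
    assert (X3 : num s3 rX = x) by (rewrite Fn3 by (cbn; lia); look; rewrite Fn2 by (cbn; lia); auto).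
    assert (T3 : num s3 rT = tau) by (rewrite Fn3 by (cbn; lia); look; rewrite Fn2 by (cbn; lia); auto).
    assert (J3 : num s3 rJ = j) by (rewrite Fn3 by (cbn; lia); look; rewrite Fn2 by (cbn; lia); auto).
    assert (I3 : ip s3 = S (addr tau x)) by (rewrite Fi3 by (cbn; lia); ipc; lia).
    pose proof E3 as (_ & _ & _ & Z3 & _).
    destruct (flag_test s3 j x Z3 Hf3) as [Hf4 Hf5].
    apply runs_if; auto; intros Htest2.
    + apply Hf4 in Htest2. apply runs_EAST with (tau := tau) (x := x) (j := j); auto; lia.
    + apply Hf5 in Htest2. destruct Htest2 as [Hjx Hfl]. apply runs_if; auto; cbn [test_val]; rewrite I3; intros Hin.
      * apply runs_do; [cbn; lia|]. intros Hfr. split; [apply Hkeep; auto; cbn; lia|]. left. look.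
        assert (Hp : Epath 1 tau x x).
        { apply path_1. unfold E. destruct (Nat.ltb_spec tau Tt); [|lia]. left. split; auto.
          destruct (nth_error w (S (addr tau x))) as [[]|]; congruence. }
        rewrite X3. repeat split; auto; try lia.
        intros z Hz Hpz. apply path_1, E_step in Hpz. lia.
      * apply runs_EAST with (tau := tau) (x := x) (j := j); auto.
        intros _ hh. rewrite hh in Hin. discriminate.
  - apply Hf2 in Htest. destruct Htest as [Hge Hfl].
    assert (HE : forall z, Epath 1 tau x z <-> z = x).
    { intros z. rewrite path_1. unfold E. destruct (Nat.ltb_spec tau Tt); [lia|]. tauto. }
    apply runs_seq; auto. apply runs_LE; auto; try lia.
    intros s3 (Fn3 & Fp3 & Fi3) Hf3. rewrite J1, X1 in Hf3.
    assert (X3 : num s3 rX = x) by (rewrite Fn3 by (cbn; lia); auto).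
    assert (T3 : num s3 rT = tau) by (rewrite Fn3 by (cbn; lia); auto).
    assert (Z3 : num s3 rZero = 0) by (rewrite Fn3 by (cbn; lia); auto).
    assert (I3 : ip s3 = ip s1) by (apply Fi3; cbn; lia).
    destruct (flag_test s3 j x Z3 Hf3) as [Hf4 Hf5].
    apply runs_if; auto; intros Htest2.
    + apply Hf4 in Htest2. apply runs_skip; auto. intros Hfr. split; [apply Hkeep; auto; lia|].
      right. repeat split; auto.
      * rewrite Hf3. destruct (Nat.leb_spec j x); [lia|auto].
      * intros z Hz Hp. apply HE in Hp. lia.
    + apply Hf5 in Htest2. destruct Htest2 as [Hjx Hfl3].
      apply runs_do; [cbn; lia|]. intros Hfr. split; [apply Hkeep; auto; cbn; lia|]. left. look.
      rewrite X3. repeat split; auto; try lia; [now apply HE|].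
      intros z Hz Hpz. apply HE in Hpz. lia.
Qed.

Hypothesis b_pos : 1 <= b.
Hypothesis b_m : b <= m.
Hypothesis d_m : d <= m.
Hypothesis b_V : b <= V.
Hypothesis d_V : d <= V.
Hypothesis bd_V : b * d <= V.
Hypothesis n_d : S n < 2 ^ d.
Hypothesis mu_m : 1 + b * S (S n) * (b + 1) + b <= m ^ 4.

(** * One level of the recursion *)

Section Level.
Variables (k tau x j : nat).
Let L := b ^ k.
Notation A s := (num s (lA k)).
Notation idx s := (ptr s (pL k)).

Definition mark (s : st) (i : nat) : nat := if i =? b then j else seg d (A s) i.

(** Invariant of a walk under way. That all alive positions of the current cut are at least [rX] is
    the hypothesis of the crossing lemmas; that [rX] is not below the mark of its cut makes the
    replacement of the mark by [rX + 1] a strict increase; the bound [S n] makes each mark a legal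
    bound for the inner call. *)
Definition searching (s : st) : Prop :=
  idx s < b /\ num s rT = tau + idx s * L /\ Epath (idx s * L) tau x (num s rX) /\
  (forall y, alive E b L tau x j (idx s) y -> num s rX <= y) /\
  (1 <= idx s -> seg d (A s) (idx s) <= num s rX) /\
  (forall i y, 1 <= i < b -> y < seg d (A s) i -> ~ alive E b L tau x j i y) /\
  (forall i, seg d (A s) i <= S n).

Definition level_inv (s : st) : Prop :=
  env s /\ num s (lT k) = tau /\ num s (lX k) = x /\ num s (lJ k) = j /\
  ((num s (lGo k) = 0 /\ searching s) \/ (num s (lGo k) = 1 /\ result (b * L) tau x j s)).

(** A lexicographic order in one number: the weight [b + 1] lets the growth of a mark outweigh the
    return to cut 0, and the leading 1 makes the end of the search a decrease too. *)
Definition level_mu (s : st) : nat :=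
  if num s (lGo k) =? 0
  then 1 + sumf (fun i => S (S n) - seg d (A s) i) b * (b + 1) + (b - idx s) else 0.

Hypothesis x_ok : ok tau x.
Hypothesis j_le : j <= S n.
Hypothesis tau_V : tau + b * L < 2 ^ V.

Hypothesis IH : forall s tau x j,
  env s -> num s rT = tau -> num s rX = x -> num s rJ = j -> ok tau x -> j <= S n ->
  tau + L < 2 ^ V -> runs (FIND k) s (fun s' => env s' /\ result L tau x j s').

Definition level_body : cmd :=
  Do (PCopy pI (pL k)) ;; Do (PInc pI) ;;
  If (EqP pI pB) (Do (Copy rJ (lJ k))) (LOAD (lA k) pI) ;;
  FIND k ;;
  If (EqN rFlag rZero)
    (If (EqP (pL k) pZ)
       (Do (Inc (lGo k)))
       (STORE (lA k) (pL k) ;; Do (PZero (pL k)) ;; Do (Copy rT (lT k)) ;; Do (Copy rX (lX k))))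
    (Do (PInc (pL k)) ;; If (EqP (pL k) pB) (Do (Inc (lGo k))) Skip).

Lemma runs_level_body s :
  level_inv s -> num s (lGo k) = 0 ->
  runs level_body s (fun s' => level_inv s' /\ level_mu s' < level_mu s).
Proof.
  intros (Henv & HT & HX & HJ & [[_ Hs]|[HG _]]) HG0; [|lia].
  destruct Hs as (Hi & HsT & Hpath & Hleft & Hge & Hdead & Hmax).
  pose proof Henv as (HeL & HeN & HeT & HeZ & HeB & HeW & HePZ & Hip).
  set (i := idx s) in *. set (y := num s rX) in *.
  assert (Hyok : ok (tau + i * L) y) by (eapply path_ok; eauto).
  assert (HiV : (i + 1) * L <= b * L) by (apply Nat.mul_le_mono_r; lia).
  assert (Hid : (i + 1) * d <= b * d) by (apply Nat.mul_le_mono_r; lia).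
  set (r := mark s).
  assert (Hrb : r b = j) by (unfold r, mark; now rewrite Nat.eqb_refl).
  assert (Hrd : forall i y, 1 <= i < b -> y < r i -> ~ alive E b L tau x j i y).
  { intros i0 y0 Hi0. unfold r, mark. destruct (Nat.eqb_spec i0 b); [lia|]. apply Hdead. auto. }
  assert (Hrm : r (S i) <= S n) by (unfold r, mark; destruct (S i =? b); auto).
  assert (H2V : 2 <= 2 ^ V) by (apply (Nat.pow_le_mono_r 2 1 V); lia).
  unfold level_body.
  apply runs_seq; auto. apply runs_do; [exact Logic.I|].
  apply runs_seq; auto. apply runs_do; [cbn [atom_ok]; look; fold i; lia|].
  apply runs_seq; auto.
  match goal with |- runs _ ?t _ => set (s1 := t) end.
  assert (P1 : ptr s1 pI = S i) by (unfold s1; look; reflexivity).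
  assert (P1' : forall p, p <> pI -> ptr s1 p = ptr s p) by (intros p Hp; unfold s1; look; reflexivity).
  assert (N1 : forall q, num s1 q = num s q) by reflexivity.
  assert (I1 : ip s1 = ip s) by reflexivity.
  clearbody s1.
  (* The bound for the inner call is the mark of the next cut, which on the last cut is [j]
     itself. *)
  apply runs_mono with (Q := fun s2 => num s2 rJ = r (S i)).
  { apply runs_if; auto; cbn [test_val]; rewrite P1, P1', HeB by lia; intros Ht.
    - apply runs_do; [exact Logic.I|]. look. rewrite N1, HJ. unfold r, mark. now rewrite Ht.
    - apply Nat.eqb_neq in Ht.
      apply runs_LOAD; auto; rewrite ?P1, ?P1', ?HeW by lia; try lia; [nia|].
      intros s2 _ H2. rewrite H2, N1. unfold r, mark. destruct (Nat.eqb_spec (S i) b); [lia|reflexivity]. }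
  intros s2 (Fn2 & Fp2 & Fi2) J2.
  assert (N2 : forall q, q <> rJ -> num s2 q = num s q).
  { intros q Hq. rewrite Fn2; [apply N1|]. cbn -[Nat.mul]. lia. }
  assert (P2 : forall p, ~ 2 <= p <= 5 -> ptr s2 p = ptr s p).
  { intros p Hp. rewrite Fp2; [apply P1'; lia|]. cbn -[Nat.mul]. lia. }
  assert (I2 : ip s2 = ip s) by (rewrite Fi2; [auto|]; cbn -[Nat.mul]; lia).
  assert (E2 : env s2) by (repeat split; rewrite ?N2, ?P2, ?I2 by lia; auto).
  clear Fn2 Fp2 Fi2 N1 P1 P1' I1 s1.
  apply runs_seq; auto. eapply runs_mono.
  { apply IH with (tau := tau + i * L) (x := y) (j := r (S i)); auto.
    - rewrite N2 by lia. auto.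
    - lia. }
  intros s3 (Fn3 & Fp3 & _) [E3 R3].
  assert (N3 : forall q, 20 + 5 * k <= q -> num s3 q = num s q).
  { intros q Hq. rewrite Fn3; [apply N2; lia|]. intros hh. apply FIND_wn in hh. lia. }
  assert (P3' : forall p, 10 + k <= p -> ptr s3 p = ptr s p).
  { intros p Hp. rewrite Fp3; [apply P2; lia|]. intros hh. apply FIND_wp in hh. lia. }
  clear Fn3 Fp3 N2 P2 I2 E2 J2 s2.
  pose proof E3 as (e1 & e2 & e3 & e4 & e5 & e6 & e7 & e8).
  assert (MU : level_mu s = 1 + sumf (fun i => S (S n) - seg d (A s) i) b * (b + 1) + (b - i)).
  { unfold level_mu. rewrite HG0. reflexivity. }
  destruct R3 as [(Rf & RT & Rj & Rp & Rmin)|(Rf & RT & RX & Rno)].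
  - apply runs_if; auto; cbn [test_val]; rewrite Rf, e4; [discriminate|]. intros _.
    (* Moving on keeps the walk to the left of every alive position. *)
    assert (Hnext : forall y', alive E b L tau x j (S i) y' -> num s3 rX <= y').
    { eapply leftmost_next; eauto. apply E_step. }
    assert (Hp' : Epath (S i * L) tau x (num s3 rX)).
    { replace (S i * L) with (i * L + L) by lia. apply path_app. eauto. }
    apply runs_seq; auto. apply runs_do; [cbn [atom_ok]; rewrite P3' by lia; fold i; lia|].
    match goal with |- runs _ ?t _ => set (s4 := t) end.
    assert (P4 : ptr s4 (10 + k) = S i) by (unfold s4; look; rewrite P3' by lia; reflexivity).
    assert (E4 : env s4) by (repeat split; unfold s4; look; auto).
    assert (N4 : num s4 = num s3) by reflexivity.
    clearbody s4.
    apply runs_if; auto; cbn [test_val]; rewrite P4; replace (ptr s4 pB) with b by (symmetry; apply E4); intros Ht.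
    + apply Nat.eqb_eq in Ht. apply runs_do; [cbn [atom_ok]; rewrite N4, N3, HG0 by lia; lia|].
      split; [|rewrite MU; unfold level_mu; look; lia].
      split; [repeat split; look; apply E4|].
      look. rewrite N4, !N3 by lia. rewrite HG0. repeat split; auto. right. split; auto.
      left. look. rewrite N4. rewrite Ht in *. repeat split; auto.
      * rewrite RT, <- Ht. lia.
      * rewrite <- Hrb. auto.
      * intros z Hz Hpz. apply Hnext. apply alive_last. auto.
    + apply Nat.eqb_neq in Ht. apply runs_skip; auto.
      split; [|rewrite MU; unfold level_mu; rewrite N4, P4, !N3, HG0 by lia; cbn [Nat.eqb]; lia].
      split; auto. rewrite N4, !N3 by lia. repeat split; auto. left. split; auto.
      unfold searching. rewrite P4, N4, (N3 (23 + 5 * k)) by lia. repeat split; auto; [lia|rewrite RT; lia|].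
      intros _. revert Rj. unfold r, mark. destruct (Nat.eqb_spec (S i) b); [lia|auto].
  - apply runs_if; auto; cbn [test_val]; rewrite Rf, e4; [|discriminate]. intros _.
    assert (Hno : forall y', y' < S y -> ~ alive E b L tau x j i y') by (eapply stuck_dead; eauto).
    apply runs_if; auto; cbn [test_val]; rewrite P3', e7 by lia; fold i; intros Ht.
    (* Stuck on cut 0: the start itself is dead, so the whole search fails, and [rT] and [rX] still
       hold the starting values. *)
    + apply Nat.eqb_eq in Ht.
      apply runs_do; [cbn [atom_ok]; rewrite N3, HG0 by lia; lia|].
      split; [|rewrite MU; unfold level_mu; look; lia].
      split; [repeat split; look; auto|].
      look. rewrite !N3 by lia. rewrite HG0. repeat split; auto. right. split; auto.
      right. look. rewrite Ht in *. cbn [Nat.mul path] in Hpath.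
      repeat split; auto; [lia|lia|].
      intros z Hz Hpz. apply (Hno y ltac:(lia)). split; [cbn; auto|].
      exists z. split; auto. rewrite Nat.sub_0_r. cbn [Nat.mul]. rewrite Nat.add_0_r, <- Hpath. auto.
    + apply Nat.eqb_neq in Ht.
      assert (Hyn : y <= n) by apply Hyok.
      apply runs_seq; auto. apply runs_STORE; auto; rewrite ?e6, ?P3' by lia; fold i; try lia.
      intros s4 (Fn4 & Fp4 & Fi4) S4.
      assert (N4 : forall q, 20 + 5 * k <= q -> q <> 23 + 5 * k -> num s4 q = num s q).
      { intros q Hq Hq'. rewrite Fn4; [apply N3; auto|]. cbn -[Nat.mul]. lia. }
      assert (E4 : env s4).
      { apply (env_frame (STORE (23 + 5 * k) (10 + k)) s3); auto; try (cbn -[Nat.mul]; lia).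
        - split; auto.
        - rewrite Fi4; [auto|]. cbn -[Nat.mul]. lia. }
      rewrite RX, N3 in S4 by lia. clear Fn4 Fp4 Fi4.
      apply runs_seq; auto. apply runs_do; [exact Logic.I|].
      apply runs_seq; auto. apply runs_do; [exact Logic.I|]. apply runs_do; [exact Logic.I|].
      match goal with |- level_inv ?t /\ _ => set (s5 := t) end.
      assert (P5 : ptr s5 (10 + k) = 0) by (unfold s5; look; reflexivity).
      assert (N5 : forall q, 20 + 5 * k <= q -> num s5 q = num s4 q) by (intros q Hq; unfold s5; look; reflexivity).
      assert (T5 : num s5 rT = tau) by (unfold s5; look; rewrite N4 by lia; auto).
      assert (X5 : num s5 rX = x) by (unfold s5; look; rewrite N4 by lia; auto).
      assert (E5 : env s5) by (repeat split; unfold s5; look; apply E4).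
      clearbody s5.
      split.
      * split; [auto|]. rewrite !N5, !N4 by lia. repeat split; auto. left. split; auto.
        unfold searching. rewrite P5, T5, X5, N5 by lia. cbn [Nat.mul].
        repeat split; auto; try lia.
        -- intros y0 Hy0. apply alive_first in Hy0. lia.
        -- intros i0 y0 Hi0. rewrite S4. destruct (Nat.eqb_spec i0 i) as [->|]; auto.
        -- intros i0. rewrite S4. destruct (i0 =? i); auto. lia.
      * rewrite MU. unfold level_mu. rewrite P5, !N5, N4, HG0 by lia. cbn [Nat.eqb].
        assert (Hlt : sumf (fun i0 => S (S n) - seg d (num s4 (23 + 5 * k)) i0) b <
                      sumf (fun i0 => S (S n) - seg d (A s) i0) b).
        (* The old mark is at most [y] and the new one is [y + 1 <= n + 1], so the term of cut [i]
           drops strictly. *)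
        { assert (Hgi : seg d (A s) i <= y) by (apply Hge; lia).
          apply sumf_lt with (i := i); auto.
          - intros q Hq. rewrite S4. destruct (Nat.eqb_spec q i); [subst q; lia|lia].
          - rewrite S4, Nat.eqb_refl. lia. }
        nia.
Qed.

End Level.

Theorem runs_FIND k : forall s tau x j,
  env s -> num s rT = tau -> num s rX = x -> num s rJ = j -> ok tau x -> j <= S n ->
  tau + b ^ k < 2 ^ V -> runs (FIND k) s (fun s' => env s' /\ result (b ^ k) tau x j s').
Proof.
  induction k as [|k IH]; intros s tau x j Henv HT HX HJ Hok Hj HV.
  - cbn [Nat.pow] in *. apply runs_STEP; auto. lia.
  - cbn [FIND]. change (b ^ S k) with (b * b ^ k) in *.
    do 6 (apply runs_seq; auto; apply runs_do; [exact Logic.I|]).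
    match goal with |- runs _ ?t _ => set (s0 := t) end.
    pose proof Henv as (e1 & e2 & e3 & e4 & e5 & e6 & e7 & e8).
    (* With all marks 0 nothing is claimed dead, and on cut 0 only [x] can be alive. *)
    assert (Hinv : level_inv k tau x j s0).
    { split; [repeat split; unfold s0; look; auto|].
      unfold s0; look; rewrite HT, HX, HJ. repeat split; auto. left. split; auto.
      unfold searching; look. cbn [Nat.mul path]. rewrite HT, HX. repeat split; auto; try lia.
      - intros y Hy. apply alive_first in Hy. lia.
      - intros i y Hi. rewrite seg_0. lia.
      - intros i. rewrite seg_0. lia. }
    apply runs_while with (Inv := level_inv k tau x j) (mu := level_mu k); auto.
    + unfold level_mu. destruct (num s0 (24 + 5 * k) =? 0); [|lia].
      pose proof (sumf_le (fun i => S (S n) - seg d (num s0 (23 + 5 * k)) i) (fun _ => S (S n)) b ltac:(intros; cbn beta; lia)) as Hs.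
      rewrite sumf_const in Hs. apply Nat.mul_le_mono_r with (p := b + 1) in Hs. lia.
    + intros s1 _ H1 Ht. cbn [test_val] in Ht. apply Nat.eqb_eq in Ht.
      apply runs_level_body; auto. rewrite Ht; apply H1.
    + intros s1 _ (H1 & _ & _ & _ & [[H2 _]|[H2 H3]]) Ht; auto. exfalso.
      cbn [test_val] in Ht. apply Nat.eqb_neq in Ht. apply Ht. rewrite H2. symmetry. apply H1.
Qed.

End Search.

(** * Instances and paths *)

(** Unary blocks are prefix-free, so a word has at most one reading of its header. *)
Lemma ublock_unique w p v v' : ublock w p v -> ublock w p v' -> v = v'.
Proof.
  intros [H1 H2] [H3 H4]. destruct (lt_eq_lt_dec v v') as [[h|h]|h]; auto.
  - specialize (H3 v h). congruence.
  - specialize (H1 v' h). congruence.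
Qed.

Lemma ublock_app pre v rest : ublock (pre ++ unary v ++ rest) (length pre) v.
Proof.
  unfold unary. split.
  - intros i Hi. rewrite nth_error_app2 by lia. replace (length pre + i - length pre) with i by lia.
    rewrite <- app_assoc, nth_error_app1 by (rewrite repeat_length; lia). now apply nth_error_repeat.
  - rewrite nth_error_app2 by lia. replace (length pre + v - length pre) with v by lia.
    rewrite <- app_assoc, nth_error_app2 by (rewrite repeat_length; lia). rewrite repeat_length, Nat.sub_diag. reflexivity.
Qed.

Lemma ublock_skipn w p v : ublock w p v -> skipn p w = unary v ++ skipn (p + (v + 1)) w.
Proof.
  intros [H1 H2]. apply nth_error_ext. intros i. rewrite nth_error_skipn.
  unfold unary. rewrite <- app_assoc. destruct (lt_eq_lt_dec i v) as [[h|h]|h].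
  - rewrite nth_error_app1 by (rewrite repeat_length; lia). rewrite H1 by auto. now rewrite nth_error_repeat.
  - subst i. rewrite nth_error_app2 by (rewrite repeat_length; lia). rewrite repeat_length, Nat.sub_diag. auto.
  - rewrite nth_error_app2 by (rewrite repeat_length; lia). rewrite repeat_length.
    replace (i - v) with (S (i - v - 1)) by lia. cbn. rewrite nth_error_skipn. f_equal. lia.
Qed.

Lemma flat_map_block {T} (f : nat -> list T) c k :
  (forall i, length (f i) = c) -> forall a,
  length (flat_map f (seq a k)) = k * c /\
  forall q t, q < k -> t < c -> nth_error (flat_map f (seq a k)) (q * c + t) = nth_error (f (a + q)) t.
Proof.
  intros Hf. induction k as [|k IH]; intros a; cbn [seq flat_map]; [split; [reflexivity|lia]|].
  destruct (IH (S a)) as [H1 H2]. rewrite length_app, H1, Hf. split; [lia|].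
  intros [|q] t Hq Ht.
  - rewrite nth_error_app1 by (rewrite Hf; lia). now rewrite Nat.add_0_r.
  - rewrite nth_error_app2 by (rewrite Hf; cbn; lia). rewrite Hf.
    replace (S q * c + t - c) with (q * c + t) by (cbn; lia). rewrite H2 by lia. f_equal. f_equal. lia.
Qed.

Lemma enc_graph_length G : length (enc_graph G) = 2 * (S (lgg_n G) * S (lgg_n G)).
Proof.
  unfold enc_graph. set (n := lgg_n G).
  assert (H : forall i, length (flat_map (fun j => enc_vertex G i j) (seq 0 (S n))) = S n * 2).
  { intros i. apply (flat_map_block (fun j => enc_vertex G i j) 2 (S n)). reflexivity. }
  rewrite (proj1 (flat_map_block _ _ _ H 0)). lia.
Qed.

Lemma enc_graph_nth G i j t :
  i <= lgg_n G -> j <= lgg_n G -> t < 2 ->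
  nth_error (enc_graph G) (2 * (i * S (lgg_n G) + j) + t) = nth_error (enc_vertex G i j) t.
Proof.
  unfold enc_graph. set (n := lgg_n G). intros Hi Hj Ht.
  assert (H : forall i, length (flat_map (fun j => enc_vertex G i j) (seq 0 (S n))) = S n * 2).
  { intros i0. apply (flat_map_block (fun j => enc_vertex G i0 j) 2 (S n)). reflexivity. }
  replace (2 * (i * S n + j) + t) with (i * (S n * 2) + (j * 2 + t)) by lia.
  rewrite (proj2 (flat_map_block _ _ _ H 0)) by lia.
  rewrite (proj2 (flat_map_block (fun j => enc_vertex G (0 + i) j) 2 (S n) ltac:(reflexivity) 0)) by lia.
  reflexivity.
Qed.

(** * Reachability as paths over the bits of an encoding *)

Section Encoding.
Variables (G : LGG) (xs ys xt yt : nat).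
Hypothesis s_vertex : is_vertex G (xs, ys).
Hypothesis t_vertex : is_vertex G (xt, yt).
Let w := enc_instance G (xs, ys) (xt, yt).
Let n := lgg_n G.
Let Tt := xt + yt.
Notation h := (n + 1 + (xs + 1) + (ys + 1) + (xt + 1) + (yt + 1)).
Notation addrG := (addr n n xs ys xt yt).
Notation EG := (E w n Tt n xs ys xt yt).
Notation okG := (ok n Tt).

Lemma unary_length v : length (unary v) = v + 1.
Proof. unfold unary. rewrite length_app, repeat_length. reflexivity. Qed.

Lemma enc_header :
  ublock w 0 n /\ ublock w (n + 1) xs /\ ublock w (n + 1 + (xs + 1)) ys /\
  ublock w (n + 1 + (xs + 1) + (ys + 1)) xt /\
  ublock w (n + 1 + (xs + 1) + (ys + 1) + (xt + 1)) yt.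
Proof.
  unfold w, enc_instance; cbn [fst snd]; fold n.
  split; [apply (ublock_app [] n)|].
  split; [rewrite <- (unary_length n); apply (ublock_app (unary n) xs)|].
  split; [rewrite <- (unary_length n), <- (unary_length xs), <- length_app, app_assoc;
    apply (ublock_app (unary n ++ unary xs) ys)|].
  split; [rewrite <- (unary_length n), <- (unary_length xs), <- (unary_length ys), <- !length_app, !app_assoc, <- app_assoc;
    rewrite <- app_assoc; apply (ublock_app ((unary n ++ unary xs) ++ unary ys) xt)|].
  rewrite <- (unary_length n), <- (unary_length xs), <- (unary_length ys), <- (unary_length xt), <- !length_app, !app_assoc.
  rewrite <- (app_assoc _ (unary yt)). apply ublock_app.
Qed.

Lemma enc_rest k : nth_error w (h + k) = nth_error (enc_graph G) k.
Proof.
  unfold w, enc_instance; cbn [fst snd]; fold n. rewrite !app_assoc.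
  rewrite nth_error_app2; rewrite !length_app, !unary_length; [|lia]. f_equal. lia.
Qed.

Lemma enc_length : length w = h + 2 * (S n * S n).
Proof.
  unfold w, enc_instance; cbn [fst snd]; fold n. rewrite !length_app, !unary_length, enc_graph_length. fold n. lia.
Qed.

Lemma east_bit tau x : x <= n -> x <= tau <= x + n ->
  nth_error w (addrG tau x) = Some (Nat.ltb x n && east G x (tau - x))%bool.
Proof.
  intros Hx Ht. unfold addr. rewrite enc_rest.
  replace (2 * (x * n + tau)) with (2 * (x * S n + (tau - x)) + 0) by nia.
  apply enc_graph_nth; fold n; lia.
Qed.

Lemma north_bit tau x : x <= n -> x <= tau <= x + n ->
  nth_error w (S (addrG tau x)) = Some (Nat.ltb (tau - x) n && north G x (tau - x))%bool.
Proof.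
  intros Hx Ht. unfold addr. rewrite <- Nat.add_succ_r, enc_rest.
  replace (S (2 * (x * n + tau))) with (2 * (x * S n + (tau - x)) + 1) by nia.
  apply enc_graph_nth; fold n; lia.
Qed.

Lemma enc_addr_lt tau x : tau < Tt -> okG tau x -> S (addrG tau x) < length w.
Proof.
  intros Ht [Hx H]. specialize (H Ht). rewrite enc_length. unfold addr.
  assert (x * n <= n * n) by (apply Nat.mul_le_mono_r; lia). lia.
Qed.

Lemma enc_no_east tau : tau < Tt -> okG tau n -> nth_error w (addrG tau n) <> Some true.
Proof.
  intros Ht [Hx H]. specialize (H Ht). rewrite east_bit by lia. rewrite Nat.ltb_irrefl. discriminate.
Qed.

Lemma enc_no_north x : x + n < Tt -> okG (x + n) x -> nth_error w (S (addrG (x + n) x)) <> Some true.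
Proof.
  intros Ht [Hx H]. specialize (H Ht). rewrite north_bit by lia.
  replace (x + n - x) with n by lia. rewrite Nat.ltb_irrefl. discriminate.
Qed.

Lemma edge_E x y x' y' : x + y < Tt -> edge G (x, y) (x', y') ->
  EG (x + y) x x' /\ x' + y' = S (x + y).
Proof.
  intros Ht He. unfold E. destruct (Nat.ltb_spec (x + y) Tt); [|lia].
  assert (En : lgg_n G = n) by reflexivity.
  inversion He as [i j Hi Hj Hb|i j Hi Hj Hb]; subst x y x' y'; split; try lia.
  - right. split; auto. rewrite east_bit by lia. replace (i + j - i) with j by lia.
    destruct (Nat.ltb_spec i n); [|lia]. now rewrite Hb.
  - left. split; auto. rewrite north_bit by lia. replace (i + j - i) with j by lia.
    destruct (Nat.ltb_spec j n); [|lia]. now rewrite Hb.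
Qed.

Lemma E_edge tau x x' : tau < Tt -> okG tau x -> EG tau x x' -> edge G (x, tau - x) (x', S tau - x').
Proof.
  intros Ht [Hx H] He. specialize (H Ht). unfold E in He.
  destruct (Nat.ltb_spec tau Tt); [|lia].
  destruct He as [[-> He]|[-> He]].
  - rewrite north_bit in He by lia. injection He as He. apply andb_true_iff in He. destruct He as [He1 He2].
    apply Nat.ltb_lt in He1. replace (S tau - x) with (S (tau - x)) by lia. apply edge_north; fold n; auto; lia.
  - rewrite east_bit in He by lia. injection He as He. apply andb_true_iff in He. destruct He as [He1 He2].
    apply Nat.ltb_lt in He1. replace (S tau - S x) with (tau - x) by lia. apply edge_east; fold n; auto; lia.
Qed.

Lemma path_idle L : forall tau x y, Tt <= tau -> path EG L tau x y <-> x = y.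
Proof.
  induction L as [|L IH]; intros tau x y Ht; cbn [path]; [tauto|]. unfold E at 1.
  destruct (Nat.ltb_spec tau Tt); [lia|]. split.
  - intros (z & -> & H1). apply IH in H1; auto. 
  - intros ->. exists y. split; auto. apply IH; auto.
Qed.

Lemma edge_sum p q : edge G p q -> fst q + snd q = S (fst p + snd p).
Proof. intros H; inversion H; cbn; lia. Qed.

Lemma reach_sum p q : reach G p q -> fst p + snd p <= fst q + snd q.
Proof.
  induction 1 as [p q H|p|p q r _ H1 _ H2]; [|lia|lia]. apply edge_sum in H. lia.
Qed.

Lemma reach_path p : reach G p (xt, yt) -> path EG (Tt - (fst p + snd p)) (fst p + snd p) (fst p) xt.
Proof.
  intros H. apply clos_rt_rt1n in H. remember (xt, yt) as q eqn:Eq.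
  induction H as [|p u q He Hr IH]; subst.
  - cbn [fst snd]. unfold Tt. rewrite Nat.sub_diag. reflexivity.
  - specialize (IH eq_refl). apply clos_rt1n_rt in Hr. apply reach_sum in Hr.
    pose proof (edge_sum _ _ He) as Hs. destruct p as [x y], u as [x' y']. cbn [fst snd] in *.
    fold Tt in Hr. replace (Tt - (x + y)) with (S (Tt - (x' + y'))) by lia.
    exists x'. split; [apply (edge_E x y x' y'); auto; lia|]. rewrite <- Hs. exact (IH t_vertex).
Qed.

Lemma path_reach L : forall tau x, tau + L = Tt -> okG tau x -> (L = 0 -> x <= tau) -> path EG L tau x xt ->
  reach G (x, tau - x) (xt, yt).
Proof.
  induction L as [|L IH]; intros tau x HL Hok H0 Hp.
  - cbn in Hp. subst xt. replace (tau - x) with yt; [apply rt_refl|]. subst Tt. lia.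
  - destruct Hp as (z & He & Hp). pose proof Hok as [Hx H]. specialize (H ltac:(lia)).
    apply rt_trans with (z, S tau - z).
    + apply rt_step. apply E_edge; auto. lia.
    + apply IH; auto; try lia.
      * eapply E_ok; eauto; [apply enc_no_east|apply enc_no_north].
      * apply E_step in He. lia.
Qed.

(** Steps after layer [Tt] are idle, so every sufficiently large [L] gives the same answer, and
    [|w|] is large enough. The condition [xs + ys <= Tt] has to be stated separately: from a start
    beyond the layer of the target all steps are idle, and a path would exist whenever [xs = xt]. *)
Lemma reach_iff L : length w <= L ->
  (reach G (xs, ys) (xt, yt) <-> xs + ys <= Tt /\ path EG L (xs + ys) xs xt).
Proof.
  intros HL. rewrite enc_length in HL. destruct s_vertex as [Hs1 Hs2], t_vertex as [Ht1 Ht2]. cbn [fst snd] in *.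
  assert (En : lgg_n G = n) by reflexivity.
  assert (HTL : Tt <= L) by (unfold Tt; lia). split.
  - intros H. pose proof (reach_sum _ _ H) as Hle. cbn [fst snd] in Hle. fold Tt in Hle. split; auto.
    apply reach_path in H. cbn [fst snd] in H.
    replace L with (Tt - (xs + ys) + (L - (Tt - (xs + ys)))) by lia.
    apply path_app. exists xt. split; auto. apply path_idle; auto. lia.
  - intros [Hle H]. replace L with (Tt - (xs + ys) + (L - (Tt - (xs + ys)))) in H by lia.
    apply path_app in H. destruct H as (z & H1 & H2). apply path_idle in H2; [|lia]. subst z.
    replace ys with (xs + ys - xs) at 1 by lia.
    apply path_reach with (L := Tt - (xs + ys)); auto; try lia. split; [auto|lia].
Qed.

End Encoding.

(** [q / S n] and [q mod S n] are the coordinates of vertex number [q] in row-major order. *)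
Definition cell_ok (w : list bool) (h n q : nat) : Prop :=
  exists e d, nth_error w (h + 2 * q) = Some e /\ nth_error w (h + 2 * q + 1) = Some d /\
    (q / S n = n -> e = false) /\ (q mod S n = n -> d = false).

Definition bit_at (w : list bool) (p : nat) : bool :=
  match nth_error w p with Some b => b | None => false end.

(** The graph is read off from the word itself; the boundary conditions in [cell_ok] make the guards
    in [enc_vertex] agree with the bits present. *)
Lemma decode w n xs ys xt yt :
  let h := n + 1 + (xs + 1) + (ys + 1) + (xt + 1) + (yt + 1) in
  ublock w 0 n -> ublock w (n + 1) xs -> ublock w (n + 1 + (xs + 1)) ys ->
  ublock w (n + 1 + (xs + 1) + (ys + 1)) xt ->
  ublock w (n + 1 + (xs + 1) + (ys + 1) + (xt + 1)) yt ->
  (forall q, q < S n * S n -> cell_ok w h n q) -> length w = h + 2 * (S n * S n) ->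
  w = enc_instance (mkLGG n (fun i j => bit_at w (h + 2 * (i * S n + j)))
                            (fun i j => bit_at w (h + 2 * (i * S n + j) + 1))) (xs, ys) (xt, yt).
Proof.
  intros h H1 H2 H3 H4 H5 Hq Hl. set (G := mkLGG _ _ _).
  unfold enc_instance; cbn [fst snd]. change (lgg_n G) with n.
  change w with (skipn 0 w) at 1. rewrite (ublock_skipn _ _ _ H1). f_equal.
  change (0 + (n + 1)) with (n + 1). rewrite (ublock_skipn _ _ _ H2). f_equal.
  rewrite (ublock_skipn _ _ _ H3). f_equal.
  rewrite (ublock_skipn _ _ _ H4). f_equal. rewrite (ublock_skipn _ _ _ H5). f_equal.
  fold h. apply nth_error_ext. intros k. rewrite nth_error_skipn.
  destruct (le_lt_dec (2 * (S n * S n)) k) as [Hk|Hk].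
  - rewrite (proj2 (nth_error_None _ _)) by lia. symmetry. apply nth_error_None.
    rewrite enc_graph_length. exact Hk.
  - pose proof (Nat.div_mod_eq k 2) as Ek. pose proof (Nat.mod_upper_bound k 2 ltac:(lia)) as Hm.
    set (q := k / 2) in *. set (t := k mod 2) in *.
    pose proof (Nat.div_mod_eq q (S n)) as Eq. pose proof (Nat.mod_upper_bound q (S n) ltac:(lia)) as Hqm.
    assert (Hqd : q / S n < S n) by (apply Nat.Div0.div_lt_upper_bound; lia).
    destruct (Hq q ltac:(lia)) as (e & d & He & Hd & He' & Hd').
    set (i := q / S n) in *. set (j := q mod S n) in *.
    replace k with (2 * (i * S (lgg_n G) + j) + t) at 2 by (cbn [lgg_n G]; lia).
    rewrite enc_graph_nth by (cbn [lgg_n G]; lia). unfold enc_vertex. cbn [lgg_n east north G].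
    replace (i * S n + j) with q by lia. unfold bit_at. rewrite He, Hd.
    destruct t as [|[|]]; [| |lia]; cbn [nth_error].
    + replace (h + k) with (h + 2 * q) by lia. rewrite He. f_equal.
      destruct (Nat.ltb_spec i n); cbn; auto. apply He'. lia.
    + replace (h + k) with (h + 2 * q + 1) by lia. rewrite Hd. f_equal.
      destruct (Nat.ltb_spec j n); cbn; auto. apply Hd'. lia.
Qed.

(** * The decision program *)

(** Performs [b ^ k] moves by pointer loops, at a time when no register holds that power. The
    counters are the cut indices of [FIND], which resets them before use. *)
Fixpoint NEST (mv : move) (k : nat) : cmd :=
  match k with
  | 0 => Do (Mv mv)
  | S k => PFor (10 + k) pB (NEST mv k)
  end.

Fixpoint PINCS (p c : nat) : cmd :=
  match c with 0 => Skip | S c => Do (PInc p) ;; PINCS p c end.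

(** The rest of the program is passed as [c], so that a missing block ends the run at once, with the
    flag still 0. *)
Definition PARSE (r : nat) (c : cmd) : cmd :=
  Do (Zero r) ;; While true InTrue (Do (Mv MoveR) ;; Do (Inc r)) ;;
  If InEnd Skip (Do (Mv MoveR) ;; c).

Definition SETBAD : cmd := Do (Zero rBad) ;; Do (Inc rBad).

Definition CHECKBIT (c : nat) : cmd :=
  If InEnd SETBAD (If InTrue (If (EqN c rN) SETBAD Skip) Skip) ;; Do (Mv MoveR).

(** The input head cannot pass the end marker: a word that is too short shows up in [CHECKBIT], one
    that is too long in the final test. *)
Definition VALID : cmd :=
  Do (Zero rBad) ;; Do (Copy rE rN) ;; Do (Inc rE) ;;
  NFor rC rE (NFor rD rE (CHECKBIT rC ;; CHECKBIT rD)) ;;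
  If InEnd Skip SETBAD.

(** With the bound [xt], the least reachable position found on the last layer is [xt] iff the target
    is reachable. *)
Definition SOLVE (K : nat) : cmd :=
  Do (Copy rT rX) ;; ADD rT rY ;; Do (Copy rTt rXt) ;; ADD rTt rYt ;;
  LE rT rTt ;;
  If (EqN rFlag rZero) Skip
    (Do (Copy rJ rXt) ;; FIND K ;;
     If (EqN rFlag rZero) Skip (If (EqN rX rXt) Skip (Do (Zero rFlag)))).

Definition REQUIRE (r : nat) (c : cmd) : cmd := LE r rN ;; If (EqN rFlag rZero) Skip c.

Definition BODY (K : nat) : cmd :=
  REQUIRE rX (REQUIRE rY (REQUIRE rXt (REQUIRE rYt
    (VALID ;; If (EqN rBad rZero) (SOLVE K) (Do (Zero rFlag)))))).

(* Finds the least [b] with [|w| <= b ^ K]: the input head is moved [b ^ K] times by nested loops, first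
   to the left as there is no left end marker on the input. *)
Definition SETUP (K C : nat) : cmd :=
  While false InEnd (Do (PInc pB) ;; NEST MoveL K ;; NEST MoveR K) ;;
  Do (PCopy pW pB) ;; PINCS pW C ;; NEST MoveL K ;;
  While false InEnd (Do (Mv MoveR) ;; Do (Inc rLen)) ;;
  NFor rC rLen (Do (Mv MoveL)).

Definition MAIN (K C : nat) : cmd :=
  SETUP K C ;; PARSE rN (PARSE rX (PARSE rY (PARSE rXt (PARSE rYt (BODY K))))).

Lemma NEST_wn mv k r : ~ wn (NEST mv k) r.
Proof. induction k; cbn; tauto. Qed.

Lemma NEST_wp mv k p : wp (NEST mv k) p -> 10 <= p < 10 + k.
Proof. induction k as [|k IH]; cbn; [tauto|]. intros H; repeat destruct H as [H|H]; try apply IH in H; lia. Qed.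

Lemma iter_moveL l t p : Nat.iter t (move_input l MoveL) p = p - t.
Proof. induction t; [cbn; lia|]. change (Nat.pred (Nat.iter t (move_input l MoveL) p) = p - S t). rewrite IHt. lia. Qed.

Lemma iter_moveR l t p : p <= l -> Nat.iter t (move_input l MoveR) p = Nat.min (p + t) l.
Proof. intros H. induction t; [cbn; lia|]. change (Nat.min (S (Nat.iter t (move_input l MoveR) p)) l = Nat.min (p + S t) l). rewrite IHt. lia. Qed.

Lemma nth_error_min {T} (l : list T) p : nth_error l (Nat.min p (length l)) = nth_error l p.
Proof.
  destruct (le_lt_dec p (length l)).
  - now rewrite Nat.min_l.
  - rewrite Nat.min_r by lia. rewrite !(proj2 (nth_error_None _ _)) by lia. reflexivity.
Qed.

Lemma search_bound b n m : b + 2 <= m -> n + 2 <= m -> 1 + b * S (S n) * (b + 1) + b <= m ^ 4.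
Proof.
  intros Hb Hn.
  assert (A1 : b * S (S n) <= m * m) by (apply Nat.mul_le_mono; lia).
  assert (A2 : b * S (S n) * (b + 1) <= m * m * m) by (apply Nat.mul_le_mono; lia).
  assert (A3 : m * m <= m * m * m) by nia.
  assert (A4 : m * m * m * 2 <= m * m * m * m) by (apply Nat.mul_le_mono; lia).
  change (m ^ 4) with (m * (m * (m * (m * 1)))). nia.
Qed.

(** * Correctness of the decision program *)

Section Main.
Variables (V : nat) (w : list bool) (m K C b : nat).
Notation runs := (runs V w m).
Notation len := (length w).
Hypothesis K_pos : 1 <= K.
Hypothesis b_root : len <= b ^ K.
Hypothesis b_least : forall b', b' < b -> b' ^ K < len.
Hypothesis m_len : len + C + 5 <= m.
Hypothesis V_b : (b + 1) * (b + C + 1) <= V.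
Hypothesis C_big : 2 * b ^ K + 4 < 2 ^ (b + C).

Lemma m_ge : 2 <= m. Proof. lia. Qed.
Lemma V_ge : 1 <= V. Proof. nia. Qed.
Hint Resolve m_ge V_ge : core.

Lemma b_le_len : b <= len.
Proof.
  destruct (le_lt_dec b len) as [|h]; auto. apply b_least in h.
  assert (len <= len ^ K); [|lia]. destruct (Nat.eq_dec len 0) as [->|]; [lia|].
  rewrite <- (Nat.pow_1_r len) at 1. apply Nat.pow_le_mono_r; lia.
Qed.

Lemma bC_V : b + C <= V. Proof. nia. Qed.

(** Room for all numbers that occur: since [|w| <= b ^ K], the largest layer number
    [xs + ys + b ^ K] is below [2 * b ^ K + 4]. *)
Lemma V_big : 2 * b ^ K + 4 < 2 ^ V.
Proof. pose proof (Nat.pow_le_mono_r 2 (b + C) V ltac:(lia) bC_V). lia. Qed.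

Lemma runs_NEST mv k : forall s (Q : st -> Prop),
  ptr s pB <= b ->
  (forall s', frame (NEST mv k) s s' -> ip s' = Nat.iter (ptr s pB ^ k) (move_input len mv) (ip s) -> Q s') ->
  runs (NEST mv k) s Q.
Proof.
  pose proof b_le_len. pose proof bC_V.
  induction k as [|k IH]; intros s Q Hb HQ.
  - apply runs_do; [exact Logic.I|]. apply HQ; [apply frame_atom|reflexivity].
  - cbn [NEST]. apply runs_pfor with (Inv := fun i s1 => ip s1 = Nat.iter (i * ptr s pB ^ k) (move_input len mv) (ip s));
      auto; try lia.
    + intros hh. apply NEST_wp in hh. lia.
    + intros hh. apply NEST_wp in hh. lia.
    + intros i s1 Hi _ (_ & Fp & _) Hinv.
      assert (EB : ptr s1 pB = ptr s pB).
      { apply Fp. cbn -[NEST]. intros hh. repeat destruct hh as [hh|hh]; try lia. apply NEST_wp in hh. lia. }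
      apply IH; [lia|]. intros s2 _ H2. ipc. rewrite H2, Hinv, EB, <- Nat.iter_add. reflexivity.
Qed.

Lemma runs_PINCS p c : forall s (Q : st -> Prop),
  ptr s p + c <= V -> (forall s', frame (PINCS p c) s s' -> ptr s' p = ptr s p + c -> Q s') ->
  runs (PINCS p c) s Q.
Proof.
  induction c as [|c IH]; intros s Q Hc HQ; cbn [PINCS].
  - apply runs_skip; [auto|]. apply HQ; [apply frame_refl|lia].
  - apply runs_frame. apply runs_seq; auto. apply runs_do; [cbn; lia|].
    apply IH; look; [lia|]. intros s' _ H1 Hf. apply HQ; auto. lia.
Qed.

Lemma in_end s : test_val w InEnd s = true <-> len <= ip s.
Proof.
  cbn. rewrite <- nth_error_None. destruct (nth_error w (ip s)); split; congruence.
Qed.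

Lemma runs_SETUP s (Q : st -> Prop) :
  ip s = 0 -> ptr s pB = 0 -> num s rLen = 0 ->
  (forall s', frame (SETUP K C) s s' -> ptr s' pB = b -> ptr s' pW = b + C -> num s' rLen = len -> ip s' = 0 -> Q s') ->
  runs (SETUP K C) s Q.
Proof.
  intros Hip HB HL HQ. apply runs_frame. pose proof b_le_len. pose proof bC_V. pose proof V_big.
  apply runs_seq; auto.
  (* The head stands at [min (pB ^ K) |w|], so it sees the end marker exactly when
     [|w| <= pB ^ K]. *)
  apply runs_while with (Inv := fun s1 => ptr s1 pB <= b /\ ip s1 = Nat.min (ptr s1 pB ^ K) len)
    (mu := fun s1 => b - ptr s1 pB); auto.
  - rewrite HB, Hip. rewrite Nat.pow_0_l by lia. lia.
  - pose proof (le_pow4 m m_ge b ltac:(lia)). lia.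
  - intros s1 _ [Hb1 Hi1] Ht.
    assert (Hlt : ip s1 < len).
    { destruct (le_lt_dec len (ip s1)) as [h|]; auto. apply in_end in h. congruence. }
    assert (Hbb : ptr s1 pB < b).
    { destruct (Nat.eq_dec (ptr s1 pB) b) as [e|]; [rewrite e in *|]; lia. }
    apply runs_seq; auto. apply runs_do; [cbn; lia|].
    apply runs_seq; auto. apply runs_NEST; look; [lia|]. intros s2 (_ & Fp2 & _) Hi2.
    assert (B2 : ptr s2 pB = S (ptr s1 pB)).
    { rewrite Fp2; [reflexivity|]. intros hh. apply NEST_wp in hh. lia. }
    apply runs_NEST; [lia|]. intros s3 (_ & Fp3 & _) Hi3.
    assert (B3 : ptr s3 pB = S (ptr s1 pB)).
    { rewrite Fp3; [auto|]. intros hh. apply NEST_wp in hh. lia. }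
    (* The increased [pB] yields at least as many left moves as the head is far from 0, so the right
       moves start from 0. *)
    pose proof (Nat.pow_le_mono_l (ptr s1 pB) (S (ptr s1 pB)) K ltac:(lia)) as Hmono.
    rewrite iter_moveL in Hi2. rewrite iter_moveR in Hi3 by lia. rewrite B3. rewrite B2 in Hi3.
    split; [split|]; lia.
  - intros s1 F1 [Hb1 Hi1] Ht. apply in_end in Ht.
    assert (B1 : ptr s1 pB = b).
    { destruct (Nat.eq_dec (ptr s1 pB) b) as [|h]; auto. specialize (b_least (ptr s1 pB) ltac:(lia)). lia. }
    apply runs_seq; auto. apply runs_do; [exact Logic.I|].
    apply runs_seq; auto. apply runs_PINCS; look; [lia|]. intros s2 (Fn2 & Fp2 & Fi2) W2.
    assert (HPW : forall c p, wp (PINCS pW c) p -> p = pW).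
    { induction c; cbn; [tauto|]. intros p [|]; auto. }
    assert (HPN : forall c r, ~ wn (PINCS pW c) r) by (induction c; cbn; intros r; [tauto|specialize (IHc r); tauto]).
    assert (HPI : forall c, ~ wi (PINCS pW c)) by (induction c; cbn; tauto).
    assert (B2 : ptr s2 pB = b).
    { rewrite Fp2; [exact B1|]. intros hh. apply HPW in hh. lia. }
    assert (L2 : num s2 rLen = 0).
    { rewrite Fn2 by auto. cbn. destruct F1 as (Fn1 & _). rewrite Fn1; auto. cbn.
      intros [hh|[hh|hh]]; [exact hh|exact (NEST_wn _ _ _ hh)..]. }
    assert (I2 : ip s2 <= len) by (rewrite Fi2 by auto; cbn; lia).
    apply runs_seq; auto. apply runs_NEST; [lia|]. intros s3 (Fn3 & Fp3 & _) Hi3. rewrite iter_moveL, B2 in Hi3.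
    assert (B3 : ptr s3 pB = b).
    { rewrite Fp3; [auto|]. intros hh. apply NEST_wp in hh. lia. }
    assert (W3 : ptr s3 pW = b + C).
    { rewrite Fp3; [rewrite W2, B1; auto|]. intros hh. apply NEST_wp in hh. lia. }
    assert (L3 : num s3 rLen = 0) by (rewrite Fn3; [auto|apply NEST_wn]).
    apply runs_seq; auto.
    apply runs_while with (Inv := fun s4 => ip s4 = num s4 rLen /\ ip s4 <= len) (mu := fun s4 => len - ip s4); auto.
    + lia.
    + pose proof (le_pow4 m m_ge len ltac:(lia)). lia.
    + intros s4 _ [H4 H4'] Ht4.
      assert (Hlt : ip s4 < len).
      { destruct (le_lt_dec len (ip s4)) as [h|]; auto. apply in_end in h. congruence. }
      apply runs_seq; auto. apply runs_do; [exact Logic.I|]. apply runs_do; [cbn; lia|].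
      look. cbn [move_input]. lia.
    + intros s4 (_ & Fp4 & _) [H4 H4'] Ht4. apply in_end in Ht4.
      assert (B4 : ptr s4 pB = b) by (rewrite Fp4; [auto|cbn; lia]).
      assert (W4 : ptr s4 pW = b + C) by (rewrite Fp4; [auto|cbn; lia]).
      apply runs_nfor with (Inv := fun i s5 => ip s5 = len - i); auto; try (cbn; lia).
      * intros i s5 _ _ _ H5. apply runs_do; [exact Logic.I|]. ipc. lia.
      * intros s5 (Fn5 & Fp5 & _) _ H5 Hf. apply HQ; auto; try lia.
        -- rewrite Fp5; [auto|cbn; lia].
        -- rewrite Fp5; [auto|cbn; lia].
        -- rewrite Fn5; [lia|cbn; lia].
Qed.

Lemma runs_PARSE r c s (Q : st -> Prop) :
  ip s <= len ->
  (forall v s', ublock w (ip s) v -> num s' r = v -> (forall q, q <> r -> num s' q = num s q) ->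
     ptr s' = ptr s -> ip s' = ip s + (v + 1) -> ip s' <= len -> v < len -> runs c s' Q) ->
  ((forall v, ~ ublock w (ip s) v) -> forall s', (forall q, q <> r -> num s' q = num s q) -> Q s') ->
  runs (PARSE r c) s Q.
Proof.
  intros Hip Hok Hbad. pose proof V_big. apply runs_seq; auto. apply runs_do; [exact Logic.I|].
  apply runs_seq; auto.
  apply runs_while with (Inv := fun s1 => ip s1 = ip s + num s1 r /\ ip s1 <= len /\
     (forall q, q <> r -> num s1 q = num s q) /\ ptr s1 = ptr s /\
     forall i, i < num s1 r -> nth_error w (ip s + i) = Some true) (mu := fun s1 => len - ip s1); auto.
  - look. repeat split; auto; try lia. intros q Hq. look. reflexivity.
  - pose proof (le_pow4 m m_ge len ltac:(lia)). lia.
  - intros s1 _ (H1 & H2 & H3 & H4 & H5) Ht. cbn in Ht.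
    destruct (nth_error w (ip s1)) as [bb|] eqn:En; [|discriminate]. subst bb.
    assert (Hlt : ip s1 < len) by (apply nth_error_Some; congruence).
    apply runs_seq; auto. apply runs_do; [exact Logic.I|]. apply runs_do; [cbn; lia|].
    look. cbn [move_input]. repeat split; auto; try lia.
    + intros q Hq. look. auto.
    + intros i Hi. destruct (Nat.eq_dec i (num s1 r)) as [->|]; [rewrite <- H1; auto|]. apply H5. lia.
  - intros s1 _ (H1 & H2 & H3 & H4 & H5) Ht. cbn in Ht.
    apply runs_if; auto; intros Ht2.
    + apply runs_skip; [auto|]. apply Hbad; auto. intros v [Hv1 Hv2]. apply in_end in Ht2.
      assert (ip s + v < len) by (apply nth_error_Some; congruence).
      destruct (lt_eq_lt_dec v (num s1 r)) as [[h|h]|h]; [|lia|lia].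
      rewrite H5 in Hv2 by auto. discriminate.
    + destruct (nth_error w (ip s1)) as [bb|] eqn:En.
      * subst bb. assert (Hlt : ip s1 < len) by (apply nth_error_Some; congruence).
        apply runs_seq; auto. apply runs_do; [exact Logic.I|].
        apply (Hok (num s1 r)); auto; ipc; try lia. split; auto. rewrite <- H1. auto.
      * cbn in Ht2. rewrite En in Ht2. discriminate.
Qed.

Definition verdict (s : st) : Prop :=
  (LGGR w /\ num s rFlag = 1) \/ (~ LGGR w /\ num s rFlag = 0).

Section Instance.
Variables n xs ys xt yt : nat.
Notation h := (n + 1 + (xs + 1) + (ys + 1) + (xt + 1) + (yt + 1)).
Hypothesis u1 : ublock w 0 n.
Hypothesis u2 : ublock w (n + 1) xs.
Hypothesis u3 : ublock w (n + 1 + (xs + 1)) ys.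
Hypothesis u4 : ublock w (n + 1 + (xs + 1) + (ys + 1)) xt.
Hypothesis u5 : ublock w (n + 1 + (xs + 1) + (ys + 1) + (xt + 1)) yt.

Lemma h_le : h <= len.
Proof. destruct u5 as [_ H]. assert (n + 1 + (xs + 1) + (ys + 1) + (xt + 1) + yt < len) by (apply nth_error_Some; congruence). lia. Qed.

Definition base_st (s : st) : Prop :=
  num s rLen = len /\ num s rN = n /\ num s rZero = 0 /\
  num s rX = xs /\ num s rY = ys /\ num s rXt = xt /\ num s rYt = yt /\
  ptr s pB = b /\ ptr s pW = b + C /\ ptr s pZ = 0.

(** [p] is the intended address, possibly beyond the input; the head is then held at the end marker,
    and [nth_error] is [None] at either place. *)
Lemma runs_CHECKBIT c i p s (Q : st -> Prop) :
  c <> rBad -> num s rN = n -> num s c = i -> ip s = Nat.min p len ->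
  (forall s', frame (CHECKBIT c) s s' -> ip s' = Nat.min (S p) len ->
     (num s' rBad = 0 <-> num s rBad = 0 /\ exists e, nth_error w p = Some e /\ (i = n -> e = false)) -> Q s') ->
  runs (CHECKBIT c) s Q.
Proof.
  intros Hc HN Hi Hip HQ. apply runs_frame. pose proof V_big.
  assert (Hbit : nth_error w (ip s) = nth_error w p) by (rewrite Hip; apply nth_error_min).
  apply runs_seq; auto.
  assert (Hbad : forall (B : Prop), ~ B ->
    runs SETBAD s (fun s' => runs (Do (Mv MoveR)) s' (fun s'' => ip s'' = Nat.min (S p) len /\ (num s'' rBad = 0 <-> B)))).
  { intros B HB. apply runs_seq; auto. apply runs_do; [exact Logic.I|]. apply runs_do; [cbn; lia|].
    apply runs_do; [exact Logic.I|]. split; [ipc; rewrite Hip; cbn [move_input]; lia|]. look. split; [discriminate|tauto]. }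
  assert (Hgood : forall (B : Prop), B ->
    runs Skip s (fun s' => runs (Do (Mv MoveR)) s' (fun s'' => ip s'' = Nat.min (S p) len /\ (num s'' rBad = 0 <-> num s rBad = 0 /\ B)))).
  { intros B HB. apply runs_skip; [auto|].
    apply runs_do; [exact Logic.I|]. split; [ipc; rewrite Hip; cbn [move_input]; lia|]. look. tauto. }
  assert (Hfin : forall c', runs c' s (fun s' => runs (Do (Mv MoveR)) s' (fun s'' => ip s'' = Nat.min (S p) len /\
      (num s'' rBad = 0 <-> num s rBad = 0 /\ exists e, nth_error w p = Some e /\ (i = n -> e = false)))) ->
    runs c' s (fun s' => runs (Do (Mv MoveR)) s' (fun s'' => frame (CHECKBIT c) s s'' -> Q s''))).
  { intros c' Hr. eapply runs_mono; [exact Hr|]. intros s' _ Hr'. eapply runs_mono; [exact Hr'|].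
    intros s'' _ [A1 A2] Hf. apply HQ; auto. }
  apply Hfin. apply runs_if; auto; cbn [test_val]; rewrite Hbit; intros Ht.
  - apply Hbad. intros (_ & e & He & _). rewrite He in Ht. discriminate.
  - destruct (nth_error w p) as [e|] eqn:Ee; [|discriminate].
    apply runs_if; auto; cbn [test_val]; rewrite Hbit; intros ->.
    + apply runs_if; auto; cbn [test_val]; rewrite HN, Hi; intros Hin.
      * apply Nat.eqb_eq in Hin. apply Hbad. intros (_ & e & He & He'). injection He as <-. specialize (He' Hin). discriminate.
      * apply Nat.eqb_neq in Hin. apply Hgood. exists true. split; auto. lia.
    + apply Hgood. exists false. auto.
Qed.

Lemma runs_VALID s (Q : st -> Prop) :
  base_st s -> ip s = h ->
  (forall s', frame VALID s s' -> ip s' <= len ->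
     (num s' rBad = 0 <-> (forall q, q < S n * S n -> cell_ok w h n q) /\ len = h + 2 * (S n * S n)) -> Q s') ->
  runs VALID s Q.
Proof.
  intros (_ & HN & _) Hip HQ. pose proof h_le. pose proof V_big.
  apply runs_frame. apply runs_seq; auto. apply runs_do; [exact Logic.I|].
  apply runs_seq; auto. apply runs_do; [exact Logic.I|].
  apply runs_seq; auto. apply runs_do; [cbn; lia|].
  apply runs_seq; auto.
  set (upto := fun k => forall q, q < k -> cell_ok w h n q).
  assert (Hstep : forall i j s1 (Q1 : st -> Prop), i <= n -> j <= n -> num s1 rN = n -> num s1 rC = i -> num s1 rD = j ->
    ip s1 = Nat.min (h + 2 * (i * S n + j)) len -> (num s1 rBad = 0 <-> upto (i * S n + j)) ->
    (forall s2, frame (CHECKBIT rC ;; CHECKBIT rD) s1 s2 -> ip s2 = Nat.min (h + 2 * (i * S n + S j)) len ->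
       (num s2 rBad = 0 <-> upto (i * S n + S j)) -> Q1 s2) ->
    runs (CHECKBIT rC ;; CHECKBIT rD) s1 Q1).
  { intros i j s1 Q1 Hi Hj N1 C1 D1 I1 B1 HQ1. apply runs_frame. apply runs_seq; auto.
    apply runs_CHECKBIT with (i := i) (p := h + 2 * (i * S n + j)); auto; try lia.
    intros s2 (Fn2 & _) I2 B2.
    apply runs_CHECKBIT with (i := j) (p := S (h + 2 * (i * S n + j))); auto; try lia.
    - rewrite Fn2; [auto|cbn; lia].
    - rewrite Fn2; [auto|cbn; lia].
    - intros s3 _ I3 B3 Hf. apply HQ1; auto; [rewrite I3; f_equal; lia|].
      rewrite B3, B2, B1. set (q := i * S n + j).
      assert (Dq : q / S n = i).
      { unfold q. rewrite Nat.add_comm, Nat.div_add by lia. rewrite Nat.div_small by lia. lia. }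
      assert (Mq : q mod S n = j).
      { unfold q. rewrite Nat.add_comm, Nat.Div0.mod_add. apply Nat.mod_small. lia. }
      replace (i * S n + S j) with (S q) by (unfold q; lia). unfold upto.
      replace (S (h + 2 * q)) with (h + 2 * q + 1) by lia. split.
      + intros ((A1 & e & A2 & A3) & e' & A4 & A5) q' Hq'. destruct (Nat.eq_dec q' q) as [->|]; [|apply A1; lia].
        exists e, e'. rewrite Dq, Mq. auto.
      + intros A. destruct (A q ltac:(lia)) as (e & e' & A1 & A2 & A3 & A4). rewrite Dq in A3. rewrite Mq in A4.
        split; [split; [intros; apply A; lia|eauto]|eauto]. }
  apply runs_nfor with (Inv := fun i s1 => ip s1 = Nat.min (h + 2 * (i * S n)) len /\ (num s1 rBad = 0 <-> upto (i * S n)));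
    auto; try (look; rewrite ?HN; cbn; lia).
  - look. split; [rewrite Hip; cbn [Nat.mul]; lia|]. cbn [Nat.mul]. split; auto. intros _ q Hq. lia.
  - look. rewrite HN. intros i s1 Hi C1 (Fn1 & _) [I1 B1].
    assert (N1 : num s1 rN = n) by (rewrite Fn1 by (cbn; lia); look; auto).
    assert (E1 : num s1 rE = S n) by (rewrite Fn1 by (cbn; lia); look; auto).
    apply runs_nfor with (Inv := fun j s2 => ip s2 = Nat.min (h + 2 * (i * S n + j)) len /\ (num s2 rBad = 0 <-> upto (i * S n + j)));
      rewrite ?E1; auto; try (cbn; lia).
    + look. rewrite !Nat.add_0_r. auto.
    + intros j s2 Hj D2 (Fn2 & _) [I2 B2].
      apply Hstep with (i := i) (j := j); auto; try lia.
      * rewrite Fn2 by (cbn; lia). auto.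
      * rewrite Fn2 by (cbn; lia). auto.
    + intros s2 (Fn2 & _) _ [I2 B2]. look. replace (S i * S n) with (i * S n + S n) by lia. auto.
  - look. rewrite HN. intros s1 _ _ [I1 B1].
    apply runs_if; auto; intros Ht.
    + apply in_end in Ht. apply runs_skip; [auto|]. intros Hf. apply HQ; auto; [lia|]. rewrite B1. split; [|tauto].
      (* The existence of the last cell bounds the length from below, the head at the end marker
         bounds it from above. *)
      intros A. split; auto. destruct (A (n * S n + n) ltac:(lia)) as (e & e' & _ & A2 & _).
      assert (h + 2 * (n * S n + n) + 1 < len) by (apply nth_error_Some; congruence). lia.
    + assert (Hlt : ip s1 < len).
      { destruct (le_lt_dec len (ip s1)) as [hh|]; auto. apply in_end in hh. congruence. }
      apply runs_seq; auto. apply runs_do; [exact Logic.I|]. apply runs_do; [cbn; lia|].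
      intros Hf. apply HQ; auto; [cbn; lia|]. look. split; [discriminate|]. intros [_ A]. lia.
Qed.

Lemma instance_unique G s t :
  enc_instance G s t = w ->
  lgg_n G = n /\ s = (xs, ys) /\ t = (xt, yt).
Proof.
  destruct s as [a1 a2], t as [a3 a4]. intros Hw.
  destruct (enc_header G a1 a2 a3 a4) as (H1 & H2 & H3 & H4 & H5). rewrite Hw in *.
  assert (E1 : lgg_n G = n) by (eapply ublock_unique; eauto). rewrite E1 in *.
  assert (E2 : a1 = xs) by (eapply ublock_unique; eauto). rewrite E2 in *.
  assert (E3 : a2 = ys) by (eapply ublock_unique; eauto). rewrite E3 in *.
  assert (E4 : a3 = xt) by (eapply ublock_unique; eauto). rewrite E4 in *.
  assert (E5 : a4 = yt) by (eapply ublock_unique; eauto). rewrite E5 in *. auto.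
Qed.

Lemma instance_cells G :
  enc_instance G (xs, ys) (xt, yt) = w -> lgg_n G = n ->
  (forall q, q < S n * S n -> cell_ok w h n q) /\ len = h + 2 * (S n * S n).
Proof.
  intros Hw Hn. pose proof (enc_length G xs ys xt yt) as Hl. rewrite Hw, Hn in Hl. split; auto.
  intros q Hq. pose proof (Nat.div_mod_eq q (S n)) as Eq.
  pose proof (Nat.mod_upper_bound q (S n) ltac:(lia)) as Hqm.
  assert (Hqd : q / S n < S n) by (apply Nat.Div0.div_lt_upper_bound; lia).
  set (i := q / S n) in *. set (j := q mod S n) in *.
  pose proof (enc_rest G xs ys xt yt (2 * q + 0)) as R0. pose proof (enc_rest G xs ys xt yt (2 * q + 1)) as R1.
  rewrite Hw, Hn in R0, R1.
  assert (B0 : forall t, t < 2 -> nth_error (enc_graph G) (2 * q + t) = nth_error (enc_vertex G i j) t).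
  { intros t Ht. rewrite <- enc_graph_nth by lia. f_equal. rewrite Hn. lia. }
  rewrite B0 in R0, R1 by lia. unfold enc_vertex in R0, R1. rewrite Hn in R0, R1. cbn [nth_error] in R0, R1.
  rewrite Nat.add_0_r in R0. rewrite Nat.add_assoc in R1.
  exists (Nat.ltb i n && east G i j)%bool, (Nat.ltb j n && north G i j)%bool.
  repeat split; auto.
  - intros Hi. change (q / S n) with i in Hi. rewrite Hi. now rewrite Nat.ltb_irrefl.
  - intros Hj. change (q mod S n) with j in Hj. rewrite Hj. now rewrite Nat.ltb_irrefl.
Qed.

Lemma runs_SOLVE G s :
  w = enc_instance G (xs, ys) (xt, yt) -> lgg_n G = n -> xs <= n -> ys <= n -> xt <= n -> yt <= n ->
  base_st s -> ip s <= len -> runs (SOLVE K) s verdict.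
Proof.
  intros Hw Hn Hxs Hys Hxt Hyt (HL & HN & HZ & HX & HY & HXt & HYt & HB & HW & HPZ) Hip.
  pose proof h_le. pose proof V_big. pose proof bC_V. pose proof b_le_len.
  assert (Hs : is_vertex G (xs, ys)) by (split; cbn; lia).
  assert (Ht : is_vertex G (xt, yt)) by (split; cbn; lia).
  (* Graphs with the same encoding may differ as functions outside the grid; they are compared
     through the paths read off from [w], which depend on the word alone. *)
  assert (Hiff : LGGR w <-> xs + ys <= xt + yt /\
    path (E w n (xt + yt) n xs ys xt yt) (b ^ K) (xs + ys) xs xt).
  { split.
    - intros (G' & s' & t' & Hs' & Ht' & Hw' & Hr). destruct (instance_unique _ _ _ Hw') as (A1 & -> & ->).
      apply (reach_iff G' xs ys xt yt Hs' Ht' (b ^ K)) in Hr; [|rewrite Hw'; auto].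
      rewrite Hw', A1 in Hr. exact Hr.
    - intros Hp. exists G, (xs, ys), (xt, yt). repeat split; auto; try apply Hs; try apply Ht.
      apply (reach_iff G xs ys xt yt Hs Ht (b ^ K)); [rewrite <- Hw; auto|]. rewrite <- Hw, Hn. exact Hp. }
  apply runs_seq; auto. apply runs_do; [exact Logic.I|].
  apply runs_seq; auto. apply runs_ADD; auto; look; rewrite ?HX, ?HY; try lia. intros s1 (Fn1 & Fp1 & Fi1) T1.
  assert (N1 : forall q, q <> rT -> q <> rK -> num s1 q = num s q).
  { intros q Hq Hq'. rewrite Fn1 by (cbn; lia). look. reflexivity. }
  assert (P1 : forall p, ptr s1 p = ptr s p) by (intros p; rewrite Fp1 by (cbn; lia); reflexivity).
  assert (I1 : ip s1 = ip s) by (rewrite Fi1 by (cbn; lia); reflexivity). clear Fn1 Fp1 Fi1.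
  apply runs_seq; auto. apply runs_do; [exact Logic.I|].
  apply runs_seq; auto. apply runs_ADD; auto; look; rewrite ?N1, ?HXt, ?HYt by lia; try lia. intros s2 (Fn2 & Fp2 & Fi2) T2.
  assert (N2 : forall q, q <> rTt -> q <> rK -> num s2 q = num s1 q).
  { intros q Hq Hq'. rewrite Fn2 by (cbn; lia). look. reflexivity. }
  assert (P2 : forall p, ptr s2 p = ptr s p) by (intros p; rewrite Fp2 by (cbn; lia); apply P1).
  assert (I2 : ip s2 = ip s) by (rewrite Fi2 by (cbn; lia); apply I1). clear Fn2 Fp2 Fi2.
  apply runs_seq; auto. apply runs_LE; auto; rewrite ?N2, ?T1 by lia; try lia. intros s3 (Fn3 & Fp3 & Fi3) F3.
  rewrite T2 in F3.
  assert (N3 : forall q, q <> rFlag -> q <> rK -> num s3 q = num s2 q).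
  { intros q Hq Hq'. rewrite Fn3 by (cbn; lia). reflexivity. }
  assert (P3' : forall p, ptr s3 p = ptr s p) by (intros p; rewrite Fp3 by (cbn; lia); apply P2).
  assert (I3 : ip s3 = ip s) by (rewrite Fi3 by (cbn; lia); apply I2). clear Fn3 Fp3 Fi3.
  assert (Z3 : num s3 rZero = 0) by (rewrite N3, N2, N1 by lia; auto).
  destruct (flag_test w s3 _ _ Z3 F3) as [Hf1 Hf2].
  apply runs_if; auto; intros Htest.
  { apply Hf1 in Htest. apply runs_skip; [auto|]. right. split; [rewrite Hiff; lia|].
    rewrite F3. destruct (Nat.leb_spec (xs + ys) (xt + yt)); [lia|auto]. }
  apply Hf2 in Htest. destruct Htest as [Hle _].
  assert (Hlen : len = h + 2 * (S n * S n)) by (rewrite Hw at 1; rewrite enc_length, Hn; auto).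
  assert (Hb1 : 1 <= b).
  { destruct b; [|lia]. rewrite Nat.pow_0_l in b_root by lia. lia. }
  assert (Hnb : S n < 2 ^ (b + C)) by lia.
  assert (HbV : b * (b + C) <= V) by (clear - V_b; nia).
  assert (Hmu : 1 + b * S (S n) * (b + 1) + b <= m ^ 4).
  { apply search_bound; lia. }
  apply runs_seq; auto. apply runs_do; [exact Logic.I|].
  apply runs_seq; auto.
  match goal with |- runs _ ?t _ => set (s4 := t) end.
  eapply runs_mono.
  { apply runs_FIND with (b := b) (d := b + C) (n := n) (Tt := xt + yt) (v1 := n) (v2 := xs) (v3 := ys) (v4 := xt) (v5 := yt)
      (tau := xs + ys) (x := xs) (j := xt); auto; try lia.
    - intros tau x A1 A2. rewrite Hw, <- Hn. apply enc_addr_lt; rewrite ?Hn; auto.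
    - intros tau A1 A2. rewrite Hw, <- Hn. apply enc_no_east; rewrite ?Hn; auto.
    - intros x A1 A2. rewrite Hw, <- Hn. apply enc_no_north; rewrite ?Hn; auto.
    - repeat split; unfold s4; look; rewrite ?P3', ?N3, ?T2 by lia; auto; rewrite ?N2, ?N1 by lia; auto. lia.
    - unfold s4; look. rewrite N3, N2 by lia. auto.
    - unfold s4; look. rewrite N3, N2, N1 by lia. auto.
    - unfold s4; look. rewrite N3, N2, N1 by lia. auto.
    - split; [lia|]. lia. }
  intros s5 (Fn5 & _) [E5 R5].
  assert (X5 : num s5 rXt = xt).
  { rewrite Fn5; [unfold s4; look; rewrite N3, N2, N1 by lia; auto|]. intros hh. apply FIND_wn in hh. lia. }
  assert (Z5 : num s5 rZero = 0) by apply E5.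
  destruct R5 as [(R1 & R2 & R3 & R4 & R5)|(R1 & R2 & R3 & R4)].
  - apply runs_if; auto; cbn [test_val]; rewrite Z5, R1; [discriminate|]. intros _.
    apply runs_if; auto; cbn [test_val]; rewrite X5; intros Heq.
    + apply Nat.eqb_eq in Heq. apply runs_skip; [auto|]. left. split; auto. apply Hiff. rewrite Heq in R4. auto.
    + apply Nat.eqb_neq in Heq. apply runs_do; [exact Logic.I|]. right. split; [|reflexivity].
      rewrite Hiff. intros [_ Hp]. specialize (R5 xt (le_n _) Hp). lia.
  - apply runs_if; auto; cbn [test_val]; rewrite Z5, R1; [|discriminate]. intros _.
    apply runs_skip; [auto|]. right. split; auto. rewrite Hiff. intros [_ Hp]. apply (R4 xt); auto.
Qed.

Lemma runs_REQUIRE r v c s :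
  6 <= r <= 13 \/ r = rXt -> base_st s -> num s r = v -> v <= len ->
  (n < v -> ~ LGGR w) ->
  (v <= n -> forall s', base_st s' -> ip s' = ip s -> runs c s' verdict) ->
  runs (REQUIRE r c) s verdict.
Proof.
  intros Hr Hs Hv Hl Hbad Hok. pose proof V_big.
  apply runs_seq; auto. apply runs_LE; auto; rewrite ?Hv; try lia. intros s1 (Fn & Fp & Fi) F1.
  assert (Hs1 : base_st s1).
  { destruct Hs as (A1 & A2 & A3 & A4 & A5 & A6 & A7 & A8 & A9 & A10).
    repeat split; rewrite ?Fn, ?Fp by (cbn; lia); auto. }
  assert (I1 : ip s1 = ip s) by (apply Fi; cbn; lia).
  assert (N0 : num s rN = n) by apply Hs. rewrite N0 in F1.
  assert (Z1 : num s1 rZero = 0) by apply Hs1.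
  destruct (flag_test w s1 _ _ Z1 F1) as [Hf1 Hf2].
  apply runs_if; auto; intros Htest.
  - apply Hf1 in Htest. apply runs_skip; [auto|]. right. split; auto.
    rewrite F1. destruct (Nat.leb_spec v n); [lia|auto].
  - apply Hf2 in Htest. apply Hok; tauto.
Qed.

Lemma runs_BODY s : base_st s -> ip s = h -> runs (BODY K) s verdict.
Proof.
  intros Hs0 Hip0. pose proof h_le.
  assert (Hvert : LGGR w -> xs <= n /\ ys <= n /\ xt <= n /\ yt <= n).
  { intros (G & s' & t' & [V1 V2] & [V3 V4] & Hw & _). destruct (instance_unique _ _ _ Hw) as (En & -> & ->).
    rewrite En in *. auto. }
  apply (runs_REQUIRE rX xs); auto; [lia|apply Hs0|lia|intros A1 A2; apply Hvert in A2; lia|].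
  intros B1 s1 Hs1 Hip1.
  apply (runs_REQUIRE rY ys); auto; [lia|apply Hs1|lia|intros A1 A2; apply Hvert in A2; lia|].
  intros B2 s2 Hs2 Hip2.
  apply (runs_REQUIRE rXt xt); auto; [apply Hs2|lia|intros A1 A2; apply Hvert in A2; lia|].
  intros B3 s3 Hs3 Hip3.
  apply (runs_REQUIRE rYt yt); auto; [lia|apply Hs3|lia|intros A1 A2; apply Hvert in A2; lia|].
  intros B4 s4 Hs4 Hip4.
  apply runs_seq; auto. apply runs_VALID; auto; [lia|]. intros s5 (Fn & Fp & _) Hip5 Hbad.
  assert (Hs5 : base_st s5).
  { destruct Hs4 as (A1 & A2 & A3 & A4 & A5 & A6 & A7 & A8 & A9 & A10).
    repeat split; rewrite ?Fn, ?Fp by (cbn; lia); auto. }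
  assert (Z5 : num s5 rZero = 0) by apply Hs5.
  apply runs_if; auto; cbn [test_val]; rewrite Z5; intros Ht.
  - apply Nat.eqb_eq, Hbad in Ht. destruct Ht as [Ht1 Ht2].
    pose proof (decode w n xs ys xt yt u1 u2 u3 u4 u5 Ht1 Ht2) as Hw.
    eapply runs_SOLVE; eauto.
  - apply Nat.eqb_neq in Ht. apply runs_do; [exact Logic.I|]. right. split; [|reflexivity].
    intros (G & s' & t' & _ & _ & Hw & _). destruct (instance_unique _ _ _ Hw) as (En & -> & ->).
    apply Ht, Hbad. eapply instance_cells; eauto.
Qed.

End Instance.

Lemma SETUP_wn r : wn (SETUP K C) r -> r = rLen \/ r = rC.
Proof.
  assert (HPN : forall c r, ~ wn (PINCS pW c) r) by (induction c; cbn; intros r'; [tauto|specialize (IHc r'); tauto]).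
  cbn -[NEST PINCS]. intros H. repeat destruct H as [H|H]; try lia;
    exfalso; first [exact (NEST_wn _ _ _ H)|exact (HPN _ _ H)].
Qed.

Lemma SETUP_wp p : wp (SETUP K C) p -> p < 2 \/ 10 <= p.
Proof.
  assert (HPW : forall c p, wp (PINCS pW c) p -> p = pW).
  { induction c; cbn; [tauto|]. intros q [|]; auto. }
  cbn -[NEST PINCS]. intros H. repeat destruct H as [H|H]; try lia;
    first [apply NEST_wp in H|apply HPW in H]; lia.
Qed.

Lemma header_blocks : LGGR w -> exists n xs ys xt yt,
  ublock w 0 n /\ ublock w (n + 1) xs /\ ublock w (n + 1 + (xs + 1)) ys /\
  ublock w (n + 1 + (xs + 1) + (ys + 1)) xt /\
  ublock w (n + 1 + (xs + 1) + (ys + 1) + (xt + 1)) yt.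
Proof.
  intros (G & [a1 a2] & [a3 a4] & _ & _ & Hw & _). exists (lgg_n G), a1, a2, a3, a4.
  rewrite <- Hw. apply enc_header.
Qed.

Theorem runs_MAIN : runs (MAIN K C) init_st verdict.
Proof.
  apply runs_seq; auto. apply runs_SETUP; auto. intros s0 (Fn & Fp & _) HB HW HL Hip.
  assert (F0 : num s0 rFlag = 0) by (rewrite Fn; [reflexivity|intros hh; apply SETUP_wn in hh; lia]).
  assert (Z0 : num s0 rZero = 0) by (rewrite Fn; [reflexivity|intros hh; apply SETUP_wn in hh; lia]).
  assert (PZ : ptr s0 pZ = 0) by (rewrite Fp; [reflexivity|intros hh; apply SETUP_wp in hh; lia]).
  clear Fn Fp.
  apply runs_PARSE; [lia| |].
  2:{ intros Hno s' N. right. split; [|rewrite N by lia; auto].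
      intros HL'. destruct (header_blocks HL') as (n & xs & ys & xt & yt & A1 & _). rewrite Hip in Hno. eapply Hno; eauto. }
  intros n s1 U1 R1 N1 P1 I1 L1 _. rewrite Hip in *. cbn [Nat.add] in I1.
  apply runs_PARSE; [lia| |].
  2:{ intros Hno s' N. right. split; [|rewrite N, N1 by lia; auto].
      intros HL'. destruct (header_blocks HL') as (n' & xs & ys & xt & yt & A1 & A2 & _).
      rewrite (ublock_unique _ _ _ _ A1 U1) in *. rewrite I1 in Hno. eapply Hno; eauto. }
  intros xs s2 U2 R2 N2 P2 I2 L2 _. rewrite I1 in *.
  apply runs_PARSE; [lia| |].
  2:{ intros Hno s' N. right. split; [|rewrite N, N2, N1 by lia; auto].
      intros HL'. destruct (header_blocks HL') as (n' & xs' & ys & xt & yt & A1 & A2 & A3 & _).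
      rewrite (ublock_unique _ _ _ _ A1 U1) in *. rewrite (ublock_unique _ _ _ _ A2 U2) in *.
      rewrite I2 in Hno. eapply Hno; eauto. }
  intros ys s3 U3 R3 N3 P3 I3 L3 _. rewrite I2 in *.
  apply runs_PARSE; [lia| |].
  2:{ intros Hno s' N. right. split; [|rewrite N, N3, N2, N1 by lia; auto].
      intros HL'. destruct (header_blocks HL') as (n' & xs' & ys' & xt & yt & A1 & A2 & A3 & A4 & _).
      rewrite (ublock_unique _ _ _ _ A1 U1) in *. rewrite (ublock_unique _ _ _ _ A2 U2) in *.
      rewrite (ublock_unique _ _ _ _ A3 U3) in *.
      rewrite I3 in Hno. eapply Hno; eauto. }
  intros xt s4 U4 R4 N4 P4 I4 L4 _. rewrite I3 in *.
  apply runs_PARSE; [lia| |].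
  2:{ intros Hno s' N. right. split; [|rewrite N, N4, N3, N2, N1 by lia; auto].
      intros HL'. destruct (header_blocks HL') as (n' & xs' & ys' & xt' & yt & A1 & A2 & A3 & A4 & A5).
      rewrite (ublock_unique _ _ _ _ A1 U1) in *. rewrite (ublock_unique _ _ _ _ A2 U2) in *.
      rewrite (ublock_unique _ _ _ _ A3 U3) in *. rewrite (ublock_unique _ _ _ _ A4 U4) in *.
      rewrite I4 in Hno. eapply Hno; eauto. }
  intros yt s5 U5 R5 N5 P5 I5 L5 _. rewrite I4 in *.
  apply (runs_BODY n xs ys xt yt); auto.
  repeat split; rewrite ?P5, ?P4, ?P3, ?P2, ?P1; auto.
  - rewrite N5, N4, N3, N2, N1 by lia. auto.
  - rewrite N5, N4, N3, N2 by lia. auto.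
  - rewrite N5, N4, N3, N2, N1 by lia. auto.
  - rewrite N5, N4, N3 by lia. auto.
  - rewrite N5, N4 by lia. auto.
  - rewrite N5 by lia. auto.
Qed.

End Main.

(** * Resource bounds *)

(** With [q = b / K] one has [b <= K * 2 ^ q]; raise this to the power [K] and use [K * q <= b]. *)
Lemma pow_le_exp b K : 1 <= K -> b ^ K <= K ^ K * 2 ^ b.
Proof.
  intros HK. set (q := b / K).
  assert (Hb : b <= K * 2 ^ q).
  { pose proof (Nat.div_mod_eq b K). pose proof (Nat.mod_upper_bound b K ltac:(lia)).
    assert (S q <= 2 ^ q) by (apply Nat.pow_gt_lin_r; lia). fold q in H. nia. }
  apply Nat.le_trans with ((K * 2 ^ q) ^ K); [apply Nat.pow_le_mono_l; auto|].
  rewrite Nat.pow_mul_l, <- Nat.pow_mul_r. apply Nat.mul_le_mono_l. apply Nat.pow_le_mono_r; [lia|].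
  rewrite Nat.mul_comm. apply Nat.Div0.mul_div_le.
Qed.

(** The origin of [C]: a constant depending on [K] alone for which [b + C] bits suffice for every
    [b]. *)
Lemma exp_dominates K b : 1 <= K -> 2 * b ^ K + 4 < 2 ^ (b + (2 * K ^ K + 4)).
Proof.
  intros HK. pose proof (pow_le_exp b K HK). rewrite Nat.pow_add_r.
  assert (2 * K ^ K + 4 < 2 ^ (2 * K ^ K + 4)) by (apply Nat.pow_gt_lin_r; lia).
  pose proof (Nat.pow_nonzero 2 b ltac:(lia)). nia.
Qed.

Lemma least_root l K : 1 <= K -> exists b, l <= b ^ K /\ forall b', b' < b -> b' ^ K < l.
Proof.
  intros HK. destruct (least_stop (fun b => l <=? b ^ K) l) as (b & _ & H1 & H2).
  - apply Nat.leb_le. destruct (Nat.eq_dec l 0) as [->|]; [lia|].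
    rewrite <- (Nat.pow_1_r l) at 1. apply Nat.pow_le_mono_r; lia.
  - exists b. split; [now apply Nat.leb_le|]. intros b' Hb. apply H2 in Hb. now apply Nat.leb_gt.
Qed.

Lemma time_bound e m V n t :
  5 <= m -> n <= m ^ e -> V <= m * m -> t <= n * (2 * V + 2) + 2 -> t <= m ^ (e + 4).
Proof.
  intros Hm Hn HV Ht. rewrite Nat.pow_add_r.
  pose proof (Nat.pow_nonzero m e ltac:(lia)).
  assert (A1 : n * (2 * V + 2) <= m ^ e * (2 * (m * m) + 2)) by (apply Nat.mul_le_mono; lia).
  assert (A2 : 2 * (m * m) + 4 <= m ^ 4).
  { change (m ^ 4) with (m * (m * (m * (m * 1)))).
    assert (5 * 5 <= m * m) by (apply Nat.mul_le_mono; lia).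
    assert (25 * (m * m) <= (m * m) * (m * m)) by (apply Nat.mul_le_mono; lia). lia. }
  assert (A3 : m ^ e * (2 * (m * m) + 4) <= m ^ e * m ^ 4) by (apply Nat.mul_le_mono_l; auto). lia.
Qed.

(** [beta ^ 2 <= beta ^ (K * eps) = (beta ^ K) ^ eps <= l ^ eps]. *)
Lemma square_le_Rpower beta K l eps :
  1 <= beta -> beta ^ K < l -> (2 <= INR K * eps)%R -> (0 < eps)%R ->
  (INR (beta * beta) <= Rpower (INR l) eps)%R.
Proof.
  intros Hb Hl HK He.
  assert (H1 : (1 <= INR beta)%R) by (apply (le_INR 1); auto).
  replace (INR (beta * beta)) with (Rpower (INR beta) 2).
  - apply Rle_trans with (Rpower (INR beta) (INR K * eps)); [apply Rle_Rpower; auto|].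
    rewrite <- Rpower_mult, Rpower_pow by lra. apply Rle_Rpower_l; [lra|].
    rewrite <- pow_INR. split; [|apply le_INR; lia].
    apply lt_0_INR. pose proof (Nat.pow_nonzero beta K ltac:(lia)). lia.
  - replace 2%R with (INR 2) by reflexivity. rewrite Rpower_pow by lra. rewrite mult_INR. cbn. ring.
Qed.

Theorem theorem3 : near_SC LGGR.
Proof.
  (* The arrays fill about [b ^ 2] cells, so [b] may be about [|w| ^ (eps / 2)]; hence
     [K > 2 / eps]. *)
  intros eps Heps. destruct (INR_unbounded (2 / eps)) as [K HK].
  assert (HKe : (2 <= INR K * eps)%R).
  { apply Rmult_gt_compat_r with (r := eps) in HK; [|auto].
    unfold Rdiv in HK. rewrite Rmult_assoc, Rinv_l in HK by lra. lra. }
  assert (K1 : 1 <= K).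
  { destruct K; [|lia]. cbn in HKe. lra. }
  set (C := 2 * K ^ K + 4). set (e := wt (MAIN K C)).
  exists (compiled (MAIN K C)). split; [apply compiled_wf|].
  (* The factor [C + 6] absorbs [m = |w| + C + 5 <= (C + 6) * |w|], and the threshold 2 on the
     length forces [b >= 2]. *)
  exists (e + 4), ((C + 6) ^ (e + 4)), 2, (INR ((C + 4) * (C + 4))). intros w.
  destruct (least_root (length w) K K1) as (b & Hroot & Hleast).
  (* Room for [b] marks of [b + C] bits each. *)
  set (V := (b + 1) * (b + C + 1)). set (m := length w + C + 5).
  destruct (runs_MAIN V w m K C b K1 Hroot Hleast (le_n _) (le_n _) (exp_dominates K b K1))
    as (s & n & Hex & Hn & Hv).
  destruct (compile_correct _ _ _ _ _ Hex) as (t & Ht & Hspace & Hst).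
  exists t. cbn [q_acc q_rej compiled machine] in *. unfold halted. cbn [q_acc q_rej compiled machine].
  split; [|split].
  - rewrite Hst. destruct (Nat.testbit (num s 0) 0); auto.
  - rewrite Hst. destruct Hv as [[H1 ->]|[H1 ->]]; cbn; split; auto; try discriminate. tauto.
  - intros Hlen.
    assert (HbL : b <= length w).
    { destruct (le_lt_dec b (length w)) as [|hh]; auto. apply Hleast in hh.
      assert (length w ^ 1 <= length w ^ K) by (apply Nat.pow_le_mono_r; lia). rewrite Nat.pow_1_r in *. lia. }
    split.
    + apply Nat.le_trans with (m ^ (e + 4)).
      * apply (time_bound e m V n); auto; [lia|]. unfold V. apply Nat.mul_le_mono; lia.
      * rewrite <- Nat.pow_mul_l. apply Nat.pow_le_mono_l. unfold m. nia.
    + intros t' Ht'. specialize (Hspace t' Ht').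
      assert (Hb2 : 2 <= b).
      { destruct b as [|[|]]; [rewrite Nat.pow_0_l in Hroot by lia; lia|rewrite Nat.pow_1_l in Hroot; lia|lia]. }
      (* Minimality of [b] bounds only [b - 1] by a root of [|w|]; as [b - 1 >= 1], passing from [b]
         to [b - 1] costs a constant factor. *)
      set (beta := b - 1).
      assert (Hbeta : beta ^ K < length w) by (apply Hleast; lia).
      assert (HV : S V <= (C + 4) * (C + 4) * (beta * beta)).
      { replace ((C + 4) * (C + 4) * (beta * beta)) with ((C + 4) * beta * ((C + 4) * beta)) by lia.
        apply Nat.le_trans with ((b + C + 2) * (b + C + 2)); [unfold V; nia|].
        assert (b + C + 2 <= (C + 4) * beta) by (unfold beta; nia).
        apply Nat.mul_le_mono; auto. }
      apply Rle_trans with (INR ((C + 4) * (C + 4) * (beta * beta))); [apply le_INR; lia|].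
      rewrite mult_INR. apply Rmult_le_compat_l; [apply pos_INR|].
      apply square_le_Rpower with (K := K); auto. lia.
Qed.
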